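(* Let $\mathcal{N}$ be a compact Riemannian submanifold of $\mathbb{R}^m$, let $\omega\subset\mathbb{T}^1$ be a nonempty open set, and let $T>0$. Let $\gamma_0:\mathbb{T}^1\to\mathcal{N}$ and $\gamma_1:\mathbb{T}^1\to\mathcal{N}$ be two harmonic maps which are in the same connected component of $C^0(\mathbb{T}^1;\mathcal{N})$. Then there exists a control $f\in L^\infty(0,T;L^2(\mathbb{T}^1))$ which steers the controlled harmonic map heat flow $$u_t-u_{xx}=\beta_u(u_x,u_x)+\mathbf{1}_\omega f^{u^\perp}$$ from $\gamma_0$ to $\gamma_1$ during the time interval $[0,T]$, i.e. the solution $u:[0,T]\times\mathbb{T}^1\to\mathcal{N}$ with $u(0,\cdot)=\gamma_0$ satisfies $u(T,\cdot)=\gamma_1$.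
   Context: $\mathbb{T}^1=\mathbb{R}/2\pi\mathbb{Z}$. $\mathcal{N}\subset\mathbb{R}^m$ carries the metric induced by the Euclidean one. Controls take values in $\mathbb{R}^m$, and $f^{u^\perp}$ denotes the orthogonal projection of $f$ onto the tangent space $T_u\mathcal{N}\subset\mathbb{R}^m$. $\beta$ is the second fundamental form of $\mathcal{N}$, normal-valued, with the sign convention that a map $\gamma:\mathbb{T}^1\to\mathcal{N}$ is harmonic if and only if $-\gamma_{xx}=\beta_\gamma(\gamma_x,\gamma_x)$, equivalently $\gamma_{xx}\perp T_\gamma\mathcal{N}$ (closed constant-speed geodesics, including constants); for $\mathcal{N}=\mathbb{S}^k$ one has $\beta_u(u_x,u_x)=|u_x|^2u$. $\mathbf{1}_\omega$ is the characteristic function of $\omega$. *)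

(* Defs.v *)
From HB Require Import structures.
From mathcomp Require Import all_boot all_order all_algebra.
From mathcomp Require Import all_classical all_reals all_analysis.

Set Implicit Arguments.
Unset Strict Implicit.
Unset Printing Implicit Defensive.

Import Order.TTheory GRing.Theory Num.Theory.
Import numFieldNormedType.Exports.

Local Open Scope classical_set_scope.
Local Open Scope ring_scope.

(* The library norm on 'rV_m is the sup norm: Euclidean quantities (orthogonal
   projections, L^2 norms) go through [dot]. *)
Definition dot {R : realType} {m : nat} (v w : 'rV[R]_m) : R :=
  \sum_(i < m) v 0 i * w 0 i.

(* C^oo on U: every iterated directional derivative is differentiable, hence
   continuous, at every point of U. *)
Definition smooth_on {R : realType} {V W : normedModType R}
    (U : set V) (F : V -> W) : Prop :=
  forall (s : seq V) (x : V), U x ->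
    differentiable (foldr (fun v G => 'D_v G) F s) x.

(* Embedded submanifold of R^m without boundary, of codimension c: locally the
   zero set of a smooth submersion onto R^c. *)
Definition is_submanifold {R : realType} {m : nat} (N : set 'rV[R]_m) : Prop :=
  exists c : nat, forall p, N p ->
    exists (U : set 'rV[R]_m) (F : 'rV[R]_m -> 'rV[R]_c),
      [/\ open U, U p, smooth_on U F,
          (forall q, U q -> (N q <-> F q = 0)) &
          (forall q, U q -> N q -> \rank ('J F q) = c)].

(* Velocities at p of smooth curves in N. *)
Definition tangent_space {R : realType} {m : nat} (N : set 'rV[R]_m)
    (p : 'rV[R]_m) : set 'rV[R]_m :=
  [set v | exists (J : set R) (c : R -> 'rV[R]_m),
    [/\ open J, J 0, smooth_on J c, (forall t, J t -> N (c t)) &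
        c 0 = p /\ derive1 c 0 = v]].

Definition tangent_proj {R : realType} {m : nat} (N : set 'rV[R]_m)
    (p v : 'rV[R]_m) : 'rV[R]_m :=
  get [set w | tangent_space N p w /\
    forall z, tangent_space N p z -> dot (v - w) z = 0].

(* beta_p(v, w) = - (D_v W)^normal, where W is any smooth local extension of w
   that is tangent to N along N.  With this sign, beta_p(v, v) = |v|^2 p on the
   unit sphere.  Meaningful for v, w in the tangent space at p in N. *)
Definition second_fund_form {R : realType} {m : nat} (N : set 'rV[R]_m)
    (p v w : 'rV[R]_m) : 'rV[R]_m :=
  get [set n | exists (U : set 'rV[R]_m) (W : 'rV[R]_m -> 'rV[R]_m),
    [/\ open U /\ U p, smooth_on U W, W p = w,
        (forall q, U q -> N q -> tangent_space N q (W q)) &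
        n = - ('D_v W p - tangent_proj N p ('D_v W p))]].

(* Functions on T^1 = R / 2 pi Z are 2pi-periodic functions on R. *)
Definition circle_fun {R : realType} {V : Type} (g : R -> V) : Prop :=
  forall x, g (x + pi *+ 2) = g x.

(* C^0(T^1; N), inside the functions R -> R^m with the topology of uniform
   convergence. *)
Definition C0_circle {R : realType} {m : nat} (N : set 'rV[R]_m) :
    set {uniform R -> 'rV[R]_m} :=
  [set g : {uniform R -> 'rV[R]_m} |
    [/\ circle_fun (g : R -> 'rV[R]_m), continuous (g : R -> 'rV[R]_m) &
        forall x : R, N (g x)]].

(* Twice differentiable maps suffice: the equation then gives smoothness. *)
Definition harmonic_map {R : realType} {m : nat} (N : set 'rV[R]_m)
    (g : R -> 'rV[R]_m) : Prop :=
  [/\ circle_fun g, (forall x, N (g x)),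
      (forall x, derivable g x 1), (forall x, derivable (derive1 g) x 1) &
      forall x, - derive1n 2 g x = second_fund_form N (g x) (derive1 g x) (derive1 g x)].

Definition sqnorm_L2 {R : realType} {m : nat} (g : R -> 'rV[R]_m) : \bar R :=
  (\int[lebesgue_measure]_(x in `[0%R, (pi *+ 2)%R]) (dot (g x) (g x))%:E)%E.

Definition in_L2 {R : realType} {m : nat} (g : R -> 'rV[R]_m) : Prop :=
  [/\ circle_fun g, (forall i, measurable_fun setT (fun x => g x 0 i)) &
      (sqnorm_L2 g < +oo)%E].

(* g is the continuous representative of an element of H^1(T^1; R^m), with weak
   derivative dg. *)
Definition H1_deriv {R : realType} {m : nat} (g dg : R -> 'rV[R]_m) : Prop :=
  [/\ circle_fun g, in_L2 dg &
      forall (x y : R) (i : 'I_m), x <= y ->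
        g y 0 i - g x 0 i = \int[lebesgue_measure]_(z in `[x, y]) dg z 0 i].

Definition time_circle_measurable {R : realType} {m : nat} (T : R)
    (g : R -> R -> 'rV[R]_m) : Prop :=
  (forall t : R, 0 < t < T -> circle_fun (g t)) /\
  forall i, measurable_fun (`]0, T[ `*` setT) (fun z : R * R => g z.1 z.2 0 i).

(* L^2(0, T; L^2(T^1)) *)
Definition in_L2L2 {R : realType} {m : nat} (T : R)
    (g : R -> R -> 'rV[R]_m) : Prop :=
  time_circle_measurable T g /\
  (\int[lebesgue_measure]_(t in `]0%R, T[) sqnorm_L2 (g t) < +oo)%E.

(* L^oo(0, T; L^2(T^1)) *)
Definition in_LooL2 {R : realType} {m : nat} (T : R)
    (g : R -> R -> 'rV[R]_m) : Prop :=
  time_circle_measurable T g /\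
  exists M : R, {ae (@lebesgue_measure R), forall t,
    0 < t < T -> (sqnorm_L2 (g t) <= M%:E)%E}.

(* Strong solutions, in the energy class
     C([0,T]; H^1) `&` L^2(0,T; H^2) `&` H^1(0,T; L^2),
   of u_t - u_xx = beta_u(u_x, u_x) + 1_omega f^{u^perp}; ut, ux, uxx are the
   weak derivatives of u. *)
Record strong_solution {R : realType} {m : nat} (N : set 'rV[R]_m)
    (omega : set R) (T : R) (f u ut ux uxx : R -> R -> 'rV[R]_m) : Prop := {
  sol_target : forall t x : R, 0 <= t <= T -> N (u t x);
  sol_ux : forall t : R, 0 <= t <= T -> H1_deriv (u t) (ux t);
  sol_ux_measurable : time_circle_measurable T ux;
  sol_C0H1 : forall t0 : R, 0 <= t0 <= T ->
    (fun t : R => (sqnorm_L2 (fun x => u t x - u t0 x)%R +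
                 sqnorm_L2 (fun x => ux t x - ux t0 x)%R)%E)
      @ within `[0, T] (nbhs t0) --> 0%E;
  sol_uxx : {ae (@lebesgue_measure R), forall t,
    0 < t < T -> H1_deriv (ux t) (uxx t)};
  sol_uxx_L2 : in_L2L2 T uxx;
  sol_ut : forall s t : R, 0 <= s -> s <= t -> t <= T ->
    {ae (@lebesgue_measure R), forall x, forall i,
      u t x 0 i - u s x 0 i
      = \int[lebesgue_measure]_(r in `]s, t[) ut r x 0 i};
  sol_ut_L2 : in_L2L2 T ut;
  sol_eq : {ae ((@lebesgue_measure R) \x (@lebesgue_measure R))%E,
    forall z : R * R, 0 < z.1 < T ->
      ut z.1 z.2 - uxx z.1 z.2
      = second_fund_form N (u z.1 z.2) (ux z.1 z.2) (ux z.1 z.2)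
        + \1_omega z.2 *: tangent_proj N (u z.1 z.2) (f z.1 z.2)}
}.

Definition is_solution {R : realType} {m : nat} (N : set 'rV[R]_m)
    (omega : set R) (T : R) (f u : R -> R -> 'rV[R]_m) : Prop :=
  exists ut ux uxx : R -> R -> 'rV[R]_m,
    strong_solution N omega T f u ut ux uxx.

(* Main.v *)
(* Every C^2 loop b in N can be pinched: traverse it within a small arc of omega
   and stay at b(xs) on the rest of the circle.  A harmonic map gamma
   reaches its own pinched version and back, because gamma (xs + phi (t, y)) has
   normal heat residual as soon as phi is a scalar solution of the heat
   equation; phi is a Gevrey flat-output solution joining y to 0, or 0 to y, in
   finite time.  Two pinched loops coming from uniformly close b and b' are
   joined in two moves: the constant b(xs) is driven to b'(xs) along a geodesic of
   N (again through a scalar heat solution, from 0 to 1), and then the loops,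
   which coincide away from omega, are interpolated linearly and projected back to
   N.  Since C^2 loops are uniformly dense in C^0(T^1; N), the set of continuous
   loops having a uniformly close C^2 loop whose pinching is reachable from gamma0
   is open and closed, and therefore contains gamma1.  The control is
   f := u_t - u_xx, whose tangential part vanishes off omega. *)

From HB Require Import structures.
Require Import Defs.
From mathcomp Require Import all_boot all_order all_algebra.
From mathcomp Require Import all_classical all_reals all_analysis.
From mathcomp Require Import ring lra zify perm measurable_realfun.
From mathcomp Require finmap.
Import Order.TTheory GRing.Theory Num.Theory.
Import numFieldNormedType.Exports.
Local Open Scope classical_set_scope.
Local Open Scope ring_scope.

Set Implicit Arguments.
Unset Strict Implicit.
Unset Printing Implicit Defensive.

(** * Smooth maps *)

Section Differentiability.
Context {R : realType}.
Implicit Types V W : normedModType R.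

(** Off omega nothing is controlled, so a homotopy of loops cannot simply be followed: its heat
    residual must be normal there. Two kinds of maps comply: constants, and compositions of a
    geodesic [sg] with a scalar function phi, whose residual is (phi_t - phi_yy) sg' - phi_y^2 sg''
    with sg'' normal. Pinching leaves only constants off omega, while inside omega the control
    absorbs any residual; this is what lets arbitrary C^2 loops serve as intermediate states. Since
    phi lives on a line cut at a point of omega, it need not be periodic.

    A heat solution joining 0 to 1 may leave [0, 1], by an amount that depends on the time allowed.
    Geodesics are therefore extended to [-M, M] for arbitrary M, and the closeness required of two
    loops is fixed before M. Reachability then holds in every positive time, so that any finite
    number of moves fits into [0, T]; the profiles are stationary before and after each move, hence
    successive moves join smoothly. *)

Lemma differentiable_epsilon V W (f : V -> W) (L : {linear V -> W}) (x : V) :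
  continuous L ->
  (forall e, 0 < e -> \forall h \near 0, `|f (h + x) - f x - L h| <= e * `|h|) ->
  differentiable f x /\ 'd f x = L :> (V -> W).
Proof.
move=> cL H.
have E : f \o shift x = cst (f x) + L +o_ 0 id.
  apply/eqaddoP => e e0; near=> h.
  rewrite /= !fctE /= opprD addrA; near: h; exact: H.
have D := diff_unique cL E.
split=> //; apply/diff_locallyP; split; first by rewrite D.
by rewrite D.
Unshelve. all: by end_near. Qed.

Lemma differentiable_near V W (f g : V -> W) (x : V) :
  (\near x, f x = g x) -> differentiable f x -> differentiable g x.
Proof.
move=> fg df.
have [] := @differentiable_epsilon V W g ('d f x) x.
- exact: diff_continuous.
- move=> e e0; have /diff_locally /eqaddoP /(_ e e0) := df.
  have fg0 : \forall h \near 0, f (h + x) = g (h + x).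
    by move: fg; rewrite (near_shift 0) subr0; apply: filterS => h.
  apply: filter_app; near=> h.
  rewrite /= !fctE /= opprD addrA -(nbhs_singleton fg).
  by rewrite (near fg0 h).
- by [].
Unshelve. all: by end_near. Qed.

Lemma differentiable_components V n (f : V -> 'rV[R]_n) (x : V) :
  (forall i, differentiable (fun y => f y 0 i) x) -> differentiable f x.
Proof.
move=> H.
have -> : f = \sum_(i < n) (fun y => f y 0 i *: delta_mx 0 i).
  apply/funext => y; rewrite fct_sumE /=; apply/rowP => j.
  rewrite summxE (bigD1 j)//= !mxE !eqxx mulr1 big1 ?addr0// => i ij.
  by rewrite !mxE/= eq_sym (negbTE ij) mulr0.
by apply: differentiable_sum => i; exact: differentiableZl.
Qed.

Lemma differentiable_component V n (f : V -> 'rV[R]_n) (x : V) i :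
  differentiable f x -> differentiable (fun y => f y 0 i) x.
Proof.
move=> df; apply: (@differentiable_comp _ _ _ _ f (fun N : 'rV[R]_n => N 0 i)) => //.
exact: differentiable_coord.
Qed.

Lemma derive_component V n (f : V -> 'rV[R]_n) (x v : V) i :
  derivable f x v -> 'D_v (fun y => f y 0 i) x = 'D_v f x 0 i.
Proof. by move=> df; rewrite derive_mx// mxE. Qed.

Lemma derive_comp_diff (U : normedModType R) V W (f : U -> V) (g : V -> W) x v :
  differentiable f x -> differentiable g (f x) ->
  'D_v (g \o f) x = 'D_('D_v f x) g (f x).
Proof.
move=> df dg; rewrite deriveE; last exact: differentiable_comp.
by rewrite diff_comp//= !deriveE.
Qed.

Lemma deriveZ_dir V W (f : V -> W) x (a : R) v :
  differentiable f x -> 'D_(a *: v) f x = a *: 'D_v f x.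
Proof. by move=> df; rewrite !deriveE// linearZ. Qed.

Lemma derive_rV_dir n W (f : 'rV[R]_n -> W) x v :
  differentiable f x -> 'D_v f x = \sum_(i < n) v 0 i *: 'D_(delta_mx 0 i) f x.
Proof.
move=> df; rewrite deriveE// [X in 'd f x X]row_sum_delta linear_sum.
by apply: eq_bigr => i _; rewrite linearZ deriveE.
Qed.

End Differentiability.

Section Smooth.
Context {R : realType}.
Implicit Types V W : normedModType R.

(** Smoothness graded by order. Products and compositions at order k+1 differentiate into products
    at order k, so their smoothness follows by induction on k; an induction on the list of
    directions in [smooth_on] would not close. *)
Fixpoint smooth_upto V W (k : nat) (U : set V) (F : V -> W) : Prop :=
  (forall x, U x -> differentiable F x) /\
  if k is k'.+1 then forall v, smooth_upto k' U ('D_v F) else True.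

Lemma smooth_upto_diff V W k (U : set V) (F : V -> W) x :
  smooth_upto k U F -> U x -> differentiable F x.
Proof. by case: k => [|k] [+ _]; exact. Qed.

Lemma smooth_onP V W (U : set V) (F : V -> W) :
  smooth_on U F <-> forall k, smooth_upto k U F.
Proof.
split.
  move=> sF k; elim: k F sF => [|k IH] F sF; split=> //.
  - exact: (sF [::]).
  - exact: (sF [::]).
  - by move=> v; apply: IH => s x Ux; have := sF (rcons s v) x Ux; rewrite foldr_rcons.
move=> sF s; elim/last_ind: s F sF => [|s v IH] F sF x Ux.
  exact: smooth_upto_diff (sF 0%N) Ux.
by rewrite foldr_rcons; apply: IH => // k; have [_ +] := sF k.+1; apply.
Qed.

Lemma smooth_on_diff V W (U : set V) (F : V -> W) x :
  smooth_on U F -> U x -> differentiable F x.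
Proof. by move=> sF; exact: (sF [::]). Qed.

Lemma smooth_on_derive V W (U : set V) (F : V -> W) v :
  smooth_on U F -> smooth_on U ('D_v F).
Proof. by move=> sF s x Ux; have := sF (rcons s v) x Ux; rewrite foldr_rcons. Qed.

Lemma smooth_on_sub V W (A B : set V) (F : V -> W) :
  A `<=` B -> smooth_on B F -> smooth_on A F.
Proof. by move=> AB sF s x /AB; exact: sF. Qed.

Lemma smooth_on_local V W (U : set V) (F : V -> W) :
  (forall x, U x -> exists2 A, A x & smooth_on A F) -> smooth_on U F.
Proof. by move=> H s x /H[A Ax]; exact. Qed.

Lemma smooth_upto_pred V W k (U : set V) (F : V -> W) :
  smooth_upto k.+1 U F -> smooth_upto k U F.
Proof.
elim: k F => [|k IH] F [dF sF]; split=> //.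
by move=> v; exact: (IH _ (sF v)).
Qed.

Section OpenDomain.
Variables (V : normedModType R) (U : set V).
Hypothesis openU : open U.

Lemma derive_eq_on W (F G : V -> W) v :
  {in U, F =1 G} -> {in U, 'D_v F =1 'D_v G}.
Proof.
move=> FG x; rewrite inE => Ux; apply: near_eq_derive.
by apply: filterS (open_nbhs_nbhs (conj openU Ux)) => y Uy; apply: FG; rewrite inE.
Qed.

Lemma smooth_upto_eq W k (F G : V -> W) :
  {in U, F =1 G} -> smooth_upto k U F -> smooth_upto k U G.
Proof.
have D : forall (F G : V -> W), {in U, F =1 G} ->
    forall x, U x -> differentiable F x -> differentiable G x.
  move=> {}F {}G FG x Ux; apply: differentiable_near.
  by apply: filterS (open_nbhs_nbhs (conj openU Ux)) => y Uy; apply: FG; rewrite inE.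
elim: k F G => [|k IH] F G FG [dF sF]; split=> //; try by move=> x Ux; apply: (D _ _ FG) => //; exact: dF.
by move=> v; exact: (IH _ _ (derive_eq_on v FG) (sF v)).
Qed.

Lemma smooth_on_eq W (F G : V -> W) :
  {in U, F =1 G} -> smooth_on U F -> smooth_on U G.
Proof. by move=> FG /smooth_onP sF; apply/smooth_onP => k; exact: smooth_upto_eq (sF k). Qed.

Lemma smooth_upto_cst W k (c : W) : smooth_upto k U (cst c).
Proof.
elim: k c => [|k IH] c; split=> //; try by move=> x _; exact: differentiable_cst.
by move=> v; apply: (@smooth_upto_eq _ _ (cst 0)) => // x _; rewrite derive_cst.
Qed.

Lemma smooth_upto_add W k (F G : V -> W) :
  smooth_upto k U F -> smooth_upto k U G -> smooth_upto k U (F + G).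
Proof.
elim: k F G => [|k IH] F G [dF sF] [dG sG]; split=> //;
  try by move=> x Ux; apply: differentiableD; [exact: dF|exact: dG].
move=> v; apply: (@smooth_upto_eq _ _ ('D_v F + 'D_v G)); last exact: (IH _ _ (sF v) (sG v)).
move=> x; rewrite inE => Ux; rewrite deriveD//.
- by apply: diff_derivable; exact: dF.
- by apply: diff_derivable; exact: dG.
Qed.

Lemma smooth_upto_mul k (F G : V -> R) :
  smooth_upto k U F -> smooth_upto k U G -> smooth_upto k U (F * G).
Proof.
elim: k F G => [|k IH] F G sF sG; have [dF sF'] := sF; have [dG sG'] := sG; split=> //;
  try by move=> x Ux; apply: differentiableM; [exact: dF|exact: dG].
move=> v; apply: (@smooth_upto_eq _ _ (F * 'D_v G + G * 'D_v F)).
  move=> x; rewrite inE => Ux; rewrite deriveM//.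
  - by apply: diff_derivable; exact: dF.
  - by apply: diff_derivable; exact: dG.
apply: smooth_upto_add.
  exact: (IH _ _ (smooth_upto_pred sF) (sG' v)).
exact: (IH _ _ (smooth_upto_pred sG) (sF' v)).
Qed.

Lemma smooth_upto_sum k (I : Type) (r : seq I) (P : pred I) (F : I -> V -> R) :
  (forall i, P i -> smooth_upto k U (F i)) ->
  smooth_upto k U (fun x => \sum_(i <- r | P i) F i x).
Proof.
move=> H; elim: r => [|i r IH].
  apply: (@smooth_upto_eq _ _ (cst 0)); last exact: smooth_upto_cst.
  by move=> x _; rewrite big_nil.
case Pi: (P i); last first.
  by apply: smooth_upto_eq IH => x _; rewrite big_cons Pi.
apply: (@smooth_upto_eq _ _ (F i + (fun x => \sum_(i <- r | P i) F i x))).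
  by move=> x _; rewrite big_cons Pi.
by apply: smooth_upto_add => //; exact: H.
Qed.

Lemma smooth_upto_prod k (I : Type) (r : seq I) (P : pred I) (F : I -> V -> R) :
  (forall i, P i -> smooth_upto k U (F i)) ->
  smooth_upto k U (fun x => \prod_(i <- r | P i) F i x).
Proof.
move=> H; elim: r => [|i r IH].
  apply: (@smooth_upto_eq _ _ (cst (1 : R))); last exact: smooth_upto_cst.
  by move=> x _; rewrite big_nil.
case Pi: (P i); last first.
  by apply: smooth_upto_eq IH => x _; rewrite big_cons Pi.
apply: (@smooth_upto_eq _ _ (F i * (fun x => \prod_(i <- r | P i) F i x))).
  by move=> x _; rewrite big_cons Pi.
by apply: smooth_upto_mul => //; exact: H.
Qed.

Lemma smooth_upto_components n k (F : V -> 'rV[R]_n) :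
  smooth_upto k U F <-> forall i, smooth_upto k U (fun x => F x 0 i).
Proof.
elim: k F => [|k IH] F; split.
- by move=> [dF _] i; split=> // x Ux; apply: differentiable_component; exact: dF.
- by move=> H; split=> // x Ux; apply: differentiable_components => i; have [+ _] := H i; exact.
- move=> [dF sF] i; split; first by move=> x Ux; apply: differentiable_component; exact: dF.
  move=> v; apply: (@smooth_upto_eq _ _ (fun x => 'D_v F x 0 i)).
    by move=> x; rewrite inE => Ux; rewrite derive_component//; apply: diff_derivable; exact: dF.
  by have /IH := sF v; exact.
- move=> H; have dF x : U x -> differentiable F x.
    by move=> Ux; apply: differentiable_components => i; have [+ _] := H i; exact.
  split=> // v; apply/IH => i.
  apply: (@smooth_upto_eq _ _ ('D_v (fun x => F x 0 i))).
    by move=> x; rewrite inE => Ux; rewrite derive_component//; apply: diff_derivable; exact: dF.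
  by have [_ +] := H i; exact.
Qed.

(** F stays fixed in the induction: the derivative of 1/F is - (1/F)^2 times that of F, so 1/F at
    order k gives 1/F at order k+1. *)
Lemma smooth_upto_inv k (F : V -> R) :
  (forall x, U x -> F x != 0) ->
  smooth_upto k U F -> smooth_upto k U (fun x => (F x)^-1).
Proof.
move=> F0; elim: k => [|k IH] sF; have [dF sF'] := sF; split=> //;
  try by move=> x Ux; apply: differentiableV; [exact: dF|exact: F0].
move=> v; apply: (@smooth_upto_eq _ _
  ((cst (- 1) * ((fun x => (F x)^-1) * (fun x => (F x)^-1))) * 'D_v F)).
  move=> x; rewrite inE => Ux; rewrite deriveV ?F0//; last by apply: diff_derivable; exact: dF.
  by rewrite !fctE /= expr2 invfM mulN1r.
have sV := IH (smooth_upto_pred sF).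
apply: smooth_upto_mul; last exact: sF'.
by apply: smooth_upto_mul; [exact: smooth_upto_cst|exact: smooth_upto_mul].
Qed.

End OpenDomain.

Lemma smooth_upto_comp V n k (U : set V) (A : set 'rV[R]_n) (F : V -> 'rV[R]_n)
    (G : 'rV[R]_n -> R) :
  open U -> open A -> (forall x, U x -> A (F x)) ->
  smooth_upto k U F -> smooth_upto k A G -> smooth_upto k U (G \o F).
Proof.
move=> oU oA FA; elim: k F G FA => [|k IH] F G FA sF sG;
  have [dF sF'] := sF; have [dG sG'] := sG; split=> //;
  try by move=> x Ux; apply: differentiable_comp; [exact: dF|apply: dG; exact: FA].
move=> v; apply: (@smooth_upto_eq _ _ oU _ _ (fun x => \sum_(i < n)
   ((fun x => 'D_v F x 0 i) * ('D_(delta_mx 0 i) G \o F)) x)).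
  move=> x; rewrite inE => Ux; rewrite derive_comp_diff; first last.
  - by apply: dG; exact: FA.
  - exact: dF.
  by rewrite derive_rV_dir//; apply: dG; exact: FA.
apply: smooth_upto_sum => // i _; apply: smooth_upto_mul => //.
  by have /(smooth_upto_components oU) := sF' v; exact.
exact: (IH _ _ FA (smooth_upto_pred sF) (sG' _)).
Qed.

End Smooth.

Section SmoothOn.
Context {R : realType} (V : normedModType R) (U : set V).
Hypothesis openU : open U.

Lemma smooth_on_cst (W : normedModType R) (c : W) : smooth_on U (cst c).
Proof. by apply/smooth_onP => k; exact: smooth_upto_cst. Qed.

Lemma smooth_on_add (W : normedModType R) (F G : V -> W) :
  smooth_on U F -> smooth_on U G -> smooth_on U (F + G).
Proof.
move=> /smooth_onP sF /smooth_onP sG; apply/smooth_onP => k.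
exact: (smooth_upto_add openU (sF k) (sG k)).
Qed.

Lemma smooth_on_mul (F G : V -> R) :
  smooth_on U F -> smooth_on U G -> smooth_on U (F * G).
Proof.
move=> /smooth_onP sF /smooth_onP sG; apply/smooth_onP => k.
exact: (smooth_upto_mul openU (sF k) (sG k)).
Qed.

Lemma smooth_on_sum (I : Type) (r : seq I) (P : pred I) (F : I -> V -> R) :
  (forall i, P i -> smooth_on U (F i)) ->
  smooth_on U (fun x => \sum_(i <- r | P i) F i x).
Proof.
move=> sF; apply/smooth_onP => k; apply: (smooth_upto_sum openU) => i /sF /smooth_onP; exact.
Qed.

Lemma smooth_on_components n (F : V -> 'rV[R]_n) :
  smooth_on U F <-> forall i, smooth_on U (fun x => F x 0 i).
Proof.
split=> [/smooth_onP sF i|sF]; apply/smooth_onP => k.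
  by have /(smooth_upto_components openU) := sF k; exact.
by apply/(smooth_upto_components openU) => i; have /smooth_onP := sF i; exact.
Qed.

Lemma smooth_on_linear (W : normedModType R) (L : V -> W) (lL : linear L) :
  continuous L -> smooth_on U L.
Proof.
pose f' := GRing.isLinear.Build _ _ _ _ L lL.
pose f : {linear V -> W} := HB.pack L f'.
move=> cL; have dL x : differentiable L x by exact: (@linear_differentiable _ _ _ f).
apply/smooth_onP => -[|k]; split=> // v.
apply: (@smooth_upto_eq _ _ _ openU _ _ (cst (L v))); last exact: smooth_upto_cst.
by move=> x _; rewrite deriveE// (@diff_lin _ _ _ f).
Qed.

End SmoothOn.

Section SmoothComp.
Context {R : realType} (V : normedModType R) (n : nat) (U : set V) (A : set 'rV[R]_n).
Hypotheses (openU : open U) (openA : open A).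

Lemma smooth_on_comp_scalar (F : V -> 'rV[R]_n) (G : 'rV[R]_n -> R) :
  (forall x, U x -> A (F x)) ->
  smooth_on U F -> smooth_on A G -> smooth_on U (G \o F).
Proof.
move=> FA /smooth_onP sF /smooth_onP sG; apply/smooth_onP => k.
exact: (smooth_upto_comp openU openA FA (sF k) (sG k)).
Qed.

Lemma smooth_on_comp p (F : V -> 'rV[R]_n) (G : 'rV[R]_n -> 'rV[R]_p) :
  (forall x, U x -> A (F x)) ->
  smooth_on U F -> smooth_on A G -> smooth_on U (G \o F).
Proof.
move=> FA sF /(smooth_on_components openA) sG; apply/(smooth_on_components openU) => i.
exact: smooth_on_comp_scalar FA sF (sG i).
Qed.

End SmoothComp.

Lemma near_forall (T : topologicalType) (I : finType) (a : T) (P : I -> T -> Prop) :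
  (forall i, \forall x \near a, P i x) -> \forall x \near a, forall i, P i x.
Proof. exact: (@filter_forall T I P (nbhs a)). Qed.

Lemma near_and (T : topologicalType) (a : T) (A B : set T) :
  nbhs a A -> nbhs a B -> nbhs a (A `&` B).
Proof. exact: filterI. Qed.

(** * Sup norm and mean value estimates *)

Section RowNorm.
Context {R : realType}.

Lemma coord_le_norm n (v : 'rV[R]_n) i : `|v 0 i| <= `|v|.
Proof.
rewrite [leRHS]/Num.Def.normr/= mx_normrE.
exact: (@le_bigmax _ _ _ 0 (fun ij : 'I_1 * 'I_n => `|v ij.1 ij.2|) (0, i)).
Qed.

Lemma row_norm_le n (v : 'rV[R]_n) M :
  0 <= M -> (forall i, `|v 0 i| <= M) -> `|v| <= M.
Proof.
move=> M0 H; rewrite [leLHS]/Num.Def.normr/= mx_normrE.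
by apply: bigmax_le => // -[i j] _; rewrite (ord1 i).
Qed.

Lemma mulmx_norm_bound m n (B : 'M[R]_(m, n)) :
  exists2 K, 0 < K & forall v : 'rV[R]_m, `|v *m B| <= K * `|v|.
Proof.
exists (\sum_i \sum_j `|B i j| + 1).
  by rewrite ltr_wpDl// sumr_ge0// => i _; rewrite sumr_ge0.
move=> v; apply: row_norm_le => [|j].
  by rewrite mulr_ge0// addr_ge0// sumr_ge0// => i _; rewrite sumr_ge0.
rewrite mxE; apply: le_trans (ler_norm_sum _ _ _) _.
rewrite mulrDl mul1r; apply: le_trans (_ : _ <= (\sum_i \sum_j `|B i j|) * `|v|) _; last first.
  by rewrite lerDl.
rewrite mulr_suml; apply: ler_sum => i _.
rewrite normrM mulrC ler_pM// ?coord_le_norm//.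
rewrite (bigD1 j)//= lerDl sumr_ge0//.
Qed.

Lemma mulmx_continuous m n (B : 'M[R]_(m, n)) : continuous (fun v : 'rV[R]_m => v *m B).
Proof.
move=> v; apply: differentiable_continuous; apply: differentiable_components => j.
have -> : (fun y : 'rV[R]_m => (y *m B) 0 j) = \sum_i (fun y : 'rV[R]_m => y 0 i *: B i j).
  by apply/funext => y; rewrite mxE fct_sumE.
apply: differentiable_sum => i; apply: differentiableZl; exact: differentiable_coord.
Qed.

End RowNorm.

Section MeanValue.
Context {R : realType}.

Lemma ball_segment (V : normedModType R) (a x y : V) r t :
  ball a r x -> ball a r y -> 0 <= t <= 1 -> ball a r (y + t *: (x - y)).
Proof.
rewrite -!ball_normE/= => ax ay /andP[t0 t1].
have -> : a - (y + t *: (x - y)) = (1 - t) *: (a - y) + t *: (a - x).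
  rewrite scalerBl scale1r -addrA [- _ + _]addrC -scalerBr opprB [a - x + _]addrC addrA subrK.
  by rewrite opprD addrA -scalerN opprB.
apply: le_lt_trans (ler_normD _ _) _; rewrite !normrZ (ger0_norm t0) ger0_norm ?subr_ge0//.
have [->|tn0] := eqVneq t 0; first by rewrite subr0 mul0r addr0 mul1r.
have tp : 0 < t by rewrite lt_neqAle eq_sym tn0.
have : `|a - y| <= r by exact: ltW.
move: (`|a - y|) (`|a - x|) ax => A B; nra.
Qed.

(** In the sup norm each coordinate may use its own intermediate point, so the scalar theorem
    suffices. *)
Lemma mean_value_le n (f f' : R -> 'rV[R]_n) (a b M : R) :
  a <= b -> (forall s, a <= s <= b -> is_derive s 1 f (f' s)) ->
  (forall s, a <= s <= b -> `|f' s| <= M) -> `|f b - f a| <= M * (b - a).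
Proof.
move=> ab df Mf.
have M0 : 0 <= M by apply: le_trans (Mf a _) => //; rewrite lexx.
apply: row_norm_le => [|i]; first by rewrite mulr_ge0// subr_ge0.
have dfi s : a <= s <= b -> is_derive s 1 (fun s => f s 0 i) (f' s 0 i).
  move=> /df [dfs <-]; apply: DeriveDef; last exact: derive_component.
  by have /derivable_mxP := dfs; exact.
have dfo x : x \in `]a, b[%R -> is_derive x 1 (fun s => f s 0 i) (f' x 0 i).
  by rewrite in_itv/= => /andP[ax xb]; apply: dfi; rewrite !ltW.
have cf : {within `[a, b], continuous (fun s => f s 0 i)}.
  apply: derivable_within_continuous => x; rewrite in_itv/= => xab.
  by have [] := dfi x xab.
have [c cab E] := MVT_segment ab dfo cf.
rewrite !mxE [_ + _]E normrM [X in _ * X]ger0_norm ?subr_ge0//.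
rewrite ler_wpM2r ?subr_ge0//; apply: le_trans (coord_le_norm _ _) _.
by apply: Mf; move: cab; rewrite in_itv.
Qed.

Lemma is_derive_comp_diff (V W : normedModType R) (c : R -> V) (c' : V) (G : V -> W) (s : R) :
  is_derive s 1 c c' -> differentiable G (c s) ->
  is_derive s 1 (G \o c) ('D_c' G (c s)).
Proof.
move=> [dc <-] dG; have dc' : differentiable c s by apply/derivable1_diffP.
apply: DeriveDef; last exact: derive_comp_diff.
by apply: diff_derivable; exact: differentiable_comp.
Qed.

Lemma is_derive_line (V : normedModType R) (p v : V) (s : R) :
  is_derive s 1 (fun t : R => p + t *: v) v.
Proof.
rewrite -[X in is_derive _ _ _ X]add0r.
apply: (@is_deriveD _ _ _ (cst p) (fun t : R => t *: v)).
apply: DeriveDef.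
  by apply: diff_derivable; exact: differentiableZl.
by rewrite deriveE; [rewrite diffZl//= diff_val scale1r | exact: differentiableZl].
Qed.

Lemma derive_le_dir n k (F : 'rV[R]_n -> 'rV[R]_k) x K v :
  differentiable F x -> (forall i, `|'D_(delta_mx 0 i) F x| <= K) ->
  `|'D_v F x| <= n%:R * K * `|v|.
Proof.
move=> dF KF; rewrite derive_rV_dir//.
apply: le_trans (ler_norm_sum _ _ _) _.
apply: le_trans (_ : _ <= \sum_(i < n) K * `|v|) _.
  apply: ler_sum => i _; rewrite normrZ mulrC ler_pM//.
  exact: coord_le_norm.
by rewrite sumr_const card_ord -mulrA mulr_natl.
Qed.

Lemma derive_le_lipschitz n k (F : 'rV[R]_n -> 'rV[R]_k) a r K :
  (forall x, ball a r x -> differentiable F x) ->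
  (forall x i, ball a r x -> `|'D_(delta_mx 0 i) F x| <= K) ->
  forall x y, ball a r x -> ball a r y -> `|F x - F y| <= n%:R * K * `|x - y|.
Proof.
move=> dF KF x y ax ay.
have := @mean_value_le k (fun t => F (y + t *: (x - y)))
  (fun t => 'D_(x - y) F (y + t *: (x - y))) 0 1 (n%:R * K * `|x - y|) ler01.
rewrite scale1r scale0r addr0 addrCA subrr addr0 subr0 mulr1; apply.
  move=> s s01; apply: (@is_derive_comp_diff _ _ (fun t => y + t *: (x - y)) _ F).
    exact: is_derive_line.
  by apply: dF; exact: ball_segment.
move=> s s01; have As := ball_segment ax ay s01.
exact: (derive_le_dir _ (dF _ As) (fun i => KF _ i As)).
Qed.

Lemma smooth_on_continuous (V W : normedModType R) (U : set V) (F : V -> W) x :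
  smooth_on U F -> U x -> {for x, continuous F}.
Proof. by move=> sF Ux; apply: differentiable_continuous; exact: smooth_on_diff sF Ux. Qed.

(** By continuity, a bound on the partial derivatives at the single point [a] persists on a ball.
    When the derivative vanishes at [a], K can be as small as desired; this is the source of all
    contractions below. *)
Lemma smooth_on_lipschitz_near n k (U : set 'rV[R]_n) (F : 'rV[R]_n -> 'rV[R]_k) a K :
  open U -> U a -> smooth_on U F -> 0 < K -> (forall i, `|'D_(delta_mx 0 i) F a| < K) ->
  exists2 r, 0 < r & (ball a r `<=` U) /\
    (forall x y, ball a r x -> ball a r y -> `|F x - F y| <= n%:R * K * `|x - y|) /\
    (forall x v, ball a r x -> `|'D_v F x| <= n%:R * K * `|v|).
Proof.
move=> oU Ua sF K0 FK.
have HD : \forall x \near a, forall i, `|'D_(delta_mx 0 i) F x| < K.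
  apply: near_forall => i.
  have : {for a, continuous ('D_(delta_mx 0 i) F)}.
    exact: (smooth_on_continuous (smooth_on_derive _ sF) Ua).
  by move=> /cvg_norm cn; apply: (cvgr_lt _ cn).
have HU := open_nbhs_nbhs (conj oU Ua).
have H := near_and HU HD.
have [r r0 Hr] := (nbhs_ballP _ _).1 H.
exists r => //; split=> [x /Hr[]//|].
have dF x : ball a r x -> differentiable F x by move=> /Hr[Ux _]; exact: smooth_on_diff sF Ux.
have KF x i : ball a r x -> `|'D_(delta_mx 0 i) F x| <= K by move=> /Hr[_ /(_ i)/ltW].
split; first by move=> x y ax ay; exact: (derive_le_lipschitz dF KF ax ay).
by move=> x v ax; exact: derive_le_dir (dF _ ax) (fun i => KF x i ax).
Qed.

End MeanValue.

(** * Fixed points by iteration *)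

Section GeometricLimit.
Context {R : realType}.

(** The intervals of radius 2 C / 2^n about [u n] are nested, and the limit is the supremum of their
    left ends. *)
Lemma geometric_limit (u : nat -> R) (C : R) :
  (forall n, `|u n.+1 - u n| <= C / 2 ^+ n) ->
  exists l, forall n, `|u n - l| <= 2 * C / 2 ^+ n.
Proof.
move=> H; have C0 : 0 <= C by have := H 0%N; rewrite expr0 divr1; apply: le_trans.
pose e n := 2 * C / 2 ^+ n; have eS n : e n = e n.+1 + C / 2 ^+ n.
  have ? : (2 : R) ^+ n != 0 by rewrite expf_neq0.
  by rewrite /e exprS; field.
have aS n : u n - e n <= u n.+1 - e n.+1.
  by have := H n; rewrite ler_norml (eS n) => /andP[+ _]; move: (e n.+1) (C / 2 ^+ n) => E D; lra.
have bS n : u n.+1 + e n.+1 <= u n + e n.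
  by have := H n; rewrite ler_norml (eS n) => /andP[_ +]; move: (e n.+1) (C / 2 ^+ n) => E D; lra.
have e0 n : 0 <= e n by rewrite divr_ge0// ?mulr_ge0// exprn_ge0.
have am m n : u n - e n <= u (n + m)%N - e (n + m)%N.
  by elim: m => [|m IH]; rewrite ?addn0// addnS; exact: le_trans (aS _).
have bm m n : u (n + m)%N + e (n + m)%N <= u n + e n.
  by elim: m => [|m IH]; rewrite ?addn0// addnS; exact: le_trans (bS _) IH.
have ab m n : u n - e n <= u m + e m.
  apply: le_trans (am m n) _; apply: le_trans (_ : _ <= u (m + n)%N + e (m + n)%N) _; last exact: bm.
  by rewrite addnC; have := e0 (m + n)%N; lra.
exists (sup (range (fun n => u n - e n))) => n.
have h1 : sup (range (fun n => u n - e n)) <= u n + e n.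
  by apply: ge_sup => [|_ [k _ <-]]; [exists (u 0%N - e 0%N); exists 0%N|exact: ab].
have h2 : u n - e n <= sup (range (fun n => u n - e n)).
  apply: ub_le_sup; last by exists n.
  by exists (u 0%N + e 0%N) => _ [k _ <-]; exact: ab.
by rewrite -/(e n) ler_norml; apply/andP; split;
  move: (sup _) (e n) h1 h2 => S E; lra.
Qed.

Lemma half_pow_small (C e : R) : 0 < e -> exists n, C / 2 ^+ n <= e.
Proof.
move=> e0; exists (Num.truncn (C / e)).+1; rewrite ler_pdivrMr ?exprn_gt0//.
have [C0|C0] := ltP C 0; first by apply: le_trans (ltW C0) _; rewrite mulr_ge0 ?exprn_ge0 ?ltW.
rewrite mulrC -ler_pdivrMr//; apply: le_trans (ltW (truncnS_gt _)) _.
by rewrite -natrX ler_nat ltnW// ltn_expl.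
Qed.

(** X carries no topology: X = [unit] solves an equation for a vector, X = R an integral equation.
    The predicate [C], closed under uniform limits, is where continuity of the iterates enters in
    the second case. *)
Lemma picard_fixed_point (X : Type) n (T : (X -> 'rV[R]_n) -> X -> 'rV[R]_n)
    (C : (X -> 'rV[R]_n) -> Prop) (rho : R) :
  0 <= rho -> C (cst 0) ->
  (forall (w : nat -> X -> 'rV[R]_n) v, (forall k, C (w k)) ->
     (forall e, 0 < e -> exists k, forall s, `|w k s - v s| <= e) -> C v) ->
  (forall w, C w -> (forall s, `|w s| <= rho) -> C (T w) /\ forall s, `|T w s| <= rho) ->
  (forall w w' d, C w -> C w' -> (forall s, `|w s| <= rho) -> (forall s, `|w' s| <= rho) ->
     (forall s, `|w s - w' s| <= d) -> forall s, `|T w s - T w' s| <= d / 2) ->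
  exists w, [/\ C w, forall s, `|w s| <= rho & T w = w].
Proof.
move=> rho0 C0 Ccl CT LT; pose w k := iter k T (cst 0).
have Cw k : C (w k) /\ forall s, `|w k s| <= rho.
  elim: k => [|k [IH1 IH2]]; first by split=> // s; rewrite normr0.
  exact: CT.
have dw k s : `|w k.+1 s - w k s| <= rho / 2 ^+ k.
  elim: k s => [|k IH] s.
    by rewrite subr0 expr0 divr1; have [_ +] := Cw 1%N; exact.
  have [c1 b1] := Cw k.+1; have [c2 b2] := Cw k.
  have -> : rho / 2 ^+ k.+1 = (rho / 2 ^+ k) / 2.
    by rewrite exprS invfM [2^-1 * _]mulrC mulrA.
  exact: (LT _ _ _ c1 c2 b1 b2 IH).
have lw s i : exists l, forall k, `|w k s 0 i - l| <= 2 * rho / 2 ^+ k.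
  apply: geometric_limit => k; have := dw k s; apply: le_trans.
  by have := coord_le_norm (w k.+1 s - w k s) i; rewrite !mxE.
have [v Hv] : exists v : X -> 'rV[R]_n, forall s k, `|w k s - v s| <= 2 * rho / 2 ^+ k.
  have [l Hl] := choice (fun si : X * 'I_n => lw si.1 si.2).
  exists (fun s => \row_i l (s, i)) => s k.
  apply: row_norm_le => [|i]; first by rewrite divr_ge0// ?mulr_ge0// exprn_ge0.
  by rewrite !mxE; exact: (Hl (s, i)).
have Cv : C v.
  apply: (Ccl w) => [k|e e0]; first by case: (Cw k).
  have [k Hk] := half_pow_small (2 * rho) e0.
  by exists k => s; exact: le_trans (Hv s k) Hk.
have bv s : `|v s| <= rho.
  apply/ler_addgt0Pr => e e0; have [k Hk] := half_pow_small (2 * rho) e0.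
  rewrite -[v s](subKr (w k s)); apply: le_trans (ler_normB _ _) _.
  by rewrite lerD//; [have [_ +] := Cw k; exact|exact: le_trans (Hv s k) Hk].
exists v; split=> //; apply/funext => s; apply/eqP.
rewrite -subr_eq0 -normr_le0; apply/ler_addgt0Pr => e e0; rewrite add0r.
have e2 : 0 < e / 2 by rewrite divr_gt0.
have [k Hk] := half_pow_small (2 * rho) e2.
have [c1 b1] := Cw k.
have A : `|T v s - w k.+1 s| <= 2 * rho / 2 ^+ k / 2.
  by apply: (LT v (w k)) => // t; rewrite distrC; exact: Hv.
have B : `|w k.+1 s - v s| <= 2 * rho / 2 ^+ k / 2.
  by have := Hv s k.+1; rewrite exprS invfM [2^-1 * _]mulrC mulrA.
rewrite -(subrK (w k.+1 s) (T v s)) -addrA; apply: le_trans (ler_normD _ _) _.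
by lra.
Qed.

End GeometricLimit.

(** * Orthogonal projections and smooth matrices *)

Section Gram.
Context {R : realType}.

Lemma dotE n (v w : 'rV[R]_n) : dot v w = (v *m w^T) 0 0.
Proof. by rewrite /dot mxE; apply: eq_bigr => i _; rewrite mxE. Qed.

Lemma dot_ge0 n (v : 'rV[R]_n) : 0 <= dot v v.
Proof. by apply: sumr_ge0 => i _; rewrite -expr2 sqr_ge0. Qed.

Lemma dot_eq0 n (v : 'rV[R]_n) : dot v v = 0 -> v = 0.
Proof.
move=> /eqP; rewrite psumr_eq0 => [/allP H|i _]; last by rewrite -expr2 sqr_ge0.
apply/rowP => i; have := H i (mem_index_enum _); rewrite mulf_eq0 orbb => /eqP ->.
by rewrite mxE.
Qed.

Lemma gram_unit m c (A : 'M[R]_(m, c)) : \rank A = c -> A^T *m A \in unitmx.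
Proof.
move=> rA; rewrite -row_free_unit; apply: inj_row_free => v vAA.
have fA : row_free A^T by rewrite /row_free mxrank_tr rA.
have : v *m A^T = 0.
  apply: dot_eq0; rewrite dotE trmx_mul trmxK.
  by rewrite -mulmxA [A^T *m _]mulmxA mulmxA -[v *m (A^T *m A)]/(v *m _) vAA mul0mx mxE.
by move/eqP; rewrite mulmx_free_eq0// => /eqP.
Qed.

(** B is the Moore-Penrose inverse of A, and P the orthogonal projection onto the row vectors v with
    v A = 0. For A the Jacobian of a defining submersion, P projects onto the tangent space. *)
Lemma orthogonal_splitting m c (A : 'M[R]_(m, c)) : \rank A = c ->
  exists (B : 'M[R]_(c, m)) (P : 'M[R]_m),
    [/\ B *m A = 1%:M, P = 1%:M - A *m B, P *m A = 0, B *m P = 0 & P^T = P].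
Proof.
move=> rA; have uG := gram_unit rA.
pose B := invmx (A^T *m A) *m A^T.
have BA : B *m A = 1%:M by rewrite /B -mulmxA mulVmx.
exists B, (1%:M - A *m B); split=> //.
- by rewrite mulmxBl mul1mx -mulmxA BA mulmx1 subrr.
- by rewrite mulmxBr mulmx1 mulmxA BA mul1mx subrr.
- rewrite linearB/= trmx1; congr (_ - _).
  by rewrite /B !trmx_mul trmx_inv trmx_mul !trmxK mulmxA.
Qed.

End Gram.

Section SmoothMatrix.
Context {R : realType} (V : normedModType R) (U : set V).
Hypothesis openU : open U.

Definition smooth_mx a b (M : V -> 'M[R]_(a, b)) :=
  forall i j, smooth_on U (fun x => M x i j).

Lemma smooth_mx_mul a b c (M : V -> 'M[R]_(a, b)) (N : V -> 'M[R]_(b, c)) :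
  smooth_mx M -> smooth_mx N -> smooth_mx (fun x => M x *m N x).
Proof.
move=> sM sN i j.
apply: (@smooth_on_eq _ _ _ openU _ (fun x => \sum_k (M x i k * N x k j))).
  by move=> x _; rewrite mxE.
by apply: smooth_on_sum => // k _; apply: (smooth_on_mul openU (sM i k) (sN k j)).
Qed.

Lemma smooth_mx_cst a b (M : 'M[R]_(a, b)) : smooth_mx (fun=> M).
Proof. by move=> i j; exact: smooth_on_cst. Qed.

Lemma smooth_mx_det n (M : V -> 'M[R]_n) : smooth_mx M -> smooth_on U (fun x => \det (M x)).
Proof.
move=> sM; rewrite /determinant.
apply: smooth_on_sum => // s _.
apply: smooth_on_mul => //; first exact: smooth_on_cst.
apply/smooth_onP => k; apply: (smooth_upto_prod openU) => i _.
by have /smooth_onP := sM i (s i); exact.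
Qed.

Lemma smooth_mx_inv n (M : V -> 'M[R]_n) :
  (forall x, U x -> M x \in unitmx) -> smooth_mx M -> smooth_mx (fun x => invmx (M x)).
Proof.
move=> uM sM i j.
apply: (@smooth_on_eq _ _ _ openU _ (fun x => (\det (M x))^-1 * cofactor (M x) j i)).
  by move=> x /[1!inE] Ux; rewrite /invmx uM// !mxE.
apply: smooth_on_mul => //.
  apply/smooth_onP => k; apply: (smooth_upto_inv openU).
    by move=> x /uM; rewrite unitmxE unitfE.
  by have /smooth_onP := smooth_mx_det sM; exact.
rewrite /cofactor; apply: smooth_on_mul => //; first exact: smooth_on_cst.
apply: smooth_mx_det => a b; apply: (@smooth_on_eq _ _ _ openU _ (fun x => M x (lift j a) (lift i b))).
  by move=> x _; rewrite !mxE.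
exact: sM.
Qed.

End SmoothMatrix.

Lemma smooth_mx_jacobian (R : realType) m n (U : set 'rV[R]_m) (F : 'rV[R]_m -> 'rV[R]_n) :
  open U -> smooth_on U F -> smooth_mx U (jacobian F).
Proof.
move=> oU sF i j.
apply: (@smooth_on_eq _ _ _ oU _ (fun x => 'D_(delta_mx 0 i) F x 0 j)).
  move=> x /[1!inE] Ux; rewrite deriveEjacobian; last exact: smooth_on_diff sF Ux.
  by rewrite -rowE mxE.
by have /(smooth_on_components oU) := smooth_on_derive (delta_mx 0 i) sF; exact.
Qed.

(** * Local retractions onto a submanifold *)

(* Near p in N the map Pi is the retraction onto N along the kernel of P, the
   orthogonal projection onto the tangent space at p. *)
Record adapted_retraction (R : realType) m (N : set 'rV[R]_m) (p : 'rV[R]_m) (r : R)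
    (P : 'M[R]_m) (Pi : 'rV[R]_m -> 'rV[R]_m) : Prop := {
  ret_gt0 : 0 < r;
  ret_sym : P^T = P;
  ret_idem : P *m P = P;
  ret_smooth : smooth_on (ball p r) Pi;
  ret_in : forall q, ball p r q -> N (Pi q);
  ret_id : forall q, ball p r q -> N q -> Pi q = q;
  ret_derive_proj : forall q v, ball p r q -> 'D_v Pi q *m P = v *m P;
  ret_derive_dir : forall q v, ball p r q -> 'D_v Pi q = 'D_(v *m P) Pi q;
  ret_derive_center : forall v, 'D_v Pi p = v *m P }.

Section ImplicitFunction.
Context {R : realType} (m c : nat) (N U : set 'rV[R]_m) (F : 'rV[R]_m -> 'rV[R]_c)
  (p : 'rV[R]_m).
Hypotheses (openU : open U) (Up : U p) (Np : N p) (sF : smooth_on U F)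
  (NF : forall q, U q -> (N q <-> F q = 0)) (rkF : \rank ('J F p) = c).

(** The implicit function theorem by contraction. Let f be F minus its affine part (x - p) A. At x =
    p + (q - p) P + y B one has (x - p) A = y, so F x = 0 is the fixed point equation y = - f x, and
    f has zero derivative at p. *)
Lemma adapted_retraction_of_submersion : exists r P Pi, adapted_retraction N p r P Pi.
Proof.
set A := 'J F p; have [B [P [BA PE PA BP Psym]]] := orthogonal_splitting rkF.
have PP : P *m P = P by rewrite {1}PE mulmxBl mul1mx -mulmxA BP mulmx0 subr0.
have dF q : U q -> differentiable F q by move=> Uq; exact: smooth_on_diff sF Uq.
have Fp : F p = 0 by apply/NF.
pose lin := fun x : 'rV[R]_m => x *m A.
have slin : smooth_on U lin.
  apply: smooth_on_linear => //; last exact: mulmx_continuous.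
  by move=> a x y; rewrite /lin mulmxDl scalemxAl.
have dlin v x : 'D_v lin x = v *m A.
  have lL : linear lin by move=> a y z; rewrite /lin mulmxDl scalemxAl.
  pose f' := GRing.isLinear.Build _ _ _ _ lin lL.
  pose f : {linear 'rV[R]_m -> 'rV[R]_c} := HB.pack lin f'.
  have cL : continuous lin by exact: mulmx_continuous.
  by rewrite deriveE ?(@diff_lin _ _ _ f)//; exact: (@linear_differentiable _ _ _ f).
pose f := (F + cst (p *m A)) - lin.
have fE x : f x = F x - (x - p) *m A.
  by rewrite /f !fctE mulmxBl opprB addrA.
have sf : smooth_on U f.
  apply: smooth_on_add => //; first by apply: smooth_on_add => //; exact: smooth_on_cst.
  have sN : smooth_on U (fun x : 'rV[R]_m => x *m (- A)).
    apply: smooth_on_linear => //; last exact: mulmx_continuous.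
    by move=> a x y; rewrite mulmxDl scalemxAl.
  by apply: smooth_on_eq sN => // x _; rewrite mulmxN.
have df v x : U x -> 'D_v f x = 'D_v F x - v *m A.
  move=> Ux; have dFx := dF x Ux.
  rewrite deriveB; [|apply: diff_derivable; exact: differentiableD|apply: diff_derivable; exact: smooth_on_diff slin Ux].
  by rewrite deriveD ?derive_cst ?addr0 ?dlin//; exact: diff_derivable.
have dfp v : 'D_v f p = 0 by rewrite df// deriveEjacobian ?subrr//; exact: dF.
have [K1 K10 HK1] := mulmx_norm_bound P.
have [K2 K20 HK2] := mulmx_norm_bound B.
pose K := K1 + K2 + 1.
have K0 : 0 < K by rewrite /K; lra.
(* [Psi] will be K-Lipschitz in its two variables together, so an eta-Lipschitz f composed with it
   has constant 1/4. *)
pose eta := (4 * K)^-1.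
have eta0 : 0 < eta by rewrite invr_gt0 mulr_gt0.
have [r1 r10 [r1U [Hf dfle]]] : exists2 r, 0 < r & (ball p r `<=` U) /\
    (forall x y, ball p r x -> ball p r y -> `|f x - f y| <= eta * `|x - y|) /\
    (forall x v, ball p r x -> `|'D_v f x| <= eta * `|v|).
  have e1 : 0 < eta / m.+1%:R by rewrite divr_gt0.
  have e2 i : `|'D_(delta_mx 0 i) f p| < eta / m.+1%:R by rewrite dfp normr0.
  have [r r0 [rU [H1 H2]]] := smooth_on_lipschitz_near openU Up sf e1 e2.
  have me : m%:R * (eta / m.+1%:R) <= eta.
    by rewrite mulrCA ger_pMr// ler_pdivrMr// mul1r ler_nat.
  exists r => //; split=> //; split=> [x y xr yr|x v xr].
    by apply: le_trans (H1 _ _ xr yr) _; rewrite ler_wpM2r.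
  by apply: le_trans (H2 _ _ xr) _; rewrite ler_wpM2r.
have fp : f p = 0 by rewrite fE Fp subrr mul0mx subrr.
have pr1 : ball p r1 p by exact: ballxx.
pose Psi q y := p + (q - p) *m P + y *m B.
have Psid q y q' y' : `|Psi q y - Psi q' y'| <= K * (`|q - q'| + `|y - y'|).
  have -> : Psi q y - Psi q' y' = (q - q') *m P + (y - y') *m B.
    rewrite /Psi !mulmxBl; apply/rowP => i; rewrite !mxE; ring.
  apply: le_trans (ler_normD _ _) _.
  have := HK1 (q - q'); have := HK2 (y - y'); rewrite /K.
  have := normr_ge0 (q - q'); have := normr_ge0 (y - y').
  move: (`|(q - q') *m P|) (`|(y - y') *m B|) (`|q - q'|) (`|y - y'|) => a b cc d; nra.
have Psip : Psi p 0 = p by rewrite /Psi subrr !mul0mx !addr0.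
(* With both arguments within rho, [Psi] moves from p by at most 2 K rho = r1 / 2. *)
pose rho := r1 / (4 * K).
have rho0 : 0 < rho by rewrite divr_gt0// mulr_gt0.
have PsiB q y : ball p rho q -> `|y| <= rho -> ball p r1 (Psi q y).
  rewrite -!ball_normE/= => pq yr; rewrite -{1}Psip.
  apply: le_lt_trans (Psid _ _ _ _) _; rewrite sub0r normrN.
  have : K * (`|p - q| + `|y|) <= K * (rho + rho) by rewrite ler_pM2l// lerD// ltW.
  have -> : K * (rho + rho) = r1 / 2 by rewrite /rho; field; rewrite gt_eqF.
  by move=> /le_lt_trans; apply; lra.
have contr q y q' y' : ball p rho q -> ball p rho q' -> `|y| <= rho -> `|y'| <= rho ->
    `|f (Psi q y) - f (Psi q' y')| <= (`|q - q'| + `|y - y'|) / 4.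
  move=> bq bq' by1 by2; have H := Hf _ _ (PsiB _ _ bq by1) (PsiB _ _ bq' by2).
  apply: le_trans H _.
  have -> : (`|q - q'| + `|y - y'|) / 4 = eta * (K * (`|q - q'| + `|y - y'|)).
    by rewrite /eta; field; rewrite gt_eqF.
  by rewrite ler_pM2l.
have self q y : ball p rho q -> `|y| <= rho -> `|f (Psi q y)| <= (`|p - q| + `|y|) / 4.
  move=> bq byr; have := contr p 0 q y (ballxx _ rho0) bq; rewrite Psip fp !sub0r !normrN normr0.
  by apply => //; exact: ltW.
have [Y HY] : exists Y : 'rV[R]_m -> 'rV[R]_c,
    forall q, ball p rho q -> `|Y q| <= rho /\ Y q = - f (Psi q (Y q)).
  suff /choice[Y HY] : forall q, exists y, ball p rho q -> `|y| <= rho /\ y = - f (Psi q y) by exists Y.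
  move=> q; have [bq|nb] := pselect (ball p rho q); last by exists 0.
  pose T (w : unit -> 'rV[R]_c) (_ : unit) := - f (Psi q (w tt)).
  have [||||w [_ bw Tw]] := @picard_fixed_point R unit c T (fun=> True) rho (ltW rho0).
  - by [].
  - by [].
  - move=> w _ bw; split=> // s; rewrite normrN.
    apply: le_trans (self _ _ bq (bw tt)) _.
    have := bw tt; have : `|p - q| < rho by move: bq; rewrite -ball_normE.
    by move: (`|p - q|) (`|w tt|) => a b; lra.
  - move=> w w' d _ _ bw bw' dw s; rewrite /T -opprD normrN.
    apply: le_trans (contr _ _ _ _ bq bq (bw tt) (bw' tt)) _.
    rewrite subrr normr0 add0r; have := dw tt; have := normr_ge0 (w tt - w' tt).
    by move: (`|w tt - w' tt|) => a; lra.
  - by exists (w tt) => _; split=> //; rewrite -{1}Tw.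
have Yuniq q y : ball p rho q -> `|y| <= rho -> y = - f (Psi q y) -> y = Y q.
  move=> bq by1 yE; have [by2 YE] := HY q bq.
  apply/eqP; rewrite -subr_eq0 -normr_le0 {1}yE {1}YE -opprD normrN.
  have := contr q y q (Y q) bq bq by1 by2.
  have E : `|y - Y q| = `|f (Psi q y) - f (Psi q (Y q))| by rewrite {1}yE {1}YE -opprD normrN.
  by rewrite subrr normr0 add0r E; lra.
have Ylip q q' : ball p rho q -> ball p rho q' -> `|Y q - Y q'| <= `|q - q'|.
  move=> bq bq'; have [b1 E1] := HY q bq; have [b2 E2] := HY q' bq'.
  have E : `|Y q - Y q'| = `|f (Psi q (Y q)) - f (Psi q' (Y q'))| by rewrite {1}E1 {1}E2 -opprD normrN.
  have := contr _ _ _ _ bq bq' b1 b2; rewrite E.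
  move: (`|f _ - _|) => a; have := normr_ge0 (q - q'); lra.
pose Pi q := Psi q (Y q).
have PiB q : ball p rho q -> ball p r1 (Pi q).
  by move=> bq; apply: PsiB => //; case: (HY q bq).
have FPi q : ball p rho q -> F (Pi q) = 0.
  move=> bq; have [_ YE] := HY q bq.
  have e1 : (Pi q - p) *m A = Y q.
    have -> : Pi q - p = (q - p) *m P + Y q *m B by rewrite /Pi /Psi; apply/rowP => i; rewrite !mxE; ring.
    by rewrite mulmxDl -!mulmxA PA BA mulmx0 add0r mulmx1.
  have := fE (Pi q); rewrite e1 => /eqP; rewrite eq_sym subr_eq => /eqP ->.
  by rewrite /Pi {2}YE subrr.
have NPi q : ball p rho q -> N (Pi q) by move=> bq; apply/NF; [exact/r1U/PiB|exact: FPi].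
pose J x := jacobian f x.
have DJ x v : U x -> 'D_v f x = v *m J x.
  by move=> Ux; exact: (deriveEjacobian v (smooth_on_diff sf Ux)).
pose M x := 1%:M + B *m J x.
have uM x : ball p r1 x -> M x \in unitmx.
  move=> bx; rewrite -row_free_unit; apply: inj_row_free => v.
  rewrite mulmxDr mulmx1 mulmxA -DJ; last exact: r1U.
  move/eqP; rewrite addr_eq0 => /eqP vE; apply/eqP; rewrite -normr_le0.
  have : `|v| <= `|v| / 4.
    rewrite {1}vE normrN; apply: le_trans (dfle _ _ bx) _.
    apply: le_trans (_ : _ <= eta * (K * `|v|)) _.
      rewrite ler_pM2l//; apply: le_trans (HK2 _) _; rewrite ler_wpM2r// /K; lra.
    by rewrite /eta le_eqVlt; apply/orP; left; apply/eqP; field; rewrite gt_eqF.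
  by have := normr_ge0 v; lra.
(* Formal differentiation of Y q = - f (Psi q (Y q)) in direction h reads dY (1 + B J) = - h P J. *)
pose L x := - (P *m J x *m invmx (M x)).
have dY q : ball p rho q -> differentiable Y q /\ forall v, 'D_v Y q = v *m L (Pi q).
  move=> bq; have Ux : U (Pi q) by exact/r1U/PiB.
  have [] := @differentiable_epsilon R _ _ Y (mulmxr (L (Pi q))) q.
  - exact: mulmx_continuous.
  - move=> e e0; have [K3 K30 HK3] := mulmx_norm_bound (invmx (M (Pi q))).
    pose e' := e / (K3 * (2 * K)).
    have e'0 : 0 < e' by rewrite divr_gt0// !mulr_gt0.
    have dfx : differentiable f (Pi q) by exact: smooth_on_diff sf Ux.
    have /diff_locally/eqaddoP/(_ e' e'0) := dfx.
    move=> /nbhs_ballP[d /= d0 Hd].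
    have /nbhs_ballP[d1 /= d10 Hd1] : nbhs q (ball p rho).
      by apply: open_nbhs_nbhs; split=> //; exact: ball_open.
    pose d2 := Num.min d1 (d / (2 * K)).
    have d20 : 0 < d2 by rewrite lt_min d10 divr_gt0// mulr_gt0.
    apply/nbhs_ballP; exists d2 => // h; rewrite -ball_normE/= sub0r normrN lt_min => /andP[hd1 hd2].
    have bq' : ball p rho (h + q).
      by apply: Hd1; rewrite -ball_normE/= opprD addrC subrK normrN.
    pose k := Pi (h + q) - Pi q.
    have kE : k = h *m P + (Y (h + q) - Y q) *m B.
      rewrite /k /Pi /Psi !mulmxBl !mulmxDl; apply/rowP => i; rewrite !mxE; ring.
    have kle : `|k| <= 2 * K * `|h|.
      rewrite mulrAC mulrC; apply: le_trans (Psid _ _ _ _) _.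
      rewrite ler_pM2l//; have := Ylip _ _ bq' bq; rewrite addrK; move: (`|_ - _|) (`|h|) => a1 a2; lra.
    have kd : ball (0 : 'rV[R]_m) d k.
      rewrite -ball_normE/= sub0r normrN; apply: le_lt_trans kle _.
      by rewrite mulrC -ltr_pdivlMr// mulr_gt0.
    have := Hd k kd; rewrite /= !fctE/= {1}/k subrK -(deriveE k dfx) (DJ _ k Ux).
    rewrite -/(Pi q) opprD addrA => H.
    have [_ E1] := HY _ bq'; have [_ E2] := HY _ bq.
    have -> : Y (h + q) - Y q - h *m L (Pi q) = - ((f (Pi (h + q)) - f (Pi q) - k *m J (Pi q)) *m invmx (M (Pi q))).
      have -> : f (Pi (h + q)) - f (Pi q) - k *m J (Pi q) = - ((Y (h + q) - Y q) *m M (Pi q) + h *m P *m J (Pi q)).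
        have -> : f (Pi (h + q)) = - Y (h + q) by apply: oppr_inj; rewrite opprK; exact: esym E1.
        have -> : f (Pi q) = - Y q by apply: oppr_inj; rewrite opprK; exact: esym E2.
        rewrite kE /M; move: (Y (h + q)) (Y q) (J (Pi q)) => y1 y0 J0.
        rewrite mulmxDr mulmx1 [(_ + _) *m J0]mulmxDl [_ *m (B *m J0)]mulmxA.
        move: (h *m P *m J0) ((y1 - y0) *m B *m J0) => a1 a2.
        by apply/rowP => i; rewrite !mxE; ring.
      rewrite mulNmx opprK mulmxDl mulmxK; last by apply: uM; exact: PiB.
      by rewrite /L mulmxN opprK !mulmxA.
    rewrite normrN; apply: le_trans (HK3 _) _.
    apply: le_trans (_ : _ <= K3 * (e' * `|k|)) _; first by rewrite ler_pM2l.
    apply: le_trans (_ : _ <= K3 * (e' * (2 * K * `|h|))) _.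
      by rewrite ler_pM2l// ler_pM2l.
    rewrite /e' le_eqVlt; apply/orP; left; apply/eqP; field.
    by rewrite !gt_eqF.
  - by move=> dYq DYq; split=> // v; rewrite deriveE// DYq.
have oball s : open (ball p s) by exact: ball_open.
have dPi q v : ball p rho q -> differentiable Pi q /\ 'D_v Pi q = v *m P + v *m L (Pi q) *m B.
  move=> bq; have [dYq DYq] := dY q bq.
  have [] := @differentiable_epsilon R _ _ Pi (mulmxr (P + L (Pi q) *m B)) q.
  - exact: mulmx_continuous.
  - move=> e e0; pose e' := e / (K2 + 1).
    have e'0 : 0 < e' by rewrite divr_gt0// ltr_wpDl// ltW.
    have /diff_locally/eqaddoP/(_ e' e'0) := dYq.
    apply: filterS => h; rewrite /= !fctE/= -deriveE// DYq opprD addrA => H.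
    have -> : Pi (h + q) - Pi q - h *m (P + L (Pi q) *m B) =
        (Y (h + q) - Y q - h *m L (Pi q)) *m B.
      rewrite /Pi /Psi !mulmxDr !mulmxBl !mulmxDl !mulmxA; apply/rowP => i; rewrite !mxE; ring.
    apply: le_trans (HK2 _) _; apply: le_trans (_ : _ <= K2 * (e' * `|h|)) _; first by rewrite ler_pM2l.
    rewrite mulrA ler_wpM2r// /e' mulrCA ger_pMr// ler_pdivrMr ?ltr_wpDl ?ltW//.
    by rewrite mul1r; lra.
  - by move=> dP EP; split=> //; rewrite deriveE// EP/= mulmxDr mulmxA.
have sL : smooth_mx (ball p r1) L.
  have sJ : smooth_mx (ball p r1) J.
    by move=> i j; apply: (smooth_on_sub r1U); exact: smooth_mx_jacobian.
  have sPJ : smooth_mx (ball p r1) (fun x => - P *m J x).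
    by apply: smooth_mx_mul => //; exact: smooth_mx_cst.
  have sM : smooth_mx (ball p r1) M.
    have sBJ : smooth_mx (ball p r1) (fun x => B *m J x).
      by apply: smooth_mx_mul => //; exact: smooth_mx_cst.
    move=> i j; apply: (@smooth_on_eq _ _ _ (oball r1) _ (cst ((1%:M : 'M[R]_c) i j) + (fun x => (B *m J x) i j))).
      by move=> x _; rewrite /M [RHS]mxE.
    by apply: smooth_on_add => //; exact: smooth_on_cst.
  have := smooth_mx_mul (oball r1) sPJ (smooth_mx_inv (oball r1) uM sM).
  move=> H i j; apply: smooth_on_eq (H i j) => // x _.
  by rewrite /L !mulNmx.
(* Bootstrap: the differential of [Pi] is a smooth function of the value of [Pi], so each order of
   smoothness yields the next. *)
have sPi : smooth_on (ball p rho) Pi.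
  have dP0 x : ball p rho x -> differentiable Pi x by move=> /(dPi x 0)[].
  apply/smooth_onP => k; elim: k => [|k IH]; first exact: (conj dP0 Logic.I).
  split; first exact: dP0.
  move=> v.
  apply: (@smooth_upto_eq _ _ _ (oball rho) _ _ (fun x => v *m P + v *m L (Pi x) *m B)).
    by move=> x /[1!inE] bx; case: (dPi x v bx).
  apply/(smooth_upto_components (oball rho)) => j.
  apply: (@smooth_upto_eq _ _ _ (oball rho) _ _ (cst ((v *m P) 0 j) +
    (fun x => \sum_l (cst (B l j) * (fun x => \sum_i (cst (v 0 i) * ((fun x => L x i l) \o Pi)) x)) x))).
    move=> x _; rewrite !fctE [RHS]mxE; congr (_ + _); rewrite mxE; apply: eq_bigr => l _.
    by rewrite !fctE mulrC mxE; congr (_ * _).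
  apply: smooth_upto_add => //; first exact: smooth_upto_cst.
  apply: smooth_upto_sum => // l _; apply: smooth_upto_mul => //; first exact: smooth_upto_cst.
  apply: smooth_upto_sum => // i _; apply: smooth_upto_mul => //; first exact: smooth_upto_cst.
  apply: (smooth_upto_comp (oball rho) (oball r1) PiB IH).
  by have /smooth_onP := sL i l; exact.
have [KA KA0 HKA] := mulmx_norm_bound A.
(* A point q of N solves the fixed point equation with y = (q - p) A. Shrinking the radius makes |y|
   <= rho, so that uniqueness gives [Pi q = q]. *)
pose r := Num.min rho (rho / KA).
have r0 : 0 < r by rewrite lt_min rho0 divr_gt0.
have rrho q : ball p r q -> ball p rho q.
  by apply: le_ball; rewrite ge_min lexx.
have idPi q : ball p r q -> N q -> Pi q = q.
  move=> bq Nq; have qE : Psi q ((q - p) *m A) = q.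
    by rewrite /Psi PE mulmxBr mulmx1 mulmxA; apply/rowP => i; rewrite !mxE; ring.
  have Fq : F q = 0 by apply/NF => //; apply: r1U; rewrite -qE; apply: PsiB; [exact: rrho|];
    apply: le_trans (HKA _) _; rewrite mulrC -ler_pdivlMr// distrC; move: bq;
    rewrite -ball_normE/= lt_min => /andP[_ /ltW].
  rewrite /Pi -(Yuniq q ((q - p) *m A))//; first exact: rrho.
    apply: le_trans (HKA _) _; rewrite mulrC -ler_pdivlMr// distrC; move: bq.
    by rewrite -ball_normE/= lt_min => /andP[_ /ltW].
  by rewrite qE fE Fq sub0r opprK.
have bp : ball p r p by exact: ballxx.
have PL x : P *m L x = L x by rewrite /L mulmxN !mulmxA PP.
exists r, P, Pi; split.
- exact: r0.
- exact: Psym.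
- exact: PP.
- by apply: smooth_on_sub sPi => x; exact: rrho.
- by move=> q /rrho; exact: NPi.
- exact: idPi.
- move=> q v /rrho bq; have [_ ->] := dPi q v bq.
  by rewrite mulmxDl -!mulmxA PP BP !mulmx0 addr0.
- move=> q v /rrho bq; have [_ ->] := dPi q v bq; have [_ ->] := dPi q (v *m P) bq.
  by rewrite -[v *m P *m P]mulmxA PP -[v *m P *m L _]mulmxA PL.
- move=> v; have [_ ->] := dPi p v (rrho _ bp); rewrite (idPi _ bp Np).
  have Jp : J p = 0 by apply/row_matrixP => i; rewrite rowE -(DJ _ _ Up) dfp row0.
  by rewrite /L Jp mulmx0 mul0mx oppr0 mulmx0 mul0mx addr0.
Qed.

End ImplicitFunction.

(** * Calculus along curves *)

Section CurveCalculus.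
Context {R : realType}.

Lemma is_derive_components (n : nat) (f : R -> 'rV[R]_n) (f' : 'rV[R]_n) (s : R) :
  (forall i, is_derive s 1 (fun t => f t 0 i) (f' 0 i)) -> is_derive s 1 f f'.
Proof.
move=> H; have df : derivable f s 1.
  by apply/derivable_mxP => i j; rewrite (ord1 i); case: (H j).
apply: DeriveDef => //; rewrite derive_mx//; apply/rowP => j; rewrite mxE.
by case: (H j).
Qed.

Lemma is_derive_component (n : nat) (f : R -> 'rV[R]_n) (f' : 'rV[R]_n) (s : R) i :
  is_derive s 1 f f' -> is_derive s 1 (fun t => f t 0 i) (f' 0 i).
Proof.
move=> [df <-]; apply: DeriveDef; last exact: derive_component.
by have /derivable_mxP := df; exact.
Qed.

Lemma is_derive_scale (n : nat) (k : R -> R) (f : R -> 'rV[R]_n) (k' : R) (f' : 'rV[R]_n) (s : R) :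
  is_derive s 1 k k' -> is_derive s 1 f f' ->
  is_derive s 1 (fun t => k t *: f t) (k' *: f s + k s *: f').
Proof.
move=> dk df; apply: is_derive_components => i.
have -> : (fun t => (k t *: f t) 0 i) = k * (fun t => f t 0 i).
  by apply/funext => t; rewrite mxE.
have -> : (k' *: f s + k s *: f') 0 i = k s *: f' 0 i + f s 0 i *: k'.
  by rewrite !mxE addrC [k' * _]mulrC.
by apply: is_deriveM; exact: is_derive_component.
Qed.

Lemma is_derive_bigsum (n p : nat) (f : 'I_p -> R -> 'rV[R]_n) (f' : 'I_p -> 'rV[R]_n) (s : R) :
  (forall i, is_derive s 1 (f i) (f' i)) ->
  is_derive s 1 (fun t => \sum_i f i t) (\sum_i f' i).
Proof.
move=> H; have -> : (fun t => \sum_i f i t) = \sum_i f i.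
  by apply/funext => t; rewrite fct_sumE.
exact: is_derive_sum.
Qed.

Lemma is_derive_continuous (V : normedModType R) (f : R -> V) (f' : V) (s : R) :
  is_derive s 1 f f' -> {for s, continuous f}.
Proof. by move=> [df _]; apply: differentiable_continuous; exact/derivable1_diffP. Qed.

Lemma is_derive_near (V : normedModType R) (f : R -> V) (f' : V) (s : R) (A : set V) :
  is_derive s 1 f f' -> open A -> A (f s) -> \forall t \near s, A (f t).
Proof. by move=> df oA As; exact: (is_derive_continuous df) (open_nbhs_nbhs (conj oA As)). Qed.

Lemma is_derive_unique (V : normedModType R) (f : R -> V) (f1 f2 : V) (s : R) :
  is_derive s 1 f f1 -> is_derive s 1 f f2 -> f1 = f2.
Proof. by move=> [_ <-] [_ <-]. Qed.

Lemma is_derive_mulmx (n p : nat) (B : 'M[R]_(n, p)) (f : R -> 'rV[R]_n) (f' : 'rV[R]_n) (s : R) :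
  is_derive s 1 f f' -> is_derive s 1 (fun t => f t *m B) (f' *m B).
Proof.
move=> df.
have E t : f t *m B = \sum_i f t 0 i *: row i B by rewrite mulmx_sum_row.
have -> : (fun t => f t *m B) = (fun t => \sum_i f t 0 i *: row i B) by exact/funext.
rewrite mulmx_sum_row; apply: is_derive_bigsum => i.
have := @is_derive_scale p (fun t => f t 0 i) (cst (row i B)) (f' 0 i) 0 s
  (is_derive_component i df) (is_derive_cst _ _ _).
by rewrite scaler0 addr0.
Qed.

Lemma derive_sum_coord (n p : nat) (U : set 'rV[R]_n) (F : 'rV[R]_n -> 'rV[R]_p) q v w :
  open U -> smooth_on U F -> U q ->
  'D_w ('D_v F) q = \sum_i v 0 i *: 'D_w ('D_(delta_mx 0 i) F) q.
Proof.
move=> oU sF Uq.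
have dD i : derivable ('D_(delta_mx 0 i) F) q w.
  by apply: diff_derivable; exact: smooth_on_diff (smooth_on_derive _ sF) Uq.
have -> : 'D_w ('D_v F) q = 'D_w (\sum_i (v 0 i \*: 'D_(delta_mx 0 i) F)) q.
  apply: near_eq_derive; apply: filterS (open_nbhs_nbhs (conj oU Uq)) => x Ux.
  by rewrite derive_rV_dir ?fct_sumE//; exact: smooth_on_diff sF Ux.
rewrite derive_sum => [|i]; last exact: derivableZ.
by apply: eq_bigr => i _; rewrite deriveZ.
Qed.

(** Direction and base point vary together; expanding the direction in the canonical basis reduces
    this to the product rule, with one term for each variation. *)
Lemma is_derive_dir_along (n p : nat) (U : set 'rV[R]_n) (F : 'rV[R]_n -> 'rV[R]_p)
    (c V : R -> 'rV[R]_n) (c' V' : 'rV[R]_n) (s : R) :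
  open U -> smooth_on U F -> U (c s) -> is_derive s 1 c c' -> is_derive s 1 V V' ->
  is_derive s 1 (fun t => 'D_(V t) F (c t)) ('D_V' F (c s) + 'D_c' ('D_(V s) F) (c s)).
Proof.
move=> oU sF Ucs dc dV.
have Uc : \forall t \near s, U (c t).
  exact: (is_derive_continuous dc) (open_nbhs_nbhs (conj oU Ucs)).
apply: (@near_eq_is_derive _ _ _ (fun t => \sum_i V t 0 i *: 'D_(delta_mx 0 i) F (c t))).
  apply: filterS Uc => t Ut; rewrite [RHS]derive_rV_dir//; exact: smooth_on_diff sF Ut.
rewrite derive_rV_dir; last exact: smooth_on_diff sF Ucs.
rewrite (derive_sum_coord _ _ oU sF Ucs) -big_split/=.
apply: is_derive_bigsum => i; apply: is_derive_scale; first exact: is_derive_component.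
apply: (is_derive_comp_diff dc); exact: smooth_on_diff (smooth_on_derive _ sF) Ucs.
Qed.

End CurveCalculus.

Lemma submanifold_adapted_retraction (R : realType) m (N : set 'rV[R]_m) p :
  is_submanifold N -> N p -> exists r P Pi, adapted_retraction N p r P Pi.
Proof.
move=> [c H] Np; have [U [F [oU Up sF NF rk]]] := H p Np.
exact: (adapted_retraction_of_submersion oU Up Np sF NF (rk p Up Np)).
Qed.

(** * Tangent spaces and the second fundamental form *)

Section Geometry.
Context {R : realType} (m : nat) (N : set 'rV[R]_m) (p : 'rV[R]_m) (r : R)
  (P : 'M[R]_m) (Pi : 'rV[R]_m -> 'rV[R]_m).
Hypotheses (Np : N p) (H : adapted_retraction N p r P Pi).

Let oB : open (ball p r). Proof. exact: ball_open. Qed.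
Let Bp : ball p r p. Proof. by apply: ballxx; case: H. Qed.
Let sPi := ret_smooth H.

Lemma ret_diff q : ball p r q -> differentiable Pi q.
Proof. by move=> bq; exact: smooth_on_diff sPi bq. Qed.

Lemma curve_near_ret (c : R -> 'rV[R]_m) (s : R) :
  {for s, continuous c} -> (\forall t \near s, N (c t)) -> ball p r (c s) ->
  \forall t \near s, Pi (c t) = c t.
Proof.
move=> cc Nc bc; near=> t; apply: (ret_id H); last by near: t.
by near: t; exact: cc (open_nbhs_nbhs (conj oB bc)).
Unshelve. all: by end_near. Qed.

Lemma curve_velocity (c : R -> 'rV[R]_m) (c' : 'rV[R]_m) (s : R) :
  is_derive s 1 c c' -> (\forall t \near s, N (c t)) -> ball p r (c s) ->
  'D_c' Pi (c s) = c'.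
Proof.
move=> dc Nc bc; have nc := curve_near_ret (is_derive_continuous dc) Nc bc.
have d1 := is_derive_comp_diff dc (ret_diff bc).
exact: is_derive_unique (near_eq_is_derive nc d1) dc.
Qed.

(** Differentiate [Pi \o c = c] along a curve of N through q. This holds throughout the ball,
    whereas the matrix P describes the tangent space at the centre only. *)
Lemma tangent_fixed q v : ball p r q -> N q -> tangent_space N q v -> 'D_v Pi q = v.
Proof.
move=> bq Nq [J [c [oJ J0 sc Nc [c0 c0']]]].
have dc : is_derive (0 : R) 1 c v.
  rewrite -c0' derive1E; apply: DeriveDef => //; apply: diff_derivable.
  exact: smooth_on_diff sc J0.
rewrite -c0; apply: curve_velocity; rewrite ?c0//.
by apply: filterS (open_nbhs_nbhs (conj oJ J0)).
Qed.

Lemma tangent_derive q w : ball p r q -> N q -> tangent_space N q ('D_w Pi q).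
Proof.
move=> bq Nq; pose l (t : R) := q + t *: w.
have cl : continuous l by move=> t; exact: is_derive_continuous (is_derive_line q w t).
have oJ : open (l @^-1` ball p r) by apply: open_comp => // t _; exact: cl.
have l0 : l 0 = q by rewrite /l scale0r addr0.
exists (l @^-1` ball p r), (Pi \o l); split=> //.
- by rewrite /preimage/= l0.
- apply: (smooth_on_comp oJ oB) => //.
  have -> : l = cst q + (fun t : R => t *: w) by [].
  apply: smooth_on_add => //; first exact: smooth_on_cst.
  apply: smooth_on_linear => //; first by move=> a x y; rewrite scalerDl scalerA.
  exact: scalel_continuous.
- by move=> t; exact: (ret_in H).
- split; first by rewrite /= l0 (ret_id H).
  rewrite derive1E; have dl : is_derive (0 : R) 1 l w by exact: is_derive_line.
  have dP : differentiable Pi (l 0) by rewrite l0; exact: ret_diff.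
  by have [_ ->] := is_derive_comp_diff dl dP; rewrite l0.
Qed.

Lemma tangent_spaceP v : tangent_space N p v <-> v *m P = v.
Proof.
split=> [/(tangent_fixed Bp Np)|vP]; first by rewrite (ret_derive_center H).
by rewrite -vP -(ret_derive_center H); exact: tangent_derive.
Qed.

Lemma dot_mulmx_sym (v z : 'rV[R]_m) : dot (v *m P) z = dot v (z *m P).
Proof. by rewrite !dotE trmx_mul (ret_sym H) mulmxA. Qed.

Lemma tangent_projE v : tangent_proj N p v = v *m P.
Proof.
rewrite /tangent_proj; apply: get_unique => [|w [/tangent_spaceP wP nw]].
  split; first by apply/tangent_spaceP; rewrite -mulmxA (ret_idem H).
  move=> z /tangent_spaceP <-.
  by rewrite -dot_mulmx_sym mulmxBl -mulmxA (ret_idem H) subrr /dot big1// => i _; rewrite mxE mul0r.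
have : v *m P - w = 0.
  rewrite -{1}wP -mulmxBl; apply: dot_eq0.
  rewrite dot_mulmx_sym -mulmxA (ret_idem H); apply: nw.
  by apply/tangent_spaceP; rewrite -mulmxA (ret_idem H).
by move/eqP; rewrite subr_eq0 => /eqP ->.
Qed.

Lemma normal_iff v : (forall z, tangent_space N p z -> dot v z = 0) <-> v *m P = 0.
Proof.
split=> [nv|vP z /tangent_spaceP <-].
  apply: dot_eq0; rewrite dot_mulmx_sym -mulmxA (ret_idem H); apply: nv.
  by apply/tangent_spaceP; rewrite -mulmxA (ret_idem H).
by rewrite -dot_mulmx_sym vP /dot big1// => i _; rewrite mxE mul0r.
Qed.

(** ['D_v Pi] composed with P is the constant [v *m P]. *)
Lemma derive2_proj0 q v w : ball p r q -> 'D_w ('D_v Pi) q *m P = 0.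
Proof.
move=> bq; pose l (t : R) := q + t *: w.
have l0 : l 0 = q by rewrite /l scale0r addr0.
have dD : differentiable ('D_v Pi) (l 0).
  by rewrite l0; exact: smooth_on_diff (smooth_on_derive _ sPi) bq.
have dl : is_derive (0 : R) 1 l w by exact: is_derive_line.
have d1 := is_derive_mulmx P (is_derive_comp_diff dl dD).
have E : \forall t \near (0 : R), cst (v *m P) t = ('D_v Pi \o l) t *m P.
  have nl : \forall t \near (0 : R), ball p r (l t) by apply: (is_derive_near dl oB); rewrite l0.
  by apply: filterS nl => t bt; rewrite /= (ret_derive_proj H).
have d0 : is_derive (0 : R) 1 (cst (v *m P)) (0 : 'rV[R]_m) by exact: is_derive_cst.
by rewrite -(is_derive_unique d1 (near_eq_is_derive E d0)) l0.
Qed.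

(** For every tangent extension W of w, ['D_(W) Pi = W] holds along the curve Pi (p + t v). Its
    derivative at t = 0 reads D_v W = (D_v W) P + D_v D_w Pi, so the normal part of D_v W is the
    same for all W and [get] has a single candidate. *)
Lemma second_fund_formE v w : tangent_space N p v -> tangent_space N p w ->
  second_fund_form N p v w = - 'D_v ('D_w Pi) p.
Proof.
move=> Tv /tangent_spaceP wP; rewrite /second_fund_form; apply: get_unique.
  exists (ball p r), ('D_w Pi); split=> //.
  - exact: smooth_on_derive.
  - by rewrite (ret_derive_center H).
  - by move=> q bq Nq; exact: tangent_derive.
  - by rewrite tangent_projE (derive2_proj0 _ _ Bp) subr0.
move=> n [U [W [[oU Up] sW Wp WT ->]]]; rewrite tangent_projE; congr (- _).
have /tangent_spaceP vP := Tv.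
pose l (t : R) := p + t *: v.
have l0 : l 0 = p by rewrite /l scale0r addr0.
have dl : is_derive (0:R) 1 l v by exact: is_derive_line.
have dPl : differentiable Pi (l 0) by rewrite l0; exact: ret_diff.
have dc : is_derive (0:R) 1 (Pi \o l) v.
  by have := is_derive_comp_diff dl dPl; rewrite l0 (ret_derive_center H) vP.
have c0 : (Pi \o l) 0 = p by rewrite /= l0 (ret_id H).
have dW : differentiable W ((Pi \o l) 0) by rewrite c0; exact: smooth_on_diff sW Up.
have dWc := is_derive_comp_diff dc dW.
have Bc : ball p r ((Pi \o l) 0) by rewrite c0.
have dV := is_derive_dir_along oB sPi Bc dc dWc.
have nB := is_derive_near dc oB Bc.
have nU : \forall t \near (0 : R), U ((Pi \o l) t) by apply: (is_derive_near dc oU); rewrite c0.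
have nbl : \forall t \near (0 : R), ball p r (l t) by apply: (is_derive_near dl oB); rewrite l0.
have E : \forall t \near (0:R), 'D_((W \o (Pi \o l)) t) Pi ((Pi \o l) t) = (W \o (Pi \o l)) t.
  near=> t; have bt : ball p r (l t) by near: t.
  apply: tangent_fixed.
  - by near: t.
  - exact: (ret_in H).
  - apply: WT; last exact: (ret_in H).
    by near: t.
have := is_derive_unique (near_eq_is_derive E dV) dWc.
rewrite c0 (ret_derive_center H) /= -/l.
have -> : W (Pi (l 0)) = w by rewrite -[Pi (l 0)]/((Pi \o l) 0) c0.
by move=> E1; apply/eqP; rewrite subr_eq addrC; apply/eqP/esym; exact: E1.
Unshelve. all: by end_near. Qed.

Lemma curve_acceleration (c c' : R -> 'rV[R]_m) (c'' : 'rV[R]_m) (s : R) :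
  (\forall t \near s, N (c t)) -> (\forall t \near s, is_derive (t : R) 1 c (c' t)) ->
  is_derive s 1 c' c'' -> ball p r (c s) ->
  c'' = 'D_c'' Pi (c s) + 'D_(c' s) ('D_(c' s) Pi) (c s).
Proof.
move=> Nc dc dc' bc.
have dcs : is_derive s 1 c (c' s) := nbhs_singleton dc.
have dV := is_derive_dir_along oB sPi bc dcs dc'.
apply: (is_derive_unique dc'); apply: near_eq_is_derive dV.
have NNc := near_join Nc.
near=> t; apply: curve_velocity.
- by near: t; exact: dc.
- by near: t.
- by near: t; exact: is_derive_near dcs oB bc.
Unshelve. all: by end_near. Qed.

(** The Gauss formula. Through it the harmonic map equation, the geodesic equation and the
    controlled flow all become statements about the tangential part of a second derivative. *)
Lemma curve_second_fund_form (c c' : R -> 'rV[R]_m) (c'' : 'rV[R]_m) (s : R) :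
  (\forall t \near s, N (c t)) -> (\forall t \near s, is_derive (t : R) 1 c (c' t)) ->
  is_derive s 1 c' c'' -> c s = p ->
  [/\ tangent_space N p (c' s), c' s *m P = c' s &
      c'' + second_fund_form N p (c' s) (c' s) = c'' *m P].
Proof.
move=> Nc dc dc' cs; have bc : ball p r (c s) by rewrite cs.
have dcs : is_derive s 1 c (c' s) := nbhs_singleton dc.
have := curve_velocity dcs Nc bc; rewrite cs (ret_derive_center H) => c'P.
have Tc : tangent_space N p (c' s) by exact/tangent_spaceP.
split=> //; rewrite second_fund_formE//.
rewrite {1}(curve_acceleration Nc dc dc' bc) cs (ret_derive_center H).
by rewrite addrK.
Qed.

End Geometry.

(** * Gevrey step functions *)

Section Primitive.
Context {R : realType}.

Lemma is_derive_scalar_continuous (f : R -> R) (f' s : R) :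
  is_derive s 1 f f' -> {for s, continuous f}.
Proof. by move=> [df _]; apply: differentiable_continuous; exact/derivable1_diffP. Qed.

Lemma mean_value_point (f f' : R -> R) (a b : R) :
  a <= b -> (forall s : R, a <= s <= b -> is_derive s 1 f (f' s)) ->
  exists2 c, a <= c <= b & f b - f a = f' c * (b - a).
Proof.
move=> ab df.
have dfo (x : R) : x \in `]a, b[%R -> is_derive x 1 f (f' x).
  by rewrite in_itv/= => /andP[ax xb]; apply: df; rewrite !ltW.
have cf : {within `[a, b], continuous f}.
  apply: derivable_within_continuous => x; rewrite in_itv/= => xab.
  by have [] := df x xab.
have [c cab E] := MVT_segment ab dfo cf.
by exists c; rewrite // -[_ <= c <= _]/(c \in `[a, b]).
Qed.

Lemma mean_value_scalar_le (f f' : R -> R) (a b M : R) :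
  a <= b -> (forall s : R, a <= s <= b -> is_derive s 1 f (f' s)) ->
  (forall s, a <= s <= b -> `|f' s| <= M) -> `|f b - f a| <= M * (b - a).
Proof.
move=> ab df Mf; have [c cab ->] := mean_value_point ab df.
by rewrite normrM [X in _ * X]ger0_norm ?subr_ge0// ler_wpM2r ?subr_ge0//; exact: Mf.
Qed.

Lemma derive_eq_diff (F G f : R -> R) (a b : R) :
  (forall s : R, Num.min a b <= s <= Num.max a b -> is_derive s 1 F (f s)) ->
  (forall s : R, Num.min a b <= s <= Num.max a b -> is_derive s 1 G (f s)) ->
  F b - F a = G b - G a.
Proof.
wlog ab : a b / a <= b.
  move=> W dF dG; have [|/ltW ba] := leP a b; first by move=> ab; exact: W.
  apply: oppr_inj; rewrite !opprB; apply: W => // s; rewrite minC maxC; [exact: dF|exact: dG].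
rewrite min_l// max_r// => dF dG.
have dFG (s : R) : a <= s <= b -> is_derive s 1 (F - G) ((fun=> 0) s).
  by move=> sab; rewrite -(subrr (f s)); apply: is_deriveB; [exact: dF|exact: dG].
have [c _] := mean_value_point ab dFG.
rewrite mul0r !fctE => /eqP; rewrite subr_eq0 => /eqP H; lra.
Qed.

Lemma exists_primitive (f : R -> R) : continuous f ->
  exists F : R -> R, F 0 = 0 /\ forall x : R, is_derive x 1 F (f x).
Proof.
move=> cf; pose I a x := (\int[lebesgue_measure]_(t in `[a, x]) f t)%R.
have dI a (x : R) : a < x -> is_derive x 1 (I a) (f x).
  move=> ax; have [] := @continuous_FTC1_closed R f a x (x + 1).
  - by rewrite ltrDl.
  - apply: continuous_compact_integrable; first exact: segment_compact.
    exact: continuous_subspaceT.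
  - exact: ax.
  - exact: cf.
  - by move=> d1 d2; apply: (DeriveDef d1); rewrite -derive1E; exact: d2.
(* The fundamental theorem is applied strictly to the right of the lower limit, so that limit lies
   below both x and 0; [FE] shows that F does not depend on it. *)
pose a (x : R) : R := Num.min x 0 - 1.
pose F (x : R) := I (a x) x - I (a x) 0.
have FE b x : b < x -> b < 0 -> F x = I b x - I b 0.
  move=> bx b0; apply: (@derive_eq_diff _ _ f) => s /andP[s0 _]; apply: dI;
    apply: lt_le_trans s0.
    by rewrite minC /a ltrBlDr ltrDl.
  by rewrite lt_min b0.
exists F; split; first by rewrite /F subrr.
move=> x; pose b := a x - 1.
have ax : a x < x by rewrite /a; have : Num.min x 0 <= x; [by rewrite ge_min lexx|lra].
have bx : b < x by rewrite /b; lra.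
have b0 : b < 0.
  by rewrite /b /a; have : Num.min x 0 <= 0; [by rewrite ge_min lexx orbT|lra].
apply: (@near_eq_is_derive _ _ _ (I b - cst (I b 0))).
  have nb : \forall y \near x, b < y by exact: lt_nbhsr.
  by apply: filterS nb => y by_; rewrite (FE b y).
rewrite -[f x]subr0; apply: is_deriveB; exact: dI.
Qed.

Definition prim (f : R -> R) : R -> R :=
  get [set F : R -> R | F 0 = 0 /\ forall x : R, is_derive x 1 F (f x)].

Lemma primP (f : R -> R) : continuous f ->
  prim f 0 = 0 /\ forall x : R, is_derive x 1 (prim f) (f x).
Proof.
by move=> /exists_primitive[F HF]; exact: (@getPex _ [set F : R -> R | _] (ex_intro _ F HF)).
Qed.

Lemma prim0 (f : R -> R) : continuous f -> prim f 0 = 0.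
Proof. by case/primP. Qed.

Lemma is_derive_prim (f : R -> R) (x : R) : continuous f -> is_derive x 1 (prim f) (f x).
Proof. by case/primP. Qed.

Lemma continuous_uniform_limit (g : R -> R) :
  (forall e, 0 < e -> exists2 f : R -> R, continuous f & forall s, `|f s - g s| <= e) ->
  continuous g.
Proof.
move=> H x; apply/cvgrPdist_le => e e0.
have e3 : 0 < e / 3 by rewrite divr_gt0.
have [f cf fg] := H _ e3.
have /cvgrPdist_le/(_ _ e3) := cf x; apply: filterS => y fxy.
have := fg x; have := fg y; move: fxy; rewrite !ler_norml.
move=> /andP[? ?] /andP[? ?] /andP[? ?]; apply/andP; split; lra.
Qed.

Lemma is_derive_shift_comp (f : R -> R) (f' a t : R) :
  is_derive (t - a) 1 f f' -> is_derive t 1 (fun s => f (s - a)) f'.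
Proof.
move=> df; have dsh : is_derive t 1 (fun s : R => s - a) 1.
  by rewrite -[X in is_derive _ _ _ X]subr0; apply: is_deriveB.
have dg : differentiable f ((fun s : R => s - a) t).
  by apply/derivable1_diffP; case: df.
by have := is_derive_comp_diff dsh dg; have [_ ->] := df.
Qed.

(** Convolution with the uniform density on [0, a]. Being one-sided, it keeps functions zero for t
    <= 0, and its derivative is a difference quotient of f, even for f merely continuous. *)
Definition average (a : R) (f : R -> R) (t : R) : R := (prim f t - prim f (t - a)) / a.

Lemma is_derive_average (a : R) (f : R -> R) (t : R) : continuous f ->
  is_derive t 1 (average a f) ((f t - f (t - a)) / a).
Proof.
move=> cf; rewrite /average.
have -> : (fun t => (prim f t - prim f (t - a)) / a) =
    a^-1 \*: (prim f - (fun t => prim f (t - a))).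
  by apply/funext => s; rewrite !fctE /= mulrC.
rewrite [_ / a]mulrC; apply: is_deriveZ; apply: is_deriveB; first exact: is_derive_prim.
by apply: is_derive_shift_comp; exact: is_derive_prim.
Qed.

Lemma average_continuous a f : continuous f -> continuous (average a f).
Proof. by move=> cf t; exact: is_derive_scalar_continuous (is_derive_average a t cf). Qed.

Lemma average_diff a f g t : 0 < a -> continuous f -> continuous g ->
  exists2 c, t - a <= c <= t & average a f t - average a g t = f c - g c.
Proof.
move=> a0 cf cg; have ta : t - a <= t by rewrite gerBl ltW.
have dFG (s : R) : t - a <= s <= t -> is_derive s 1 (prim f - prim g) ((f - g) s).
  by move=> _; apply: is_deriveB; exact: is_derive_prim.
have [c cta] := mean_value_point ta dFG.
rewrite !fctE => E; exists c => //; rewrite /average -mulrBl.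
apply: (mulIf (lt0r_neq0 a0)); rewrite divfK ?gt_eqF//.
have e : t - (t - a) = a by ring.
by rewrite e in E; rewrite -E; ring.
Qed.

Lemma average_point a f t : 0 < a -> continuous f ->
  exists2 c, t - a <= c <= t & average a f t = f c.
Proof.
move=> a0 cf; have ta : t - a <= t by rewrite gerBl ltW.
have dF (s : R) : t - a <= s <= t -> is_derive s 1 (prim f) (f s).
  by move=> _; exact: is_derive_prim.
have [c cta E] := mean_value_point ta dF; exists c => //.
have e : t - (t - a) = a by ring.
by rewrite /average E e mulfK// gt_eqF.
Qed.

End Primitive.

(** * A step function as a limit of iterated averages *)

Section Limits.
Context {R : realType}.

(** Nested intervals again, now with radii of arbitrary decay: the tails below decrease only like
    k^(-1/2). *)
Lemma telescoping_limit (u e : nat -> R) :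
  (forall n, 0 <= e n) -> (forall n, `|u n.+1 - u n| <= e n - e n.+1) ->
  exists l, forall n, `|u n - l| <= e n.
Proof.
move=> e0 H.
have aS n : u n - e n <= u n.+1 - e n.+1.
  by have := H n; rewrite ler_norml => /andP[+ _]; move: (e n.+1) (e n) => E D; lra.
have bS n : u n.+1 + e n.+1 <= u n + e n.
  by have := H n; rewrite ler_norml => /andP[_ +]; move: (e n.+1) (e n) => E D; lra.
have am m n : u n - e n <= u (n + m)%N - e (n + m)%N.
  by elim: m => [|m IH]; rewrite ?addn0// addnS; exact: le_trans (aS _).
have bm m n : u (n + m)%N + e (n + m)%N <= u n + e n.
  by elim: m => [|m IH]; rewrite ?addn0// addnS; exact: le_trans (bS _) IH.
have ab m n : u n - e n <= u m + e m.
  apply: le_trans (am m n) _; apply: le_trans (_ : _ <= u (m + n)%N + e (m + n)%N) _; last exact: bm.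
  by rewrite addnC; have := e0 (m + n)%N; lra.
exists (sup (range (fun n => u n - e n))) => n.
have h1 : sup (range (fun n => u n - e n)) <= u n + e n.
  by apply: ge_sup => [|_ [k _ <-]]; [exists (u 0%N - e 0%N); exists 0%N|exact: ab].
have h2 : u n - e n <= sup (range (fun n => u n - e n)).
  apply: ub_le_sup; last by exists n.
  by exists (u 0%N + e 0%N) => _ [k _ <-]; exact: ab.
by rewrite ler_norml; apply/andP; split; move: (sup _) (e n) h1 h2 => S E; lra.
Qed.

End Limits.

Section SmoothStep.
Context {R : realType}.

(* The widths sum up to 1, so that infinitely many averagings keep the
   transition interval bounded, while the product of the [2 / width j], [j < k], grows like [k!^(3/2)]. *)
Definition tail (k : nat) : R := (Num.sqrt k.+1%:R)^-1.
Definition width (k : nat) : R := tail k - tail k.+1.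

Lemma sqrtS_gt0 k : 0 < Num.sqrt k.+1%:R :> R.
Proof. by rewrite sqrtr_gt0. Qed.

Lemma tail_gt0 k : 0 < tail k.
Proof. by rewrite invr_gt0 sqrtS_gt0. Qed.

Lemma tail_le1 k : tail k <= 1.
Proof.
rewrite invf_le1 ?sqrtS_gt0// -[leLHS]sqrtr1 ler_sqrt// ler1n//.
Qed.

Lemma widthE k : width k =
  (Num.sqrt k.+1%:R * Num.sqrt k.+2%:R * (Num.sqrt k.+1%:R + Num.sqrt k.+2%:R))^-1.
Proof.
have a0 := sqrtS_gt0 k; have b0 := sqrtS_gt0 k.+1.
have a2 : Num.sqrt k.+1%:R ^+ 2 = k.+1%:R :> R by rewrite sqr_sqrtr.
have b2 : Num.sqrt k.+2%:R ^+ 2 = k.+2%:R :> R by rewrite sqr_sqrtr.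
have E : Num.sqrt k.+2%:R ^+ 2 - Num.sqrt k.+1%:R ^+ 2 = 1 :> R.
  by rewrite a2 b2 -[k.+2]addn1 natrD; ring.
rewrite /width /tail; move: (Num.sqrt k.+1%:R) (Num.sqrt k.+2%:R) a0 b0 E => a b a0 b0 E.
have ab : a + b != 0 by rewrite gt_eqF// addr_gt0.
have a1 : a != 0 by rewrite gt_eqF.
have b1 : b != 0 by rewrite gt_eqF.
rewrite -[RHS]mul1r -E; field; by rewrite a1 b1 /= ?[b + a]addrC ab.
Qed.

Lemma width_gt0 k : 0 < width k.
Proof. by rewrite widthE invr_gt0 !mulr_gt0 ?addr_gt0 ?sqrtS_gt0. Qed.

(** The left side is 1 / (2 n^(3/2)) with n = k + 2. *)
Lemma width_ge k : Num.sqrt k.+2%:R / (2 * k.+2%:R ^+ 2) <= width k.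
Proof.
rewrite widthE; have a0 := sqrtS_gt0 k; have b0 := sqrtS_gt0 k.+1.
have b2 : Num.sqrt k.+2%:R ^+ 2 = k.+2%:R :> R by rewrite sqr_sqrtr.
have ab : Num.sqrt k.+1%:R <= Num.sqrt k.+2%:R :> R by rewrite ler_sqrt// ler_nat.
have -> : 2 * k.+2%:R ^+ 2 = 2 * (Num.sqrt k.+2%:R ^+ 2) ^+ 2 :> R by rewrite b2.
move: (Num.sqrt k.+1%:R) (Num.sqrt k.+2%:R) a0 b0 ab => a b a0 b0 ab.
have b1 : b != 0 by rewrite gt_eqF.
have -> : b / (2 * (b ^+ 2) ^+ 2) = (2 * b ^+ 3)^-1 by field.
rewrite lef_pV2 ?posrE ?mulr_gt0 ?addr_gt0 ?exprn_gt0//.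
have : 0 <= (b - a) * b * b by rewrite !mulr_ge0 ?subr_ge0// ltW.
have : 0 <= (b - a) * a * b by rewrite !mulr_ge0 ?subr_ge0// ltW.
by nra.
Qed.

Lemma tail_small (e : R) : 0 < e -> exists n, forall k, (n <= k)%N -> tail k <= e.
Proof.
move=> e0; exists (Num.truncn (e^-1 ^+ 2)).+1 => k nk.
have -> : e = (Num.sqrt (e^-1 ^+ 2))^-1.
  by rewrite sqrtr_sqr ger0_norm ?invrK// invr_ge0 ltW.
rewrite /tail lef_pV2 ?posrE ?sqrtS_gt0// ?sqrtr_gt0 ?exprn_gt0 ?invr_gt0//.
apply: ler_wsqrtr; apply: le_trans (ltW (truncnS_gt _)) _; by rewrite ler_nat ltnW.
Qed.

Definition ramp (t : R) : R := Num.max 0 (Num.min t 1).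

Lemma ramp_lip s t : s <= t -> 0 <= ramp t - ramp s <= t - s.
Proof.
by move=> st; rewrite /ramp /Num.max /Num.min; do ![case: ifPn]; rewrite -?leNgt => *; apply/andP; split; lra.
Qed.

Lemma ramp_continuous : continuous ramp.
Proof.
move=> t; apply/cvgrPdist_le => e e0; apply/nbhs_ballP; exists e => // s /= /ltW.
have [st|/ltW ts] := leP s t.
  have /andP[a b] := ramp_lip st.
  by rewrite !ger0_norm ?subr_ge0//; [lra|lra].
have /andP[a b] := ramp_lip ts.
by rewrite distrC [X in _ -> X <= _]distrC !ger0_norm ?subr_ge0//; [lra|lra].
Qed.

(** Averages of widths k, ..., k + j - 1 applied to the ramp. The starting index k is a parameter
    because the limits Y k in j then satisfy Y k = average (width k) (Y k.+1), from which all
    derivatives are read off. *)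
Fixpoint smoothing (j k : nat) : R -> R :=
  if j is j'.+1 then average (width k) (smoothing j' k.+1) else ramp.

Lemma smoothing_continuous j k : continuous (smoothing j k).
Proof. by elim: j k => [|j IH] k; [exact: ramp_continuous|exact: average_continuous]. Qed.

Lemma smoothing_itv j k t : 0 <= smoothing j k t <= 1.
Proof.
elim: j k t => [|j IH] k t.
  by rewrite /= /ramp le_max lexx/= ge_max ler01/= ge_min lexx orbT.
have [c _ /= ->] := average_point t (width_gt0 k) (@smoothing_continuous j k.+1).
exact: IH.
Qed.

Lemma smoothing_le0 j k t : t <= 0 -> smoothing j k t = 0.
Proof.
elim: j k t => [|j IH] k t t0.
  by rewrite /= /ramp max_l// ge_min t0.
have [c /andP[_ ct] /= ->] := average_point t (width_gt0 k) (@smoothing_continuous j k.+1).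
by apply: IH; exact: le_trans ct t0.
Qed.

(** Each average delays saturation by its width; the widths telescope to tail k - tail (k + j). *)
Lemma smoothing_ge j k t : 1 + tail k - tail (k + j) <= t -> smoothing j k t = 1.
Proof.
elim: j k t => [|j IH] k t t1.
  rewrite /= /ramp; rewrite addn0 addrK in t1.
  by rewrite min_r// max_r.
have [c /andP[ct _] /= ->] := average_point t (width_gt0 k) (@smoothing_continuous j k.+1).
apply: IH; apply: le_trans ct; rewrite addSnnS /width; lra.
Qed.

(** The two functions differ by one innermost average of width [width (k + j)]. It displaces the
    1-Lipschitz ramp by at most that width, and the outer averages do not increase sup distances. *)
Lemma smoothing_step j k t : `|smoothing j.+1 k t - smoothing j k t| <= width (k + j)%N.
Proof.
elim: j k t => [|j IH] k t.
  rewrite addn0; have [c /andP[c1 c2] /= ->] := average_point t (width_gt0 k) ramp_continuous.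
  have /andP[a b] := ramp_lip c2; rewrite distrC ger0_norm//; lra.
have [c _ E] := average_diff t (width_gt0 k) (@smoothing_continuous j.+1 k.+1)
  (@smoothing_continuous j k.+1).
rewrite -[smoothing j.+2 k]/(average (width k) (smoothing j.+1 k.+1)).
rewrite -[smoothing j.+1 k in X in `|_ - X|]/(average (width k) (smoothing j k.+1)).
by rewrite E -addSnnS; exact: IH.
Qed.

Lemma smoothing_limit_ex : exists Y : nat -> R -> R,
  forall k j t, `|smoothing j k t - Y k t| <= tail (k + j)%N.
Proof.
have H (kt : nat * R) : exists l, forall j, `|smoothing j kt.1 kt.2 - l| <= tail (kt.1 + j)%N.
  apply: telescoping_limit => j; first exact/ltW/tail_gt0.
  by have := smoothing_step j kt.1 kt.2; rewrite /width addnS.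
by have [Y HY] := choice H; exists (fun k t => Y (k, t)) => k j t; exact: (HY (k, t)).
Qed.

Definition finite_diff (a : R) (f : R -> R) (t : R) : R := (f t - f (t - a)) / a.

(** Applied to Y k this is the k-th derivative of Y 0, because differentiating an average leaves a
    difference quotient of the averaged function. Each quotient multiplies sup bounds by at most 2 /
    width j. *)
Fixpoint iter_diff (k : nat) (f : R -> R) : R -> R :=
  if k is k'.+1 then iter_diff k' (finite_diff (width k') f) else f.

Lemma iter_diff_derive k (f g : R -> R) :
  (forall t : R, is_derive t 1 f (g t)) ->
  forall t : R, is_derive t 1 (iter_diff k f) (iter_diff k g t).
Proof.
elim: k f g => [//|k IH] f g fg; apply: IH => t.
rewrite /finite_diff.
have -> : (fun t => (f t - f (t - width k)) / width k) =
    (width k)^-1 \*: (f - (fun t => f (t - width k))).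
  by apply/funext => s; rewrite !fctE /= mulrC.
rewrite [_ / _]mulrC; apply: is_deriveZ; apply: is_deriveB.
by apply: is_derive_shift_comp; exact: fg.
Qed.

Lemma iter_diff_bound k (f : R -> R) M : (forall t, `|f t| <= M) ->
  forall t, `|iter_diff k f t| <= M * \prod_(j < k) (2 / width j).
Proof.
elim: k f M => [|k IH] f M fM t; first by rewrite big_ord0 mulr1.
rewrite big_ord_recr/= [\prod_(i < k) _ * _]mulrC mulrA; apply: IH => s.
rewrite /finite_diff normrM mulrA normfV (gtr0_norm (width_gt0 k)).
rewrite ler_pM2r ?invr_gt0 ?width_gt0//; apply: le_trans (ler_normB _ _) _.
by have := fM s; have := fM (s - width k); lra.
Qed.

Lemma iter_diff_le0 k (f : R -> R) : (forall t, t <= 0 -> f t = 0) ->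
  forall t, t <= 0 -> iter_diff k f t = 0.
Proof.
elim: k f => [//|k IH] f f0; apply: IH => t t0.
rewrite /finite_diff !f0 ?subrr ?mul0r//.
by have := width_gt0 k; lra.
Qed.

Lemma eventually_decreasing_bounded (u : nat -> R) K :
  (forall k, (K <= k)%N -> u k.+1 <= u k) -> exists C, forall k, u k <= C.
Proof.
move=> H; exists (\sum_(j < K.+1) `|u j|) => k.
have [kK|Kk] := leqP k K.
  rewrite (bigD1 (Ordinal (kK : (k < K.+1)%N)))//=.
  by apply: le_trans (ler_norm _) _; rewrite lerDl sumr_ge0.
have : forall j, u (K + j)%N <= u K.
  by elim=> [|j IH]; rewrite ?addn0// addnS; apply: le_trans (H _ _) IH; exact: leq_addr.
move=> /(_ (k - K)%N); rewrite subnKC ?(ltnW Kk)// => /le_trans; apply.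
rewrite (bigD1 ord_max)//=.
by apply: le_trans (ler_norm _) _; rewrite lerDl sumr_ge0.
Qed.

(** Ratio test: consecutive terms have ratio 2 r / ((2k + 2) (2k + 1) width k), at most of order
    k^(-1/2) by [width_ge]. It is at most 1 once 8 r <= sqrt (k + 2), which determines [K]. *)
Lemma prod_width_growth (r : R) : 0 <= r ->
  exists C, forall k, (\prod_(j < k) (2 / width j)) * r ^+ k / (k.*2)`!%:R <= C.
Proof.
move=> r0; pose K := (Num.truncn ((8 * r) ^+ 2)).+1.
apply: (@eventually_decreasing_bounded _ K) => k Kk.
rewrite big_ord_recr/= exprS doubleS !factS -doubleS.
set p := \prod_(i < k) _; have p0 : 0 <= p.
  by apply: prodr_ge0 => i _; rewrite divr_ge0// ltW// width_gt0.
have F0 : 0 < (k.*2)`!%:R :> R by rewrite ltr0n fact_gt0.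
rewrite !natrM; set F := (k.*2)`!%:R in F0 *.
have q0 : 0 <= p * r ^+ k / F by rewrite !mulr_ge0 ?exprn_ge0 ?invr_ge0// ltW.
have w0 := width_gt0 k.
have A0 : 0 < (k.+1).*2%:R * (k.*2).+1%:R * width k by rewrite !mulr_gt0// ltr0n.
have -> : p * (2 / width k) * (r * r ^+ k) / ((k.+1).*2%:R * ((k.*2).+1%:R * F)) =
    (p * r ^+ k / F) * (2 * r / ((k.+1).*2%:R * (k.*2).+1%:R * width k)).
  have n1 : (k.*2).+1%:R != 0 :> R by rewrite pnatr_eq0.
  have n2 : (k.+1).*2%:R != 0 :> R by rewrite pnatr_eq0 double_eq0.
  have w1 : width k != 0 by rewrite gt_eqF.
  have F1 : F != 0 by rewrite gt_eqF.
  clear F0 q0 w0 A0; move: (width k) F (r ^+ k) ((k.+1).*2%:R) ((k.*2).+1%:R) w1 F1 n1 n2 => W G Q X Y w1 F1 n1 n2.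
  by field; rewrite n1 n2 w1 F1.
rewrite ler_piMr// ler_pdivrMr// mul1r.
have h1 := width_ge k; have s0 := sqrtS_gt0 k.+1.
have h2 : 8 * r <= Num.sqrt k.+2%:R.
  rewrite -[8 * r]ger0_norm ?mulr_ge0// -sqrtr_sqr ler_sqrt//.
  by apply: le_trans (ltW (truncnS_gt _)) _; rewrite ler_nat (leq_trans Kk)// ltnW.
have h3 : k.+2%:R ^+ 2 <= 2 * ((k.+1).*2%:R * (k.*2).+1%:R) :> R.
  rewrite -natrX -!natrM ler_nat -!mul2n; nia.
have h4 : 0 < k.+2%:R ^+ 2 :> R by rewrite exprn_gt0.
move: (Num.sqrt k.+2%:R) (width k) ((k.+1).*2%:R * (k.*2).+1%:R) (k.+2%:R ^+ 2) h1 h2 h3 h4 s0 w0 => S w B n h1 h2 h3 h4 s0 w0.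
rewrite ler_pdivrMr ?mulr_gt0// in h1.
have : 0 <= (2 * B - n) * w by rewrite mulr_ge0 ?subr_ge0// ltW.
lra.
Qed.

End SmoothStep.

Section GevreyStep.
Context {R : realType}.

Lemma is_derive_dilate (f : R -> R) (f' a t : R) :
  is_derive (a * t) 1 f f' -> is_derive t 1 (fun s => f (a * s)) (a * f').
Proof.
move=> df; have dsc : is_derive t 1 (fun s : R => a * s) a.
  have := @is_deriveZ R R R id a t 1 1 (is_derive_id _ _).
  by rewrite [a *: 1]mulr1.
have dg : differentiable f ((fun s : R => a * s) t).
  by apply/derivable1_diffP; case: df.
have := is_derive_comp_diff dsc dg.
have -> : 'D_a f (a * t) = 'D_(a *: 1) f (a * t) by rewrite [a *: 1]mulr1.
by rewrite deriveZ_dir//; have [_ ->] := df.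
Qed.

Lemma is_derive_locally_cst (f : R -> R) (f' c t : R) :
  (\forall s \near t, f s = c) -> is_derive t 1 f f' -> f' = 0.
Proof.
move=> fc df; have [_ <-] := df; rewrite (@near_eq_derive _ _ _ _ (cst c))//.
by rewrite derive_cst.
Qed.

Lemma gevrey_step_unit : exists e : nat -> R -> R,
  [/\ forall k (t : R), is_derive t 1 (e k) (e k.+1 t),
      forall k t, t <= 0 -> e k t = 0,
      forall t, 3 <= t -> e 0%N t = 1 /\ forall k, e k.+1 t = 0,
      forall t, 0 <= e 0%N t <= 1 &
      forall k t, `|e k t| <= \prod_(j < k) (2 / width j)].
Proof.
have [Y HY] := @smoothing_limit_ex R.
have approx e : 0 < e -> exists n, forall k t, `|smoothing n k t - Y k t| <= e.
  move=> e0; have [n Hn] := tail_small e0; exists n => k t.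
  by apply: le_trans (HY k n t) _; apply: Hn; exact: leq_addl.
have cY k : continuous (Y k).
  apply: continuous_uniform_limit => e e0; have [n Hn] := approx e e0.
  by exists (smoothing n k) => [|s]; [exact: smoothing_continuous|exact: Hn].
have Yeq k t c : (forall n, smoothing n k t = c) -> Y k t = c.
  move=> H; apply/eqP; rewrite -subr_eq0 -normr_le0; apply/ler_addgt0Pr => e e0.
  have [n Hn] := approx e e0; rewrite add0r.
  by have := Hn k t; rewrite H distrC.
have Y01 k t : 0 <= Y k t <= 1.
  apply/andP; split; apply/ler_addgt0Pr => e e0; have [n Hn] := approx e e0;
  have := Hn k t; have /andP[] := smoothing_itv n k t; rewrite ler_norml => ? ? /andP[? ?]; lra.
have Y0 k t : t <= 0 -> Y k t = 0.
  by move=> t0; apply: Yeq => n; exact: smoothing_le0.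
have Y1 k t : 2 <= t -> Y k t = 1.
  move=> t2; apply: Yeq => n; apply: smoothing_ge.
  by have := tail_gt0 (k + n) (R := R); have := tail_le1 k (R := R); lra.
have YA k t : Y k t = average (width k) (Y k.+1) t.
  apply/eqP; rewrite -subr_eq0 -normr_le0; apply/ler_addgt0Pr => e e0; rewrite add0r.
  have e2 : 0 < e / 2 by rewrite divr_gt0.
  have [n Hn] := tail_small e2.
  have h1 : `|smoothing n.+1 k t - Y k t| <= e / 2.
    by apply: le_trans (HY k n.+1 t) _; apply: Hn; rewrite addnS ltnW// ltnS leq_addl.
  have [c _ E] := average_diff t (width_gt0 k) (@smoothing_continuous R n k.+1) (cY k.+1).
  have h2 : `|smoothing n k.+1 c - Y k.+1 c| <= e / 2.
    by apply: le_trans (HY k.+1 n c) _; apply: Hn; exact: leq_addl.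
  rewrite -E -[average _ _ _]/(smoothing n.+1 k t) in h2.
  move: h1 h2; rewrite !ler_norml => /andP[? ?] /andP[? ?]; apply/andP; split; lra.
have dY k (t : R) : is_derive t 1 (Y k) (finite_diff (width k) (Y k.+1) t).
  have -> : Y k = average (width k) (Y k.+1) by exact/funext.
  exact: is_derive_average.
pose e k := iter_diff k (Y k).
have de k (t : R) : is_derive t 1 (e k) (e k.+1 t).
  exact: (@iter_diff_derive R k (Y k) (finite_diff (width k) (Y k.+1)) (dY k)).
(* The inequality is strict so that [e k] is constant near t and its derivative vanishes; this is
   why the statement uses a threshold larger than 2. *)
have e2 k t : 2 < t -> (if k is 0%N then e k t = 1 else e k t = 0).
  elim: k t => [|k IH] t t2; first by apply: Y1; exact: ltW.
  apply: is_derive_locally_cst (de k t).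
  have n2 : \forall s \near t, 2 < s by exact: lt_nbhsr.
  by instantiate (1 := if k is 0%N then 1 else 0); apply: filterS n2 => s /IH; case: (k).
exists e; split=> //.
- by move=> k t t0; apply: iter_diff_le0 => // s; exact: Y0.
- move=> t t3; have t2 : 2 < t by lra.
  by split=> [|k]; [exact: e2 0%N t t2|exact: e2 k.+1 t t2].
- by move=> t; exact: Y01.
- move=> k t; rewrite -[X in _ <= X]mul1r; apply: iter_diff_bound => s.
  by have /andP[a b] := Y01 k s; rewrite ger0_norm.
Qed.

(* A smooth step of Gevrey order 3/2, hence below the order 2 at which the heat
   equation series with flat output d diverges. *)
Lemma gevrey_step (T : R) : 0 < T -> exists d : nat -> R -> R,
  [/\ forall k (t : R), is_derive t 1 (d k) (d k.+1 t),
      forall k t, t <= 0 -> d k t = 0,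
      forall t, T <= t -> d 0%N t = 1 /\ forall k, d k.+1 t = 0,
      forall t, 0 <= d 0%N t <= 1 &
      forall r, 0 <= r -> exists C, forall k t, `|d k t| * r ^+ k / (k.*2)`!%:R <= C].
Proof.
move=> T0; have [e [de e0 e1 e01 eb]] := gevrey_step_unit.
pose a := 3 / T; have a0 : 0 < a by rewrite divr_gt0.
exists (fun k t => a ^+ k * e k (a * t)); split.
- move=> k t; rewrite exprSr -mulrA.
  apply: (@is_deriveZ R R R (fun t => e k (a * t)) (a ^+ k) t 1 (a * e k.+1 (a * t))).
  exact: is_derive_dilate.
- by move=> k t t0; rewrite e0 ?mulr0// pmulr_rle0.
- move=> t tT; have [|H1 H2] := e1 (a * t).
    by rewrite /a mulrAC ler_pdivlMr// ler_pM2l.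
  by split=> [|k]; rewrite ?expr0 ?mul1r// H2 mulr0.
- by move=> t; rewrite expr0 mul1r.
- move=> r r0; have [|C HC] := @prod_width_growth R (a * r); first by rewrite mulr_ge0// ltW.
  exists C => k t; apply: le_trans (HC k).
  have h1 : `|a ^+ k * e k (a * t)| <= a ^+ k * \prod_(j < k) (2 / width j).
    by rewrite normrM (ger0_norm (exprn_ge0 _ (ltW a0))) (ler_wpM2l (exprn_ge0 _ (ltW a0)) (eb _ _)).
  have -> : \prod_(j < k) (2 / width j) * (a * r) ^+ k =
      a ^+ k * \prod_(j < k) (2 / width j) * r ^+ k.
    by rewrite exprMn; ring.
  by rewrite ler_wpM2r ?invr_ge0//; apply: ler_wpM2r; [exact: exprn_ge0|exact: h1].
Qed.

End GevreyStep.

(** * Scalar solutions of the heat equation *)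

(** Stated on all of R x R: trajectories will be stationary before the initial and after the final
    time, so no one-sided derivatives occur. *)
Record C12 (R : realType) (V : normedModType R) (u ut ux uxx : R -> R -> V) : Prop := {
  C12_t : forall t x : R, is_derive t 1 (fun s => u s x) (ut t x);
  C12_x : forall t x : R, is_derive x 1 (u t) (ux t x);
  C12_xx : forall t x : R, is_derive x 1 (ux t) (uxx t x);
  C12_cont : continuous (fun z : R * R => u z.1 z.2);
  C12_cont_t : continuous (fun z : R * R => ut z.1 z.2);
  C12_cont_x : continuous (fun z : R * R => ux z.1 z.2);
  C12_cont_xx : continuous (fun z : R * R => uxx z.1 z.2) }.

Section HeatSeries.
Context {R : realType}.

Lemma limn_geometric (u : nat -> R) (C : R) :
  (forall n, `|u n.+1 - u n| <= C / 2 ^+ n) ->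
  forall n, `|u n - limn u| <= 2 * C / 2 ^+ n.
Proof.
move=> H; have [l Hl] := geometric_limit H.
suff -> : limn u = l by [].
apply/cvg_lim => //; apply/cvgrPdist_le => e e0.
have [k Hk] := half_pow_small (2 * C) e0.
exists k => // n /= kn; rewrite distrC; apply: le_trans (Hl n) _.
have C0 : 0 <= C by have := H 0%N; rewrite expr0 divr1; apply: le_trans.
apply: le_trans Hk; rewrite ler_wpM2l ?mulr_ge0// lef_pV2 ?posrE ?exprn_gt0//.
by rewrite ler_eXn2l// ltr1n.
Qed.

Lemma continuous_local_limit (T : topologicalType) (g : T -> R) (x : T) :
  (forall e, 0 < e -> exists2 f : T -> R, {for x, continuous f} &
     \forall y \near x, `|f y - g y| <= e) ->
  {for x, continuous g}.
Proof.
move=> H; apply/cvgrPdist_le => e e0.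
have e3 : 0 < e / 3 by rewrite divr_gt0.
have [f cf fg] := H _ e3; have fgx := nbhs_singleton fg.
have cf' : \forall y \near x, `|f x - f y| <= e / 3 by move/cvgrPdist_le: cf; exact.
apply: filterS2 fg cf' => y.
move: fgx; rewrite !ler_norml.
move=> /andP[? ?] /andP[? ?] /andP[? ?]; apply/andP; split; lra.
Qed.

(** Rather than exchanging limits, compare with a primitive of g: F n - prim g has small derivative
    on the unit interval about x, so f - prim g is constant there. *)
Lemma limit_derive (F F' : nat -> R -> R) (f g : R -> R) (x : R) :
  (forall n (y : R), is_derive y 1 (F n) (F' n y)) -> continuous g ->
  (forall e, 0 < e -> exists n, forall y, `|y - x| <= 1 ->
     `|F n y - f y| <= e /\ `|F' n y - g y| <= e) ->
  is_derive x 1 f (g x).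
Proof.
move=> dF cg H; have dG (y : R) : is_derive y 1 (prim g) (g y) by exact: is_derive_prim.
have E y : `|y - x| <= 1 -> f y = prim g y + (f x - prim g x).
  move=> yx; apply/eqP; rewrite -subr_eq0 -normr_le0; apply/ler_addgt0Pr => e e0; rewrite add0r.
  have e3 : 0 < e / 3 by rewrite divr_gt0.
  have [n Hn] := H _ e3.
  have key a b : a <= b -> b - a <= 1 -> `|a - x| <= 1 -> `|b - x| <= 1 ->
      `|(F n b - prim g b) - (F n a - prim g a)| <= e / 3.
    move=> ab ba ax bx.
    have dD (s : R) : a <= s <= b -> is_derive s 1 (F n - prim g) ((F' n - g) s).
      by move=> _; apply: is_deriveB.
    have := mean_value_scalar_le ab dD; move=> /(_ (e / 3)) D.
    apply: le_trans (D _) _; last by rewrite ger_pMr.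
    move=> s /andP[as_ sb]; have [|_ +] := Hn s; last by [].
    by move: ax bx; rewrite !ler_norml => /andP[? ?] /andP[? ?]; apply/andP; split; lra.
  have xx : `|x - x| <= 1 by rewrite subrr normr0.
  have K : `|(F n y - prim g y) - (F n x - prim g x)| <= e / 3.
    have [xy|/ltW yx'] := leP x y.
      by apply: key => //; move: yx; rewrite ler_norml => /andP[].
    rewrite distrC; apply: key => //; move: yx; rewrite ler_norml => /andP[]; lra.
  have [A _] := Hn y yx; have [B _] := Hn x xx.
  move: A B K; rewrite !ler_norml => /andP[? ?] /andP[? ?] /andP[? ?]; apply/andP; split; lra.
apply: (@near_eq_is_derive _ _ _ (prim g + cst (f x - prim g x))).
  apply/nbhs_ballP; exists 1 => //= y; rewrite -ball_normE/= distrC => /ltW yx.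
  by rewrite [RHS]E.
by rewrite -[g x]addr0; apply: is_deriveD.
Qed.

Definition heat_partial (dd : nat -> R -> R) (n : nat) (t x : R) : R :=
  \sum_(j < n) dd j t * x ^+ j / j`!%:R.

Definition heat_series (dd : nat -> R -> R) (t x : R) : R :=
  limn (fun n => heat_partial dd n t x).

(** Differentiating the series in x shifts the coefficients by one; the first clause says that
    differentiating in t shifts them by two, which is the heat equation. The second clause gives
    convergence for every x, uniformly in t. *)
Definition heat_coeffs (dd : nat -> R -> R) :=
  (forall j (t : R), is_derive t 1 (dd j) (dd j.+2 t)) /\
  forall r, 0 <= r -> exists C, forall j t, `|dd j t| * r ^+ j / j`!%:R <= C.

Definition shift_coeffs (dd : nat -> R -> R) : nat -> R -> R := fun j => dd j.+1.

Lemma shift_heat_coeffs dd : heat_coeffs dd -> heat_coeffs (shift_coeffs dd).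
Proof.
move=> [d1 d2]; split=> [j t|r r0]; first exact: d1.
(* The powers of 2 absorb the factor j + 1 between the factorials, and r + 1 >= 1 absorbs the
   additional power. *)
have [|C HC] := d2 (2 * (r + 1)); first by rewrite mulr_ge0// addr_ge0.
exists C => j t; apply: le_trans (HC j.+1 t); rewrite /shift_coeffs.
have F0 : 0 < j`!%:R :> R by rewrite ltr0n fact_gt0.
have J0 : 0 < j.+1%:R :> R by [].
rewrite factS natrM -!mulrA ler_wpM2l// invfM [X in _ <= X]mulrA ler_pM2r ?invr_gt0//.
rewrite ler_pdivlMr// exprMn.
have h1 : r ^+ j <= (r + 1) ^+ j.+1.
  apply: le_trans (_ : _ <= (r + 1) ^+ j) _; first by rewrite lerXn2r ?nnegrE ?addr_ge0// lerDl.
  by rewrite ler_weXn2l// lerDr.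
have h2 : j.+1%:R <= 2 ^+ j.+1 :> R by rewrite -natrX ler_nat ltnW// ltn_expl.
by rewrite [X in _ <= X]mulrC ler_pM// exprn_ge0.
Qed.

Section Estimates.
Variables (dd : nat -> R -> R).
Hypothesis hc : heat_coeffs dd.

Lemma heat_partial_limit r : 0 <= r -> exists C, forall n t x, `|x| <= r ->
  `|heat_partial dd n t x - heat_series dd t x| <= C / 2 ^+ n.
Proof.
move=> r0; have [|C HC] := hc.2 (2 * r); first by rewrite mulr_ge0.
exists (2 * C) => n t x xr; apply: limn_geometric => k.
rewrite /heat_partial big_ord_recr/= addrAC subrr add0r.
rewrite !normrM normfV normrX (@ger0_norm _ k`!%:R)// ler_pdivlMr ?exprn_gt0//.
apply: le_trans (HC k t); rewrite mulrAC ler_wpM2r ?invr_ge0// exprMn -mulrA ler_wpM2l//.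
by rewrite mulrC ler_wpM2l ?exprn_ge0// lerXn2r ?nnegrE.
Qed.

Lemma heat_partial_t n (t x : R) :
  is_derive t 1 (fun s => heat_partial dd n s x) (heat_partial (shift_coeffs (shift_coeffs dd)) n t x).
Proof.
have -> : (fun s => heat_partial dd n s x) = \sum_(j < n) ((x ^+ j / j`!%:R) \*: dd j).
  apply/funext => s; rewrite fct_sumE /heat_partial; apply: eq_bigr => j _.
  by rewrite -mulrA mulrC.
have -> : heat_partial (shift_coeffs (shift_coeffs dd)) n t x =
    \sum_(j < n) ((x ^+ j / j`!%:R) *: dd j.+2 t).
  apply: eq_bigr => j _; by rewrite -mulrA mulrC.
by apply: is_derive_sum => j; apply: is_deriveZ; exact: hc.1.
Qed.

Lemma heat_partial_x n (t x : R) :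
  is_derive x 1 (heat_partial dd n.+1 t) (heat_partial (shift_coeffs dd) n t x).
Proof.
elim: n => [|n IH].
  have -> : heat_partial dd 1 t = cst (dd 0%N t).
    by apply/funext => y; rewrite /heat_partial big_ord1 expr0 mulr1 fact0 divr1.
  by rewrite /heat_partial big_ord0; exact: is_derive_cst.
have -> : heat_partial dd n.+2 t =
    heat_partial dd n.+1 t + ((dd n.+1 t / n.+1`!%:R) \*: (fun y => y ^+ n.+1)).
  apply/funext => y; rewrite /heat_partial big_ord_recr/=; congr (_ + _).
  by rewrite mulrAC.
have -> : heat_partial (shift_coeffs dd) n.+1 t x =
    heat_partial (shift_coeffs dd) n t x + (dd n.+1 t / n.+1`!%:R) *: (n.+1%:R * x ^+ n).
  rewrite /heat_partial big_ord_recr/=; congr (_ + _).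
  rewrite /shift_coeffs factS natrM; have F0 : n`!%:R != 0 :> R by rewrite pnatr_eq0 -lt0n fact_gt0.
  have J0 : n.+1%:R != 0 :> R by rewrite pnatr_eq0.
  transitivity (dd n.+1 t / (n.+1%:R * n`!%:R) * (n.+1%:R * x ^+ n)); last by [].
  move: (n.+1%:R) (n`!%:R) (x ^+ n) J0 F0 => a b c a0 b0.
  by field; rewrite a0 b0.
apply: is_deriveD; apply: is_deriveZ.
apply: DeriveDef; first exact: exprn_derivable.
by rewrite exp_derive [_ *: 1]mulr1.
Qed.

Lemma heat_partial_continuous n :
  continuous (fun z : R * R => heat_partial dd n z.1 z.2).
Proof.
elim: n => [|n IH] z.
  rewrite (_ : (fun z : R * R => _) = cst 0); first exact: cst_continuous.
  by apply/funext => y; rewrite /heat_partial big_ord0.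
rewrite (_ : (fun z : R * R => _) = (fun z => heat_partial dd n z.1 z.2 +
   dd n z.1 * z.2 ^+ n / n`!%:R)); last first.
  by apply/funext => y; rewrite /heat_partial big_ord_recr.
apply: cvgD; first exact: IH.
apply: cvgM; last exact: cvg_cst.
apply: cvgM.
  apply: (@cvg_comp _ _ _ fst (dd n)); first exact: cvg_fst.
  exact: is_derive_scalar_continuous (hc.1 n z.1).
apply: (@cvg_comp _ _ _ snd (fun y : R => y ^+ n)); first exact: cvg_snd.
exact: exprn_continuous.
Qed.

Lemma heat_series_continuous : continuous (fun z : R * R => heat_series dd z.1 z.2).
Proof.
move=> z; apply: continuous_local_limit => e e0.
have [|C HC] := @heat_partial_limit (`|z.2| + 1); first by rewrite addr_ge0.
have [n Hn] := half_pow_small C e0.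
exists (fun z : R * R => heat_partial dd n z.1 z.2); first exact: heat_partial_continuous.
have : \forall y \near z, `|y.2| < `|z.2| + 1.
  have cz : {for z, continuous (fun y : R * R => `|y.2|)}.
    by apply: cvg_norm; exact: cvg_snd.
  by apply: (cvgr_lt _ cz); rewrite ltrDl.
by apply: filterS => y /ltW /HC H; exact: le_trans (H _ _) Hn.
Qed.

End Estimates.

Lemma pair_left_continuous (t : R) : continuous (fun y : R => (t, y)).
Proof.
by move=> y; apply: (@cvg_pair _ _ _ _ (nbhs t) (nbhs y)); [exact: cvg_cst|exact: cvg_id].
Qed.

Lemma pair_right_continuous (x : R) : continuous (fun y : R => (y, x)).
Proof.
by move=> y; apply: (@cvg_pair _ _ _ _ (nbhs y) (nbhs x)); [exact: cvg_id|exact: cvg_cst].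
Qed.

Lemma heat_series_x dd (t x : R) : heat_coeffs dd ->
  is_derive x 1 (heat_series dd t) (heat_series (shift_coeffs dd) t x).
Proof.
move=> hc; have hc' := shift_heat_coeffs hc.
apply: (@limit_derive (fun n => heat_partial dd n.+1 t) (fun n => heat_partial (shift_coeffs dd) n t)).
- by move=> n y; exact: heat_partial_x.
- move=> y; apply: (@continuous_comp _ _ _ (fun y : R => (t, y)) (fun z => heat_series (shift_coeffs dd) z.1 z.2)).
    exact: pair_left_continuous.
  exact: heat_series_continuous.
- move=> e e0; have r0 : 0 <= `|x| + 1 by rewrite addr_ge0.
  have [C1 H1] := heat_partial_limit hc r0; have [C2 H2] := heat_partial_limit hc' r0.
  have [n Hn] := half_pow_small (`|C1| + `|C2|) e0; exists n => y yx.
  have yr : `|y| <= `|x| + 1.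
    by rewrite -(subrK x y) addrC; apply: le_trans (ler_normD _ _) _; rewrite lerD2l.
  split; [apply: le_trans (H1 _ _ _ yr) _|apply: le_trans (H2 _ _ _ yr) _]; apply: le_trans Hn.
    apply: le_trans (_ : _ <= `|C1| / 2 ^+ n.+1) _.
      by rewrite ler_wpM2r ?invr_ge0 ?exprn_ge0// ler_norm.
    rewrite ler_pM// ?invr_ge0 ?exprn_ge0//; first by rewrite lerDl.
    by rewrite lef_pV2 ?posrE ?exprn_gt0// ler_eXn2l// ltr1n.
  by rewrite ler_wpM2r ?invr_ge0 ?exprn_ge0//; apply: le_trans (ler_norm _) _; rewrite lerDr.
Qed.

Lemma heat_series_t dd (t x : R) : heat_coeffs dd ->
  is_derive t 1 (fun s => heat_series dd s x) (heat_series (shift_coeffs (shift_coeffs dd)) t x).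
Proof.
move=> hc; have hc' := shift_heat_coeffs (shift_heat_coeffs hc).
apply: (@limit_derive (fun n s => heat_partial dd n s x)
  (fun n s => heat_partial (shift_coeffs (shift_coeffs dd)) n s x) _
  (fun s => heat_series (shift_coeffs (shift_coeffs dd)) s x)).
- by move=> n y; exact: heat_partial_t.
- move=> y; apply: (@continuous_comp _ _ _ (fun y : R => (y, x)) (fun z => heat_series (shift_coeffs (shift_coeffs dd)) z.1 z.2)).
    exact: pair_right_continuous.
  exact: heat_series_continuous.
- move=> e e0; have r0 : 0 <= `|x| by [].
  have [C1 H1] := heat_partial_limit hc r0; have [C2 H2] := heat_partial_limit hc' r0.
  have [n Hn] := half_pow_small (`|C1| + `|C2|) e0; exists n => y yx.
  split; [apply: le_trans (H1 _ _ _ (lexx _)) _|apply: le_trans (H2 _ _ _ (lexx _)) _]; apply: le_trans Hn;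
  rewrite ler_wpM2r ?invr_ge0 ?exprn_ge0//; apply: le_trans (ler_norm _) _; rewrite ?lerDr ?lerDl//.
Qed.

Lemma heat_series_C12 dd : heat_coeffs dd ->
  C12 (heat_series dd) (heat_series (shift_coeffs (shift_coeffs dd)))
    (heat_series (shift_coeffs dd)) (heat_series (shift_coeffs (shift_coeffs dd))).
Proof.
move=> hc; have hc1 := shift_heat_coeffs hc; have hc2 := shift_heat_coeffs hc1.
split.
- by move=> t x; exact: heat_series_t.
- by move=> t x; exact: heat_series_x.
- by move=> t x; exact: heat_series_x.
- exact: heat_series_continuous.
- exact: heat_series_continuous.
- exact: heat_series_continuous.
- exact: heat_series_continuous.
Qed.

Lemma heat_series_eventually dd t x N : (forall j, (N <= j)%N -> dd j t = 0) ->
  heat_series dd t x = heat_partial dd N t x.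
Proof.
move=> H; apply/cvg_lim => //; apply: cvg_near_cst; exists N => // n /= Nn.
rewrite /heat_partial -(subnKC Nn) big_split_ord/= [X in _ + X]big1 ?addr0// => i _.
by rewrite H ?leq_addr// !mul0r.
Qed.

(** The even series of terms d^(k)(t) x^(2k) / (2k)!, whose flat output is the value at x = 0. Once
    d equals 1 with vanishing derivatives, only the constant term survives. *)
Lemma heat_control_const (T : R) : 0 < T -> exists phi phit phix : R -> R -> R,
  [/\ C12 phi phit phix phit, forall t x, t <= 0 -> phi t x = 0 &
      forall t x, T <= t -> phi t x = 1].
Proof.
move=> T0; have [d [dd d0 d1 _ db]] := gevrey_step T0.
pose c j := if odd j then cst 0 else d j./2.
have hc : heat_coeffs c.
  split=> [j t|r r0].
    by rewrite /c /= negbK; case: (odd j) => //; exact: is_derive_cst.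
  have [|C HC] := db (r ^+ 2); first by rewrite exprn_ge0.
  exists (Num.max C 0) => j t; rewrite /c; case: ifPn => [_|ej].
    by rewrite normr0 !mul0r le_max lexx orbT.
  rewrite le_max; apply/orP; left; have := HC j./2 t.
  by rewrite -exprM -[(2 * _)%N]/(2 * _)%N mul2n even_halfK.
exists (heat_series c), (heat_series (shift_coeffs (shift_coeffs c))), (heat_series (shift_coeffs c)).
split; first exact: heat_series_C12.
- move=> t x t0; rewrite (@heat_series_eventually _ _ _ 0%N) /heat_partial ?big_ord0//.
  by move=> j _; rewrite /c; case: ifP => // _; exact: d0.
- move=> t x tT; have [H0 H1] := d1 t tT.
  rewrite (@heat_series_eventually _ _ _ 1%N) /heat_partial.
    by rewrite big_ord1 /c /= H0 expr0 fact0 divr1 mulr1.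
  by case=> [//|[//|j]] _; rewrite /c; case: ifP => //= _; exact: H1.
Qed.

(** The odd series of terms d^(k)(t) x^(2k+1) / (2k+1)!, whose flat output is the slope at x = 0;
    its surviving term is x itself. *)
Lemma heat_control_id (T : R) : 0 < T -> exists phi phit phix : R -> R -> R,
  [/\ C12 phi phit phix phit, forall t x, t <= 0 -> phi t x = 0 &
      forall t x, T <= t -> phi t x = x].
Proof.
move=> T0; have [d [dd d0 d1 _ db]] := gevrey_step T0.
pose c j := if odd j then d j./2 else cst 0.
have hc : heat_coeffs c.
  split=> [j t|r r0].
    by rewrite /c /= negbK; case: (odd j) => //; exact: is_derive_cst.
  have [|C HC] := db (r ^+ 2); first by rewrite exprn_ge0.
  exists (Num.max (r * C) 0) => j t; rewrite /c; case: ifPn => [oj|_]; last first.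
    by rewrite normr0 !mul0r le_max lexx orbT.
  rewrite le_max; apply/orP; left.
  have {2 3}-> : j = (j./2).*2.+1 by rewrite -[LHS]odd_double_half oj.
  set k := j./2; rewrite exprS factS natrM invfM.
  apply: le_trans (_ : _ <= r * (`|d k t| * (r ^+ 2) ^+ k / (k.*2)`!%:R)) _; last by rewrite ler_wpM2l.
  rewrite -exprM mul2n.
  have -> : `|d k t| * (r * r ^+ k.*2) * ((k.*2).+1%:R^-1 / (k.*2)`!%:R) =
    r * (`|d k t| * r ^+ k.*2 / (k.*2)`!%:R) * (k.*2).+1%:R^-1 by ring.
  by rewrite ler_piMr ?mulr_ge0 ?exprn_ge0 ?invr_ge0// invf_le1 ?ler1n ?ltr0n.
exists (heat_series c), (heat_series (shift_coeffs (shift_coeffs c))), (heat_series (shift_coeffs c)).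
split; first exact: heat_series_C12.
- move=> t x t0; rewrite (@heat_series_eventually _ _ _ 0%N) /heat_partial ?big_ord0//.
  by move=> j _; rewrite /c; case: ifP => // _; exact: d0.
- move=> t x tT; have [H0 H1] := d1 t tT.
  rewrite (@heat_series_eventually _ _ _ 2%N) /heat_partial.
    by rewrite big_ord_recr big_ord1 /c /= H0 !mul0r add0r expr1 divr1 mul1r.
  by case=> [//|[//|j]] _; rewrite /c; case: ifP => //= _; exact: H1.
Qed.

End HeatSeries.

(** * Geodesics *)

Section VectorPrimitive.
Context {R : realType} (m : nat).
Implicit Types w : R -> 'rV[R]_m.

Definition coord_continuous_fun w := forall i, continuous (fun t => w t 0 i).

Definition primv w (s : R) : 'rV[R]_m := \row_i prim (fun t => w t 0 i) s.

Lemma primv0 w : coord_continuous_fun w -> primv w 0 = 0.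
Proof. by move=> cw; apply/rowP => i; rewrite !mxE prim0. Qed.

Lemma is_derive_primv w (s : R) : coord_continuous_fun w -> is_derive s 1 (primv w) (w s).
Proof.
move=> cw; apply: is_derive_components => i.
have -> : (fun t => primv w t 0 i) = prim (fun t => w t 0 i) by apply/funext => t; rewrite mxE.
exact: is_derive_prim.
Qed.

Lemma is_derive_coord_continuous w w' :
  (forall s : R, is_derive s 1 w (w' s)) -> coord_continuous_fun w.
Proof.
by move=> dw i s; apply: is_derive_scalar_continuous; exact: is_derive_component (dw s).
Qed.

Lemma coord_continuousP w : coord_continuous_fun w <-> continuous w.
Proof.
split=> cw.
  move=> s; apply/cvgrPdist_le => e e0.
  have : \forall t \near s, forall i, `|w s 0 i - w t 0 i| <= e.
    by apply: near_forall => i; move/cvgrPdist_le: (cw i s); exact.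
  by apply: filterS => t H; apply: row_norm_le => [|i]; [exact: ltW|rewrite !mxE; exact: H].
move=> i s; apply: (@continuous_comp _ _ _ w (fun v : 'rV[R]_m => v 0 i)); first exact: cw.
exact: coord_continuous.
Qed.

Lemma vector_increment_le (f g : R -> 'rV[R]_m) f' g' (d : R) :
  (forall s : R, is_derive s 1 f (f' s)) -> (forall s : R, is_derive s 1 g (g' s)) ->
  f 0 = g 0 -> 0 <= d -> (forall s, `|s| <= 1 -> `|f' s - g' s| <= d) ->
  forall s, `|s| <= 1 -> `|f s - g s| <= d.
Proof.
move=> df dg fg0 d0 H s s1.
have dD (t : R) : is_derive t 1 (f - g) (f' t - g' t) by exact: is_deriveB.
have key a b : a <= b -> `|a| <= 1 -> `|b| <= 1 -> b - a <= 1 -> `|(f - g) b - (f - g) a| <= d.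
  move=> ab a1 b1 ba.
  have := @mean_value_le R m (f - g) (fun t => f' t - g' t) a b d ab (fun t _ => dD t).
  move=> M; apply: le_trans (M _) _; last by rewrite ler_piMr.
  move=> t /andP[at_ tb]; apply: H; move: a1 b1; rewrite !ler_norml => /andP[? ?] /andP[? ?].
  by apply/andP; split; lra.
have e0 : (f - g) 0 = 0 by rewrite !fctE fg0 subrr.
have n0 : `|0 : R| <= 1 by rewrite normr0.
have E : `|(f - g) s - (f - g) 0| <= d.
  move: (s1); rewrite ler_norml => /andP[sa sb].
  have [s0|/ltW s0] := leP 0 s; first by apply: key => //; lra.
  by rewrite distrC; apply: key => //; lra.
by rewrite e0 subr0 in E.
Qed.

Lemma affine_of_derive2_eq0 (f f' : R -> 'rV[R]_m) :
  (forall s : R, `|s| <= 1 -> is_derive s 1 f (f' s)) ->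
  (forall s : R, `|s| <= 1 -> is_derive s 1 f' (0 : 'rV[R]_m)) ->
  forall s, `|s| <= 1 -> f s = f 0 + s *: f' 0.
Proof.
move=> df df'.
have seg (s t : R) : `|s| <= 1 -> Num.min 0 s <= t <= Num.max 0 s -> `|t| <= 1.
  rewrite !ler_norml => /andP[? ?] /andP[]; rewrite ge_min le_max.
  by move=> /orP[?|?] /orP[?|?]; apply/andP; split; lra.
have E s : `|s| <= 1 -> f' s = f' 0.
  move=> s1; apply/rowP => i.
  have H1 (t : R) : Num.min 0 s <= t <= Num.max 0 s ->
      is_derive t 1 (fun t => f' t 0 i) ((0 : 'rV[R]_m) 0 i).
    by move=> ts; apply: is_derive_component; apply: df'; exact: seg ts.
  have H2 (t : R) : Num.min 0 s <= t <= Num.max 0 s ->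
      is_derive t 1 (cst (0 : R)) ((0 : 'rV[R]_m) 0 i).
    by move=> _; rewrite mxE; exact: is_derive_cst.
  have := derive_eq_diff H1 H2; rewrite /cst subrr => /eqP; rewrite subr_eq0 => /eqP; exact.
move=> s s1; apply/rowP => i; rewrite !mxE.
have H1 (t : R) : Num.min 0 s <= t <= Num.max 0 s ->
    is_derive t 1 (fun t => f t 0 i) (f' 0 0 i).
  move=> ts; rewrite -(E t (seg _ _ s1 ts)).
  by apply: is_derive_component; apply: df; exact: seg ts.
have H2 (t : R) : Num.min 0 s <= t <= Num.max 0 s ->
    is_derive t 1 (fun t : R => (0 + t *: f' 0) 0 i) (f' 0 0 i).
  by move=> _; apply: is_derive_component; exact: is_derive_line.
have := derive_eq_diff H1 H2; rewrite !mxE !add0r mul0r subr0 => <-; ring.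
Qed.

End VectorPrimitive.

Section GeodesicFixedPoint.
Context {R : realType} (m : nat) (Q : 'rV[R]_m -> 'rV[R]_m -> 'rV[R]_m -> 'rV[R]_m)
  (p0 : 'rV[R]_m) (r : R).
Hypothesis r0 : 0 < r.
Hypothesis Q0 : Q p0 0 0 = 0.
Hypothesis QL : forall (x v w x' v' w' : 'rV[R]_m) (d : R),
  `|p0 - x| < r -> `|v| < r -> `|w| < r -> `|p0 - x'| < r -> `|v'| < r -> `|w'| < r ->
  `|x - x'| <= d -> `|v - v'| <= d -> `|w - w'| <= d ->
  `|Q x v w - Q x' v' w'| <= d / 8.

(** Freezing the parameter outside [-1, 1] turns the equation into one for bounded continuous
    functions on all of R, with uniform estimates. *)
Let clamp (s : R) : R := Num.max (- 1) (Num.min s 1).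

Let clamp_norm s : `|clamp s| <= 1.
Proof.
rewrite /clamp ler_norml; apply/andP; split; first by rewrite le_max lexx.
by rewrite ge_max ge_min lexx orbT andbT; lra.
Qed.

Let clamp_id s : `|s| <= 1 -> clamp s = s.
Proof. by rewrite ler_norml /clamp => /andP[a b]; rewrite min_l// max_r. Qed.

Let clamp_cont : continuous clamp.
Proof.
have lip s t : s <= t -> 0 <= clamp t - clamp s <= t - s.
  by move=> st; rewrite /clamp /Num.max /Num.min; do ![case: ifPn]; rewrite -?leNgt => *; apply/andP; split; lra.
move=> t; apply/cvgrPdist_le => e e0; apply/nbhs_ballP; exists e => // s /= /ltW.
have [st|/ltW ts] := leP s t.
  have /andP[a b] := lip _ _ st.
  by rewrite !ger0_norm ?subr_ge0//; [lra|lra].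
have /andP[a b] := lip _ _ ts.
by rewrite distrC [X in _ -> X <= _]distrC !ger0_norm ?subr_ge0//; [lra|lra].
Qed.

(* [kappa = 0] is the initial value problem for sigma'' = Q (sigma, sigma', sigma''),
   [kappa = 2] the boundary value problem with data at 0 and 1/2. *)
Lemma second_order_solution (rho kappa : R) (p a : 'rV[R]_m) :
  0 < rho -> 8 * rho <= r -> 0 <= kappa <= 2 -> `|p0 - p| <= rho -> `|a| <= rho ->
  exists sigma sigma' w : R -> 'rV[R]_m,
    [/\ (forall s : R, is_derive s 1 sigma (sigma' s)),
        (forall s : R, is_derive s 1 sigma' (w s)), coord_continuous_fun w,
        (forall s, `|s| <= 1 -> [/\ `|p0 - sigma s| <= 5 * rho, `|sigma' s| <= 4 * rho &
             w s = Q (sigma s) (sigma' s) (w s)]) &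
        [/\ sigma 0 = p, kappa = 2 -> sigma 2^-1 = p + 2^-1 *: a & kappa = 0 -> sigma' 0 = a]].
Proof.
move=> rho0 rhor /andP[k0 k1] pp0 aa.
pose V (w : R -> 'rV[R]_m) := primv w; pose X (w : R -> 'rV[R]_m) := primv (V w).
(* The unknown is the acceleration w, and [X w] its double primitive. For kappa = 2 the correction
   of the initial velocity cancels [X w] at s = 1/2, leaving p + a / 2 there. *)
pose sg (w : R -> 'rV[R]_m) (s : R) := p + s *: (a - kappa *: X w 2^-1) + X w s.
pose sg' (w : R -> 'rV[R]_m) (s : R) := a - kappa *: X w 2^-1 + V w s.
have cV w : coord_continuous_fun w -> coord_continuous_fun (V w).
  by move=> cw; apply: is_derive_coord_continuous => s; exact: is_derive_primv.
have V_le w w' d s : coord_continuous_fun w -> coord_continuous_fun w' -> 0 <= d ->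
    (forall t, `|w t - w' t| <= d) -> `|s| <= 1 -> `|V w s - V w' s| <= d.
  move=> cw cw' d0 H; apply: (@vector_increment_le _ _ _ _ w w') => //.
  - by move=> t; exact: is_derive_primv.
  - by move=> t; exact: is_derive_primv.
  - by rewrite /V !primv0.
have X_le w w' d s : coord_continuous_fun w -> coord_continuous_fun w' -> 0 <= d ->
    (forall t, `|w t - w' t| <= d) -> `|s| <= 1 -> `|X w s - X w' s| <= d.
  move=> cw cw' d0 H; apply: (@vector_increment_le _ _ _ _ (V w) (V w')) => //.
  - by move=> t; apply: is_derive_primv; exact: cV.
  - by move=> t; apply: is_derive_primv; exact: cV.
  - by rewrite /X !primv0//; exact: cV.
  - by move=> t; exact: V_le.
have c0 : coord_continuous_fun (cst (0 : 'rV[R]_m)) by move=> i; exact: cst_continuous.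
have d0 (s : R) : is_derive s 1 (cst (0 : 'rV[R]_m)) (cst (0 : 'rV[R]_m) s) by exact: is_derive_cst.
have V_b w s : coord_continuous_fun w -> (forall t, `|w t| <= rho) -> `|s| <= 1 -> `|V w s| <= rho.
  move=> cw H s1; rewrite -[V w s]subr0.
  apply: (@vector_increment_le _ _ _ (cst 0) w (cst 0)) => //.
  - by move=> t; exact: is_derive_primv.
  - by rewrite /V primv0.
  - exact: ltW.
  - by move=> t _; rewrite subr0.
have X_b w s : coord_continuous_fun w -> (forall t, `|w t| <= rho) -> `|s| <= 1 -> `|X w s| <= rho.
  move=> cw H s1; rewrite -[X w s]subr0.
  apply: (@vector_increment_le _ _ _ (cst 0) (V w) (cst 0)) => //.
  - by move=> t; apply: is_derive_primv; exact: cV.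
  - by rewrite /X primv0//; exact: cV.
  - exact: ltW.
  - by move=> t t1; rewrite subr0; exact: V_b.
have one1 : `|2^-1 : R| <= 1 by rewrite ger0_norm; lra.
have kb x d : `|x| <= d -> `|kappa *: x : 'rV[R]_m| <= 2 * d.
  by move=> xd; rewrite normrZ (ger0_norm k0); apply: ler_pM.
have sb (s : R) x d : `|s| <= 1 -> `|x| <= d -> `|s *: x : 'rV[R]_m| <= d.
  by move=> s1 xd; rewrite normrZ; apply: le_trans xd; rewrite ler_piMl.
have sg_b w s : coord_continuous_fun w -> (forall t, `|w t| <= rho) -> `|s| <= 1 ->
    `|p0 - sg w s| <= 5 * rho.
  move=> cw H s1; rewrite /sg -addrA opprD addrA; apply: le_trans (ler_normB _ _) _.
  have h1 : `|a - kappa *: X w 2^-1| <= 3 * rho.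
    apply: le_trans (ler_normB _ _) _; have := kb _ _ (X_b w 2^-1 cw H one1); lra.
  have h2 := sb s _ _ s1 h1; have h3 := X_b w s cw H s1.
  have := ler_normD (s *: (a - kappa *: X w 2^-1)) (X w s); lra.
have sg'_b w s : coord_continuous_fun w -> (forall t, `|w t| <= rho) -> `|s| <= 1 ->
    `|sg' w s| <= 4 * rho.
  move=> cw H s1; rewrite /sg'; apply: le_trans (ler_normD _ _) _.
  have h1 : `|a - kappa *: X w 2^-1| <= 3 * rho.
    apply: le_trans (ler_normB _ _) _; have := kb _ _ (X_b w 2^-1 cw H one1); lra.
  by have := V_b w s cw H s1; lra.
have sg_d w w' d s : coord_continuous_fun w -> coord_continuous_fun w' -> 0 <= d ->
    (forall t, `|w t - w' t| <= d) -> `|s| <= 1 -> `|sg w s - sg w' s| <= 3 * d.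
  move=> cw cw' dd H s1.
  have -> : sg w s - sg w' s = - (s *: (kappa *: (X w 2^-1 - X w' 2^-1))) + (X w s - X w' s).
    by rewrite /sg; apply/rowP => i; rewrite !mxE; ring.
  apply: le_trans (ler_normD _ _) _; rewrite normrN.
  have := sb s _ _ s1 (kb _ _ (X_le _ _ _ 2^-1 cw cw' dd H one1)).
  have := X_le _ _ _ s cw cw' dd H s1; lra.
have sg'_d w w' d s : coord_continuous_fun w -> coord_continuous_fun w' -> 0 <= d ->
    (forall t, `|w t - w' t| <= d) -> `|s| <= 1 -> `|sg' w s - sg' w' s| <= 3 * d.
  move=> cw cw' dd H s1.
  have -> : sg' w s - sg' w' s = - (kappa *: (X w 2^-1 - X w' 2^-1)) + (V w s - V w' s).
    by rewrite /sg'; apply/rowP => i; rewrite !mxE; ring.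
  apply: le_trans (ler_normD _ _) _; rewrite normrN.
  have := kb _ _ (X_le _ _ _ 2^-1 cw cw' dd H one1).
  have := V_le _ _ _ s cw cw' dd H s1; lra.
have dsg w (s : R) : coord_continuous_fun w -> is_derive s 1 (sg w) (sg' w s).
  move=> cw; rewrite /sg /sg'; apply: is_deriveD; first exact: is_derive_line.
  by apply: is_derive_primv; exact: cV.
have dsg' w (s : R) : coord_continuous_fun w -> is_derive s 1 (sg' w) (w s).
  move=> cw; rewrite /sg' -[w s]add0r; apply: is_deriveD; exact: is_derive_primv.
have rr : 5 * rho < r by lra.
have rr4 : 4 * rho < r by lra.
pose T (w : R -> 'rV[R]_m) (s : R) := Q (sg w (clamp s)) (sg' w (clamp s)) (w (clamp s)).
have TL w w' d s t : coord_continuous_fun w -> coord_continuous_fun w' ->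
    (forall u, `|w u| <= rho) -> (forall u, `|w' u| <= rho) ->
    `|s| <= 1 -> `|t| <= 1 ->
    `|sg w s - sg w' t| <= d -> `|sg' w s - sg' w' t| <= d -> `|w s - w' t| <= d ->
    `|Q (sg w s) (sg' w s) (w s) - Q (sg w' t) (sg' w' t) (w' t)| <= d / 8.
  move=> cw cw' bw bw' s1 t1 h1 h2 h3; apply: QL h1 h2 h3.
  - by apply: le_lt_trans rr; exact: sg_b.
  - by apply: le_lt_trans rr4; exact: sg'_b.
  - by have := bw s; lra.
  - by apply: le_lt_trans rr; exact: sg_b.
  - by apply: le_lt_trans rr4; exact: sg'_b.
  - by have := bw' t; lra.
have [|||w [cw bw Tw]] := @picard_fixed_point R R m T (@coord_continuous_fun R m) rho (ltW rho0) c0.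
- move=> w v cw H i; apply: continuous_uniform_limit => e e0.
  have [k Hk] := H e e0; exists (fun t => w k t 0 i); first exact: cw.
  move=> s; apply: le_trans (Hk s); have := coord_le_norm (w k s - v s) i.
  by rewrite !mxE.
- move=> w cw bw; split; last first.
    (* Comparison with (p0, 0, 0), where Q vanishes: the image has norm at most 5 rho / 8. *)
    move=> s; rewrite -[T w s]subr0 -Q0.
    have := QL (x := sg w (clamp s)) (v := sg' w (clamp s)) (w := w (clamp s))
      (x' := p0) (v' := 0) (w' := 0) (d := 5 * rho).
    rewrite subrr normr0 !subr0 => H.
    apply: le_trans (H _ _ _ _ _ _ _ _ _) _ => //.
    + by apply: le_lt_trans rr; exact: sg_b.
    + by apply: le_lt_trans rr4; exact: sg'_b.
    + by have := bw (clamp s); lra.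
    + by rewrite distrC; exact: sg_b.
    + by have := sg'_b w (clamp s) cw bw (clamp_norm s); lra.
    + by have := bw (clamp s); lra.
    + lra.
  apply/coord_continuousP => s; apply/cvgrPdist_le => e e0.
  have e1 : 0 < e by [].
  have c1 : \forall t \near s, `|sg w (clamp s) - sg w (clamp t)| <= e.
    have : {for s, continuous (sg w \o clamp)}.
      apply: continuous_comp; first exact: clamp_cont.
      exact: is_derive_continuous (dsg w _ cw).
    by move/cvgrPdist_le; exact.
  have c2 : \forall t \near s, `|sg' w (clamp s) - sg' w (clamp t)| <= e.
    have : {for s, continuous (sg' w \o clamp)}.
      apply: continuous_comp; first exact: clamp_cont.
      exact: is_derive_continuous (dsg' w _ cw).
    by move/cvgrPdist_le; exact.
  have c3 : \forall t \near s, `|w (clamp s) - w (clamp t)| <= e.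
    have : {for s, continuous (w \o clamp)}.
      apply: continuous_comp; first exact: clamp_cont.
      by have /coord_continuousP := cw; exact.
    by move/cvgrPdist_le; exact.
  apply: filterS (filterI (filterI c1 c2) c3) => t [[h1 h2] h3].
  apply: le_trans (TL w w e (clamp s) (clamp t) cw cw bw bw _ _ h1 h2 h3) _ => //.
  lra.
- move=> w w' d cw cw' bw bw' H s.
  have dd : 0 <= d by apply: le_trans (H 0).
  (* Position and velocity depend on w with constant 3, so the iteration has factor 3/8, below the
     required 1/2. *)
  apply: le_trans (_ : _ <= (3 * d) / 8) _; last lra.
  apply: TL => //.
  + exact: sg_d.
  + exact: sg'_d.
  + by have := H (clamp s); lra.
exists (sg w), (sg' w), w; split.
- by move=> s; exact: dsg.
- by move=> s; exact: dsg'.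
- exact: cw.
- move=> s s1; split; [exact: sg_b|exact: sg'_b|].
  by rewrite -{1}Tw /T clamp_id.
- split.
  + by rewrite /sg scale0r addr0 /X primv0 ?addr0//; exact: cV.
  + move=> k2; rewrite /sg k2 scalerBr scalerA mulVf// scale1r addrA.
    by rewrite subrK.
  + by move=> k0'; rewrite /sg' k0' scale0r subr0 /V primv0 ?addr0.
Qed.

End GeodesicFixedPoint.

(** * The geodesic equation as a contraction *)

Section Flat.
Context {R : realType} (V : normedModType R) (U : set V) (z0 : V).
Hypotheses (oU : open U) (Uz : U z0).

Definition flat_at (F : V -> R) := smooth_on U F /\ forall v, 'D_v F z0 = 0.

Lemma flat_add (F G : V -> R) : flat_at F -> flat_at G -> flat_at (F + G).
Proof.
move=> [sF F0] [sG G0]; split; first exact: smooth_on_add.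
move=> v; rewrite deriveD ?F0 ?G0 ?addr0//; apply: diff_derivable;
  [exact: smooth_on_diff sF Uz|exact: smooth_on_diff sG Uz].
Qed.

Lemma flat_mul (F G : V -> R) : smooth_on U F -> smooth_on U G -> F z0 = 0 -> G z0 = 0 -> flat_at (F * G).
Proof.
move=> sF sG F0 G0; split; first exact: smooth_on_mul.
move=> v; rewrite deriveM; [|apply: diff_derivable; exact: smooth_on_diff sF Uz|
  apply: diff_derivable; exact: smooth_on_diff sG Uz].
by rewrite F0 G0 !scale0r addr0.
Qed.

Lemma flat_sum n (F : 'I_n -> V -> R) :
  (forall i, flat_at (F i)) -> flat_at (fun x => \sum_(i < n) F i x).
Proof.
move=> H; split; first by apply: smooth_on_sum => // i _; case: (H i).
move=> v; have -> : (fun x => \sum_(i < n) F i x) = \sum_(i < n) F i.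
  by apply/funext => x; rewrite fct_sumE.
rewrite derive_sum => [|i]; last first.
  by apply: diff_derivable; case: (H i) => sF _; exact: smooth_on_diff sF Uz.
by rewrite big1// => i _; case: (H i).
Qed.

End Flat.

Section GeodesicOperator.
Context {R : realType} (m : nat) (N : set 'rV[R]_m) (p : 'rV[R]_m) (r : R)
  (P : 'M[R]_m) (Pi : 'rV[R]_m -> 'rV[R]_m).
Hypotheses (Np : N p) (H : adapted_retraction N p r P Pi).

Let oB : open (ball p r). Proof. exact: ball_open. Qed.
Let Bp : ball p r p. Proof. by apply: ballxx; case: H. Qed.
Let sPi := ret_smooth H.
Let E x := jacobian Pi x.

Lemma ret_jacobian x v : ball p r x -> 'D_v Pi x = v *m E x.
Proof. by move=> bx; exact: (deriveEjacobian v (ret_diff H bx)). Qed.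

Lemma ret_jacobian_center : E p = P.
Proof. by apply/row_matrixP => i; rewrite rowE -ret_jacobian// (ret_derive_center H) -rowE. Qed.

Lemma ret_jacobian_idem x : ball p r x -> E x *m E x = E x.
Proof.
move=> bx; apply/row_matrixP => i; rewrite !rowE mulmxA -!(ret_jacobian _ bx).
rewrite (@ret_derive_dir _ _ _ _ _ _ _ H _ _ bx) (@ret_derive_proj _ _ _ _ _ _ _ H _ _ bx).
by rewrite -(@ret_derive_dir _ _ _ _ _ _ _ H _ _ bx).
Qed.

Lemma ret_derive2_jacobian x v w : ball p r x -> 'D_w ('D_v Pi) x *m E x = 0.
Proof.
move=> bx; rewrite -(ret_jacobian _ bx) (@ret_derive_dir _ _ _ _ _ _ _ H _ _ bx).
by rewrite (derive2_proj0 H _ _ bx) derive0.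
Qed.

(* [w = w E + D^2 Pi (v, v)] holds for the acceleration w of any curve in N; it is
   normal, that is [w E^T = 0], for a geodesic.  Subtracting [w E^T] makes the
   operator a contraction in w near p, where E is symmetric. *)
Definition geodesic_op (x v w : 'rV[R]_m) : 'rV[R]_m :=
  w *m (E x - (E x)^T) + \sum_i \sum_k (v 0 i * v 0 k) *: 'D_(delta_mx 0 i) ('D_(delta_mx 0 k) Pi) x.

Lemma geodesic_opE x v w : ball p r x ->
  geodesic_op x v w = w *m (E x - (E x)^T) + 'D_v ('D_v Pi) x.
Proof.
move=> bx; congr (_ + _).
rewrite derive_rV_dir; last exact: smooth_on_diff (smooth_on_derive _ sPi) bx.
apply: eq_bigr => i _; rewrite (derive_sum_coord _ _ oB sPi bx) scaler_sumr.
by apply: eq_bigr => k _; rewrite scalerA.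
Qed.

Let zx (z : 'rV[R]_(m + (m + m))) : 'rV[R]_m := lsubmx z.
Let zv (z : 'rV[R]_(m + (m + m))) : 'rV[R]_m := lsubmx (rsubmx z).
Let zw (z : 'rV[R]_(m + (m + m))) : 'rV[R]_m := rsubmx (rsubmx z).

Let smooth_coord n (A : set 'rV[R]_n) i : open A -> smooth_on A (fun z : 'rV[R]_n => z 0 i).
Proof.
move=> oA; apply: smooth_on_linear => //; last exact: coord_continuous.
by move=> a x y; rewrite !mxE.
Qed.

(** As a function of the joint variable (x, v, w), every term is a product of two factors vanishing
    at (p, 0, 0): w with E - E^T, which is zero at p because P is symmetric, or one coordinate of v
    with another. The derivative there is zero, and the Lipschitz constant is small nearby. *)
Lemma geodesic_op_lipschitz : exists2 r', 0 < r' & r' <= r /\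
  forall (x v w x' v' w' : 'rV[R]_m) (d : R),
  `|p - x| < r' -> `|v| < r' -> `|w| < r' -> `|p - x'| < r' -> `|v'| < r' -> `|w'| < r' ->
  `|x - x'| <= d -> `|v - v'| <= d -> `|w - w'| <= d ->
  `|geodesic_op x v w - geodesic_op x' v' w'| <= d / 8.
Proof.
pose n := (m + (m + m))%N.
pose z0 : 'rV[R]_n := row_mx p (row_mx 0 0).
pose U : set 'rV[R]_n := zx @^-1` ball p r.
have szx (A : set 'rV[R]_n) : open A -> smooth_on A zx.
  move=> oA; apply/(smooth_on_components oA) => i.
  have -> : (fun z => zx z 0 i) = (fun z : 'rV[R]_n => z 0 (lshift _ i)).
    by apply/funext => z; rewrite /zx mxE.
  exact: smooth_coord.
have szv (A : set 'rV[R]_n) i : open A -> smooth_on A (fun z => zv z 0 i).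
  move=> oA; have -> : (fun z => zv z 0 i) = (fun z : 'rV[R]_n => z 0 (rshift m (lshift m i))).
    by apply/funext => z; rewrite /zv !mxE.
  exact: smooth_coord.
have szw (A : set 'rV[R]_n) i : open A -> smooth_on A (fun z => zw z 0 i).
  move=> oA; have -> : (fun z => zw z 0 i) = (fun z : 'rV[R]_n => z 0 (rshift m (rshift m i))).
    by apply/funext => z; rewrite /zw !mxE.
  exact: smooth_coord.
have oU : open U.
  apply: open_comp => // z _; apply: (@smooth_on_continuous _ _ _ setT) => //.
  by apply: szx; exact: openT.
have zx0 : zx z0 = p by rewrite /zx row_mxKl.
have zv0 : zv z0 = 0 by rewrite /zv row_mxKr row_mxKl.
have zw0 : zw z0 = 0 by rewrite /zw !row_mxKr.
have Uz : U z0 by rewrite /U /preimage/= zx0.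
pose q z := geodesic_op (zx z) (zv z) (zw z).
have sE i j : smooth_on U (fun z => E (zx z) i j).
  apply: (@smooth_on_comp_scalar _ _ _ _ _ oU oB zx (fun x => E x i j)) => //.
    exact: szx.
  exact: smooth_mx_jacobian.
have fq j : flat_at U z0 (fun z => q z 0 j).
  have -> : (fun z => q z 0 j) =
    (fun z => \sum_i ((fun z => zw z 0 i) * ((fun z => E (zx z) i j) + (cst (- 1) * (fun z => E (zx z) j i)))) z) +
    (fun z => \sum_i (fun z => \sum_k ((fun z => zv z 0 i) * ((fun z => zv z 0 k) *
      (fun z => 'D_(delta_mx 0 i) ('D_(delta_mx 0 k) Pi) (zx z) 0 j))) z) z).
    apply/funext => z; rewrite /q /geodesic_op !fctE [LHS]mxE; congr (_ + _).
      rewrite mxE; apply: eq_bigr => i _; congr (_ * _); rewrite mxE; congr (_ + _).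
      by rewrite mxE [X in - X]mxE; exact/esym/mulN1r.
    rewrite summxE; apply: eq_bigr => i _; rewrite summxE; apply: eq_bigr => k _.
    by rewrite mxE; exact/esym/mulrA.
  apply: flat_add => //.
    apply: flat_sum => // i; apply: flat_mul => //.
    - exact: szw.
    - apply: smooth_on_add => //; apply: smooth_on_mul => //; exact: smooth_on_cst.
    - by rewrite zw0 mxE.
    - by rewrite !fctE zx0 ret_jacobian_center -[in X in _ + _ * X](ret_sym H) mxE mulN1r subrr.
  apply: flat_sum => // i; apply: flat_sum => // k; apply: flat_mul => //.
  - exact: szv.
  - apply: smooth_on_mul => //; first exact: szv.
    apply: (@smooth_on_comp_scalar _ _ _ _ _ oU oB zx (fun x => 'D_(delta_mx 0 i) ('D_(delta_mx 0 k) Pi) x 0 j)) => //.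
      exact: szx.
    by have /(smooth_on_components oB) := smooth_on_derive (delta_mx 0 i) (smooth_on_derive (delta_mx 0 k) sPi); exact.
  - by rewrite zv0 mxE.
  - by rewrite !fctE zv0 mxE mul0r.
have sq : smooth_on U q by apply/(smooth_on_components oU) => j; case: (fq j).
have Dq v : 'D_v q z0 = 0.
  apply/rowP => j; rewrite mxE -derive_component; first by case: (fq j).
  by apply: diff_derivable; exact: smooth_on_diff sq Uz.
pose K : R := (8 * n.+1%:R)^-1.
have K0 : 0 < K by rewrite invr_gt0 mulr_gt0.
have DK i : `|'D_(delta_mx 0 i) q z0| < K by rewrite Dq normr0.
have [r1 r10 [_ [L _]]] := smooth_on_lipschitz_near oU Uz sq K0 DK.
exists (Num.min r r1); first by rewrite lt_min r10 andbT; case: H.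
split; first by rewrite ge_min lexx.
move=> x v w x' v' w' d; rewrite !lt_min.
move=> /andP[_ x1] /andP[_ v1] /andP[_ w1] /andP[_ x1'] /andP[_ v1'] /andP[_ w1'] xd vd wd.
have nrow (a b c : 'rV[R]_m) (e : R) : 0 <= e -> `|a| <= e -> `|b| <= e -> `|c| <= e ->
    `|row_mx a (row_mx b c)| <= e.
  move=> e0 ae be ce; apply: row_norm_le => // i.
  case: (split_ordP i) => j ->; first by rewrite row_mxEl; apply: le_trans (coord_le_norm _ _) ae.
  rewrite row_mxEr; case: (split_ordP j) => k ->.
    by rewrite row_mxEl; apply: le_trans (coord_le_norm _ _) be.
  by rewrite row_mxEr; apply: le_trans (coord_le_norm _ _) ce.
have inball (a b c : 'rV[R]_m) : `|p - a| < r1 -> `|b| < r1 -> `|c| < r1 ->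
    ball z0 r1 (row_mx a (row_mx b c)).
  move=> a1 b1 c1; rewrite -ball_normE/= /z0 opp_row_mx add_row_mx opp_row_mx add_row_mx !sub0r.
  have M0 : 0 <= Num.max (Num.max `|p - a| `|b|) `|c| by rewrite !le_max normr_ge0.
  apply: le_lt_trans (nrow _ _ _ _ M0 _ _ _) _; rewrite ?normrN ?le_max ?lexx ?orbT//.
  by rewrite !gt_max a1 b1 c1.
have := L _ _ (inball _ _ _ x1 v1 w1) (inball _ _ _ x1' v1' w1').
have qE (a b c : 'rV[R]_m) : q (row_mx a (row_mx b c)) = geodesic_op a b c.
  by rewrite /q /zx /zv /zw !row_mxKr !row_mxKl.
rewrite !qE => /le_trans; apply.
rewrite opp_row_mx add_row_mx opp_row_mx add_row_mx.
have d0 : 0 <= d by exact: le_trans xd.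
apply: le_trans (_ : _ <= n%:R * K * d) _.
  by rewrite ler_wpM2l ?mulr_ge0 ?(ltW K0)//; exact: nrow.
rewrite [X in _ <= X]mulrC ler_wpM2r// /K invfM mulrCA ler_piMr ?invr_ge0//.
by rewrite ler_pdivrMr// mul1r ler_nat.
Qed.

End GeodesicOperator.

Record geodesic_on (R : realType) m (N : set 'rV[R]_m) (a b : R)
    (sg sg' sg'' : R -> 'rV[R]_m) : Prop := {
  geo_d1 : forall s : R, is_derive s 1 sg (sg' s);
  geo_d2 : forall s : R, is_derive s 1 sg' (sg'' s);
  geo_cont : coord_continuous_fun sg'';
  geo_in : forall s, a <= s <= b -> N (sg s);
  geo_normal : forall s, a <= s <= b -> forall z, tangent_space N (sg s) z -> dot (sg'' s) z = 0 }.

Section LocalGeodesics.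
Context {R : realType} (m : nat) (N : set 'rV[R]_m) (p0 : 'rV[R]_m) (r : R)
  (P : 'M[R]_m) (Pi : 'rV[R]_m -> 'rV[R]_m).
Hypotheses (Np0 : N p0) (H : adapted_retraction N p0 r P Pi).

Let oB : open (ball p0 r). Proof. exact: ball_open. Qed.
Let Q := geodesic_op Pi.

(* Both [sg] and [Pi \o sg] have second derivative [sg''], so their difference
   is affine in [s] and vanishes identically. *)
Lemma second_order_geodesic (sg sg' sg'' : R -> 'rV[R]_m) :
  (forall s : R, is_derive s 1 sg (sg' s)) -> (forall s : R, is_derive s 1 sg' (sg'' s)) ->
  coord_continuous_fun sg'' ->
  (forall s, `|s| <= 1 -> ball p0 r (sg s) /\ sg'' s = Q (sg s) (sg' s) (sg'' s)) ->
  N (sg 0) -> (tangent_space N (sg 0) (sg' 0) \/ N (sg 2^-1)) ->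
  geodesic_on N (- 1) 1 sg sg' sg''.
Proof.
move=> d1 d2 c2 HQ N0 bc.
have Bs s : `|s| <= 1 -> ball p0 r (sg s) by move=> /HQ[].
have key s : `|s| <= 1 -> sg'' s *m (jacobian Pi (sg s))^T = 0 /\
    sg'' s = 'D_(sg'' s) Pi (sg s) + 'D_(sg' s) ('D_(sg' s) Pi) (sg s).
  move=> s1; have [bs Qs] := HQ s s1.
  have EE := ret_jacobian_idem H bs.
  have DE : 'D_(sg' s) ('D_(sg' s) Pi) (sg s) *m jacobian Pi (sg s) = 0.
    exact: (ret_derive2_jacobian H _ _ bs).
  rewrite /Q (geodesic_opE H _ _ bs) in Qs.
  rewrite (ret_jacobian H _ bs).
  move: (sg'' s) (jacobian Pi (sg s)) ('D_(sg' s) ('D_(sg' s) Pi) (sg s)) Qs EE DE => w M D Qs EE DE.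
  (* Multiply w = w (M - M^T) + D by M on the right: since M M = M and D M = 0, this leaves w M^T M
     = 0, hence |w M^T|^2 = 0. *)
  have wM : w *m M^T = 0.
    apply: dot_eq0; rewrite dotE trmx_mul trmxK.
    have : w *m M = (w *m (M - M^T) + D) *m M by rewrite -Qs.
    rewrite mulmxDl DE addr0 mulmxBr mulmxBl -!mulmxA EE => /eqP.
    rewrite -subr_eq0 opprB addrC subrK => /eqP H0.
    by rewrite [M^T *m _]mulmxA mulmxA H0 mul0mx mxE.
  by split=> //; rewrite {1}Qs mulmxBr wM subr0.
pose e := sg - (Pi \o sg).
pose e' s := sg' s - 'D_(sg' s) Pi (sg s).
have de s : `|s| <= 1 -> is_derive (s : R) 1 e (e' s).
  move=> s1; apply: is_deriveB.
  exact: (is_derive_comp_diff (d1 s) (ret_diff H (Bs s s1))).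
have de' s : `|s| <= 1 -> is_derive (s : R) 1 e' (0 : 'rV[R]_m).
  move=> s1; have [_ K] := key s s1.
  rewrite -(subrr (sg'' s)) {2}K; apply: is_deriveB => //.
  exact: (is_derive_dir_along oB (ret_smooth H) (Bs s s1) (d1 s) (d2 s)).
have EA := affine_of_derive2_eq0 de de'.
have n0 : `|0 : R| <= 1 by rewrite normr0.
have eN s : `|s| <= 1 -> N (sg s) -> e s = 0.
  by move=> s1 Ns; rewrite /e !fctE /= (ret_id H (Bs s s1) Ns) subrr.
have e0 : e 0 = 0 by exact: eN.
(* An affine function that vanishes at 0 is zero if its slope is zero, as for a tangent initial
   velocity, or if it vanishes also at 1/2, as for an endpoint in N. *)
have e'0 : e' 0 = 0.
  case: bc => [T0|N2].
    by rewrite /e' (tangent_fixed H (Bs 0 n0) N0 T0) subrr.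
  have h1 : `|2^-1 : R| <= 1 by rewrite ger0_norm; lra.
  have := EA _ h1; rewrite (eN _ h1 N2) e0 add0r => /esym/eqP.
  by rewrite scaler_eq0 invr_eq0 pnatr_eq0/= => /eqP.
have Pis s : `|s| <= 1 -> Pi (sg s) = sg s.
  move=> s1; have := EA _ s1; rewrite e0 e'0 scaler0 addr0 /e !fctE /= => /eqP.
  by rewrite subr_eq0 => /eqP.
have sabs (s : R) : - 1 <= s <= 1 -> `|s| <= 1 by rewrite ler_norml.
split=> //.
- by move=> s /sabs s1; rewrite -Pis//; exact: (ret_in H (Bs s s1)).
- move=> s /sabs s1 z Tz; have [wE _] := key s s1.
  have Ns : N (sg s) by rewrite -Pis//; exact: (ret_in H (Bs s s1)).
  have <- := tangent_fixed H (Bs s s1) Ns Tz.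
  by rewrite (ret_jacobian H _ (Bs s s1)) dotE trmx_mul mulmxA wE mul0mx mxE.
Qed.

Lemma local_geodesics : exists2 rho0, 0 < rho0 & forall rho, 0 < rho -> rho <= rho0 ->
  (forall p a, N p -> `|p0 - p| <= rho -> tangent_space N p a -> `|a| <= rho ->
     exists sg sg' sg'', [/\ geodesic_on N (- 1) 1 sg sg' sg'', sg 0 = p & sg' 0 = a]) /\
  (forall p q, N p -> N q -> `|p0 - p| <= rho -> 2 * `|q - p| <= rho ->
     exists sg sg' sg'', [/\ geodesic_on N (- 1) 1 sg sg' sg'', sg 0 = p, sg 2^-1 = q &
       forall s, `|s| <= 1 -> `|p0 - sg s| <= 5 * rho]).
Proof.
have [r' r'0 [r'r QL]] := geodesic_op_lipschitz H.
have Q0 : Q p0 0 0 = 0.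
  rewrite /Q /geodesic_op mul0mx add0r big1// => i _; rewrite big1// => k _.
  by rewrite !mxE mul0r scale0r.
exists (r' / 8) => [|rho rho0 rhor]; first by rewrite divr_gt0.
have r8 : 8 * rho <= r' by lra.
have inB x : `|p0 - x| <= 5 * rho -> ball p0 r x.
  by rewrite -ball_normE/= => /le_lt_trans; apply; lra.
split.
  move=> p a Np pp Ta aa.
  have k0 : 0 <= (0 : R) <= 2 by apply/andP; split.
  have [sg [sg' [w [d1 d2 cw HQ [i0 _ i2]]]]] :=
    second_order_solution r'0 Q0 QL rho0 r8 k0 pp aa.
  exists sg, sg', w; split=> //; last exact: i2.
  apply: second_order_geodesic => //.
  - by move=> s /HQ[/inB ? _ ?].
  - by rewrite i0.
  - by left; rewrite i0 i2.
move=> p q Np Nq pp qq.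
have k0 : 0 <= (2 : R) <= 2 by apply/andP; split.
(* 2 (q - p) is the mean velocity from p to q over a parameter interval of length 1/2. *)
have aa : `|2 *: (q - p)| <= rho by rewrite normrZ ger0_norm.
have [sg [sg' [w [d1 d2 cw HQ [i0 i1 _]]]]] :=
  second_order_solution r'0 Q0 QL rho0 r8 k0 pp aa.
have i1' : sg 2^-1 = q by rewrite i1// scalerA mulVf// scale1r addrCA subrr addr0.
exists sg, sg', w; split=> //.
  apply: second_order_geodesic => //.
  - by move=> s /HQ[/inB ? _ ?].
  - by rewrite i0.
  - by right; rewrite i1'.
by move=> s /HQ[].
Qed.

End LocalGeodesics.

(** * Geodesics uniform over N and of arbitrary length *)

Section Uniform.
Context {R : realType} (m : nat) (N : set 'rV[R]_m).
Hypotheses (sN : is_submanifold N) (cN : compact N).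

(** Compactness in near-covering form, for the filter of radii tending to 0 from the right;
    monotonicity in r turns each local radius into an eventual property. *)
Lemma compact_uniform_radius (Pr : R -> 'rV[R]_m -> Prop) :
  (forall r r' p, 0 < r' -> r' <= r -> Pr r p -> Pr r' p) ->
  (forall p0, N p0 -> exists2 r, 0 < r & forall p, N p -> `|p0 - p| < r -> Pr r p) ->
  exists2 r, 0 < r & forall p, N p -> Pr r p.
Proof.
move=> mono loc.
have /compact_near_coveringP/(_ R (0^'+) (fun i p => N p -> Pr i p) _) K := cN.
have {K}K : \forall r \near 0^'+, N `<=` (fun p => N p -> Pr r p).
  apply: K => p0 Np0; have [r r0 Hr] := loc p0 Np0.
  exists (ball p0 r, `]0, r]%classic).
    split; first exact: nbhsx_ballx.
    by apply: filterS (filterI (nbhs_right_gt 0) (nbhs_right_le r0)) => i [? ?]; rewrite /= in_itv/=; apply/andP.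
  move=> [p i] /= [bp]; rewrite in_itv/= => /andP[i0 ir] Np.
  by apply: mono ir _ => //; apply: Hr => //; move: bp; rewrite -ball_normE.
have [r [r0 Hr]] := filter_ex (filterI (nbhs_right_gt (0 : R)) K).
by exists r => // p Np; exact: Hr.
Qed.

End Uniform.

Section Glue.
Context {R : realType}.

Lemma is_derive_affine_comp (V : normedModType R) (f : R -> V) (f' : V) (k c t : R) :
  is_derive (k * t + c) 1 f f' -> is_derive t 1 (fun s => f (k * s + c)) (k *: f').
Proof.
move=> df; have dsc : is_derive t 1 (fun s : R => k * s + c) k.
  rewrite -[X in is_derive _ _ _ X]addr0; apply: is_deriveD.
  have := @is_deriveZ R R R id k t 1 1 (is_derive_id _ _).
  by rewrite [k *: 1]mulr1.
have dg : differentiable f ((fun s : R => k * s + c) t).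
  by apply/derivable1_diffP; case: df.
have := is_derive_comp_diff dsc dg.
have -> : 'D_k f (k * t + c) = 'D_(k *: 1) f (k * t + c) by rewrite [k *: 1]mulr1.
by rewrite deriveZ_dir//; have [_ ->] := df.
Qed.

Definition glue (V : Type) (b : R) (f g : R -> V) (s : R) : V := if s <= b then f s else g s.

Lemma glue_near_le (V : Type) (b s : R) (f g : R -> V) : s < b -> \forall t \near s, f t = glue b f g t.
Proof. by move=> sb; apply: filterS (lt_nbhsl sb) => t tb; rewrite /glue ltW. Qed.

Lemma glue_near_gt (V : Type) (b s : R) (f g : R -> V) : b < s -> \forall t \near s, g t = glue b f g t.
Proof. by move=> sb; apply: filterS (lt_nbhsr sb) => t tb; rewrite /glue leNgt tb. Qed.

Lemma is_derive_glue_point (V : normedModType R) (b : R) (f g : R -> V) (d : V) :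
  f b = g b -> is_derive b 1 f d -> is_derive b 1 g d -> is_derive b 1 (glue b f g) d.
Proof.
move=> fg df dg.
have dF : differentiable f b by apply/derivable1_diffP; case: df.
have dG : differentiable g b by apply/derivable1_diffP; case: dg.
have lin : linear (fun h : R => h *: d) by move=> a x y; rewrite scalerDl scalerA.
pose f' := GRing.isLinear.Build _ _ _ _ _ lin.
pose L : {linear R -> V} := HB.pack (fun h : R => h *: d) f'.
have LE (k : R -> V) : differentiable k b -> is_derive b 1 k d -> forall h, 'd k b h = h *: d.
  move=> dk [_ kd] h; rewrite -kd deriveE//.
  by rewrite -linearZ/=; congr ('d k b _); rewrite [_ *: 1]mulr1.
have [] := @differentiable_epsilon R R V (glue b f g) L b.
- exact: scalel_continuous.
- move=> e e0.
  have /diff_locally/eqaddoP/(_ e e0) Hf := dF.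
  have /diff_locally/eqaddoP/(_ e e0) Hg := dG.
  apply: filterS2 Hf Hg => h; rewrite /= !fctE/= (LE f dF df) (LE g dG dg) /glue lexx -fg => Hf Hg.
  by case: ifP => _; rewrite -addrA -opprD.
- move=> dgl E; apply: DeriveDef; first exact/derivable1_diffP.
  by rewrite deriveE// E/= scale1r.
Qed.

Lemma is_derive_glue (V : normedModType R) (b : R) (f f' g g' : R -> V) :
  (forall s : R, is_derive s 1 f (f' s)) -> (forall s : R, is_derive s 1 g (g' s)) ->
  f b = g b -> f' b = g' b -> forall s : R, is_derive s 1 (glue b f g) (glue b f' g' s).
Proof.
move=> df dg fg fg' s; have [sb|bs|->] := ltgtP s b.
- rewrite {2}/glue ltW//; apply: near_eq_is_derive (df s); exact: glue_near_le.
- rewrite {2}/glue leNgt bs/=; apply: near_eq_is_derive (dg s); exact: glue_near_gt.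
- rewrite {2}/glue lexx; apply: is_derive_glue_point => //.
  by rewrite fg'; exact: dg.
Qed.

Lemma glue_continuous (b : R) (f g : R -> R) :
  continuous f -> continuous g -> f b = g b -> continuous (glue b f g).
Proof.
move=> cf cg fg s; apply/cvgrPdist_le => e e0.
have /cvgrPdist_le/(_ e e0) Hf := cf s; have /cvgrPdist_le/(_ e e0) Hg := cg s.
have [sb|bs|sb] := ltgtP s b.
- apply: filterS2 Hf (glue_near_le f g sb) => t Hf <-.
  by rewrite /glue (ltW sb).
- apply: filterS2 Hg (glue_near_gt f g bs) => t Hg <-.
  by rewrite /glue (leNgt s b) bs.
- rewrite {}sb in Hf Hg *; apply: filterS2 Hf Hg => t; rewrite -fg => Hf Hg.
  have -> : glue b f g b = f b by rewrite /glue lexx.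
  by rewrite /glue; case: ifP.
Qed.

End Glue.

Section LongGeodesics.
Context {R : realType} (m : nat) (N : set 'rV[R]_m).
Hypotheses (sN : is_submanifold N) (cN : compact N).
Implicit Types sg : R -> 'rV[R]_m.

Lemma geodesic_affine a b a' b' k c sg sg' sg'' :
  geodesic_on N a b sg sg' sg'' -> (forall s, a' <= s <= b' -> a <= k * s + c <= b) ->
  geodesic_on N a' b' (fun s => sg (k * s + c)) (fun s => k *: sg' (k * s + c))
    (fun s => k *: (k *: sg'' (k * s + c))).
Proof.
move=> [d1 d2 c2 i n] H; split.
- by move=> s; exact: is_derive_affine_comp.
- move=> s; have [dd <-] : is_derive s 1 (fun s => sg' (k * s + c)) (k *: sg'' (k * s + c)).
    exact: is_derive_affine_comp.
  by apply: DeriveDef; [exact: derivableZ|rewrite deriveZ].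
- move=> j s.
  have -> : (fun t => (k *: (k *: sg'' (k * t + c))) 0 j) =
      (fun t => k * (k * (fun t => sg'' t 0 j) (k * t + c))) by apply/funext => t; rewrite !mxE.
  apply: cvgMr; apply: cvgMr.
  apply: (@continuous_comp _ _ _ (fun t => k * t + c) (fun t => sg'' t 0 j)); last exact: c2.
  exact: (is_derive_scalar_continuous (@is_derive_affine_comp _ R id 1 k c s (is_derive_id _ _))).
- by move=> s /H; exact: i.
- move=> s /H ab z Tz; have := n _ ab z Tz; rewrite /dot => E.
  under eq_bigr do rewrite !mxE -!mulrA.
  by rewrite -!mulr_sumr E !mulr0.
Qed.

Lemma geodesic_sub a b a' b' sg sg' sg'' :
  geodesic_on N a b sg sg' sg'' -> a <= a' -> b' <= b -> geodesic_on N a' b' sg sg' sg''.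
Proof.
move=> [d1 d2 c2 i n] aa bb.
have H s : a' <= s <= b' -> a <= s <= b.
  by move=> /andP[? ?]; apply/andP; split; [exact: le_trans aa _|exact: le_trans bb].
by split=> // s /H; [exact: i|exact: n].
Qed.

(** Tangency of the velocity comes from neighbouring points of the curve in N, hence the open
    interval. The acceleration is a function of position and velocity, which is why geodesics glued
    to first order agree to second order. *)
Lemma geodesic_interior a b sg sg' sg'' s : geodesic_on N a b sg sg' sg'' -> a < s < b ->
  tangent_space N (sg s) (sg' s) /\
  sg'' s = - second_fund_form N (sg s) (sg' s) (sg' s).
Proof.
move=> [d1 d2 c2 i n] /andP[sa sb].
have Ns : N (sg s) by apply: i; rewrite !ltW.
have [r [P [Pi H]]] := submanifold_adapted_retraction sN Ns.
have nN : \forall t \near s, N (sg t).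
  by apply: filterS2 (lt_nbhsr sa) (lt_nbhsl sb) => t ta tb; apply: i; rewrite !ltW.
have nd : \forall t \near s, is_derive (t : R) 1 sg (sg' t) by exact: (@filterE _ (nbhs s) _ _ d1).
have [T c'P E] := curve_second_fund_form Ns H nN nd (d2 s) erefl.
split=> //; have : sg'' s *m P = 0.
  by apply/(normal_iff Ns H) => z; apply: n; rewrite !ltW.
by move: E => /[swap] -> /eqP; rewrite addr_eq0 => /eqP.
Qed.

Lemma geodesic_speed a b sg sg' sg'' s : geodesic_on N a b sg sg' sg'' -> a < 0 -> 0 <= s < b ->
  dot (sg' s) (sg' s) = dot (sg' 0) (sg' 0).
Proof.
move=> g a0 /andP[s0 sb]; have [d1 d2 c2 i n] := g.
have dd (t : R) : Num.min 0 s <= t <= Num.max 0 s ->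
    is_derive t 1 (fun t => dot (sg' t) (sg' t)) ((fun=> 0) t).
  rewrite min_l// max_r// => /andP[t0 ts].
  have tab : a < t < b by rewrite (lt_le_trans a0)// (le_lt_trans ts).
  have [T _] := geodesic_interior g tab.
  have E : dot (sg'' t) (sg' t) = 0.
    by apply: n => //; case/andP: tab => ? ?; rewrite !ltW.
  rewrite /dot in E *.
  have -> : (fun t => \sum_(j < m) sg' t 0 j * sg' t 0 j) =
      \sum_(j < m) ((fun t => sg' t 0 j) * (fun t => sg' t 0 j)).
    by apply/funext => u; rewrite fct_sumE.
  have -> : 0 = \sum_(j < m) (sg' t 0 j *: sg'' t 0 j + sg' t 0 j *: sg'' t 0 j).
    rewrite big_split/=; rewrite -[LHS]addr0 -{2}E -{1}E; congr (_ + _); apply: eq_bigr => j _; exact: mulrC.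
  by apply: is_derive_sum => j; apply: is_deriveM; apply: is_derive_component; exact: d2.
have d0 (t : R) : Num.min 0 s <= t <= Num.max 0 s -> is_derive t 1 (cst (0 : R)) ((fun=> 0) t).
  by move=> _; exact: is_derive_cst.
have := derive_eq_diff dd d0; rewrite /cst subrr => /eqP; rewrite subr_eq0 => /eqP; exact.
Qed.

Lemma norm_le_dot (v : 'rV[R]_m) : `|v| ^+ 2 <= dot v v.
Proof.
have H i : `|v 0 i| ^+ 2 <= dot v v.
  rewrite real_normK ?num_real// /dot (bigD1 i)//= -expr2 lerDl sumr_ge0// => j _.
  by rewrite -expr2 sqr_ge0.
have D0 := dot_ge0 v.
rewrite -[leRHS](sqr_sqrtr D0) lerXn2r ?nnegrE ?sqrtr_ge0//.
apply: row_norm_le => [|i]; first exact: sqrtr_ge0.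
by rewrite -[leLHS]ger0_norm// -sqrtr_sqr; exact: ler_wsqrtr.
Qed.

Lemma uniform_ivp : exists2 rho, 0 < rho & forall p a, N p -> tangent_space N p a -> `|a| <= rho ->
  exists sg sg' sg'', [/\ geodesic_on N (- 1) 1 sg sg' sg'', sg 0 = p & sg' 0 = a].
Proof.
have [||rho rho0 Hr] := @compact_uniform_radius R m N cN (fun rho p => forall a, tangent_space N p a -> `|a| <= rho ->
  exists sg sg' sg'', [/\ geodesic_on N (- 1) 1 sg sg' sg'', sg 0 = p & sg' 0 = a]).
- by move=> r r' p _ r'r H a Ta ar; apply: H => //; exact: le_trans r'r.
- move=> p0 Np0; have [r [P [Pi H]]] := submanifold_adapted_retraction sN Np0.
  have [rho rho0 K] := local_geodesics H.
  exists rho => // p Np pp a Ta aa; have [K1 _] := K rho rho0 (lexx _).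
  by apply: K1 => //; exact: ltW.
by exists rho => // p a Np; exact: Hr.
Qed.

Lemma uniform_bvp e : 0 < e -> exists2 d, 0 < d & forall p q, N p -> N q -> `|q - p| <= d ->
  exists sg sg' sg'', [/\ geodesic_on N (- 2) 2 sg sg' sg'', sg 0 = p, sg 1 = q &
    forall s, `|s| <= 2 -> `|p - sg s| <= e].
Proof.
move=> e0.
have [||d d0 Hd] := @compact_uniform_radius R m N cN (fun d p => forall q, N q -> `|q - p| <= d ->
  exists sg sg' sg'', [/\ geodesic_on N (- 2) 2 sg sg' sg'', sg 0 = p, sg 1 = q &
    forall s, `|s| <= 2 -> `|p - sg s| <= e]).
- by move=> r r' p _ r'r H q Nq qr; apply: H => //; exact: le_trans r'r.
- move=> p0 Np0; have [r [P [Pi H]]] := submanifold_adapted_retraction sN Np0.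
  have [rho0 rho00 K] := local_geodesics H.
  pose rho := Num.min rho0 (e / 6).
  have r0 : 0 < rho by rewrite lt_min rho00 divr_gt0.
  have [|_ K2] := K rho r0; first by rewrite ge_min lexx.
  have re : 6 * rho <= e by rewrite -ler_pdivlMl// mulrC ge_min lexx orbT.
  exists (rho / 2) => [|p Np pp q Nq qp]; first by rewrite divr_gt0.
  have [||sg [sg' [sg'' [g s0 s1 sb]]]] := K2 p q Np Nq.
  - by lra.
  - by lra.
  exists (fun s => sg (2^-1 * s + 0)), (fun s => 2^-1 *: sg' (2^-1 * s + 0)),
    (fun s => 2^-1 *: (2^-1 *: sg'' (2^-1 * s + 0))); split.
  + by apply: geodesic_affine g _ => s /andP[? ?]; apply/andP; split; lra.
  + by rewrite mulr0 addr0.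
  + by rewrite mulr1 addr0.
  + move=> s s2; rewrite addr0; have h : `|2^-1 * s| <= 1 by rewrite normrM ger0_norm; lra.
    have := sb _ h; have := ler_distD p0 p (sg (2^-1 * s)); rewrite [`|p - p0|]distrC; lra.
by exists d => // p q Np Nq; exact: Hd.
Qed.

(** The gain d depends on the speed bound V alone: speed is conserved, and the initial value problem
    is solvable uniformly over the compact N. Iteration therefore reaches any length. *)
Lemma extend_right V : exists2 d, 0 < d & forall a b sg sg' sg'', a < 0 -> 2 <= b ->
  geodesic_on N a b sg sg' sg'' -> dot (sg' 0) (sg' 0) <= V ->
  exists tg tg' tg'', [/\ geodesic_on N a (b + d) tg tg' tg'',
    (forall s, s <= 3 / 2 -> tg s = sg s) & tg' 0 = sg' 0].
Proof.
have [rho rho0 IVP] := uniform_ivp.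
pose W := Num.sqrt `|V| + 1; have W0 : 0 < W by rewrite ltr_wpDl// sqrtr_ge0.
(* Dividing the velocity by k brings it into the range of [uniform_ivp]; k >= 8 makes d small enough
   for the gluing point b - d to stay beyond 3/2. *)
pose k := Num.max (W / rho) 8.
have k8 : 8 <= k by rewrite le_max lexx orbT.
have k0 : 0 < k by lra.
have kW : W / k <= rho.
  by rewrite ler_pdivrMr// mulrC -ler_pdivrMr// le_max lexx.
pose d := (2 * k)^-1.
have d0 : 0 < d by rewrite invr_gt0 mulr_gt0.
have d16 : d <= 1 / 4.
  rewrite /d div1r lef_pV2 ?posrE ?mulr_gt0//; lra.
have kd : k * (2 * d) = 1 by rewrite /d; field; rewrite gt_eqF.
exists d => // a b sg sg' sg'' a0 b2 g sV.
(* The restart is at an interior time, where the velocity is known to be tangent. The new piece has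
   half-length 1/k = 2 d about b - d, so it reaches b + d. *)
pose b0 := b - d.
have b0ab : a < b0 < b by rewrite /b0; apply/andP; split; lra.
have sb0 : dot (sg' b0) (sg' b0) = dot (sg' 0) (sg' 0).
  by apply: (geodesic_speed g a0); rewrite /b0; apply/andP; split; lra.
have [T E] := geodesic_interior g b0ab.
have Nb0 : N (sg b0) by apply: (geo_in g); case/andP: b0ab => ? ?; rewrite !ltW.
have vW : `|sg' b0| <= W.
  rewrite /W; apply: le_trans (_ : _ <= Num.sqrt `|V|) _; last by rewrite lerDl.
  rewrite -[leLHS]ger0_norm// -sqrtr_sqr; apply: ler_wsqrtr.
  apply: le_trans (norm_le_dot _) _; rewrite sb0; apply: le_trans sV _; exact: ler_norm.
have [||t0 [t0' [t0'' [gt t00 t01]]]] := IVP (sg b0) (k^-1 *: sg' b0) Nb0.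
- have [r [P [Pi H]]] := submanifold_adapted_retraction sN Nb0.
  apply/(tangent_spaceP Nb0 H); move/(tangent_spaceP Nb0 H): T => T.
  by rewrite -scalemxAl T.
- rewrite normrZ gtr0_norm ?invr_gt0// mulrC; apply: le_trans kW.
  by rewrite ler_pM2r ?invr_gt0.
pose t s := t0 (k * s + - (k * b0)).
pose t' s := k *: t0' (k * s + - (k * b0)).
pose t'' s := k *: (k *: t0'' (k * s + - (k * b0))).
have gt' : geodesic_on N (b0 - 2 * d) (b0 + 2 * d) t t' t''.
  apply: geodesic_affine gt _ => s /andP[s1 s2].
  have -> : k * s + - (k * b0) = k * (s - b0) by ring.
  have e1 : k * (- (2 * d)) <= k * (s - b0) by rewrite ler_pM2l//; lra.
  have e2 : k * (s - b0) <= k * (2 * d) by rewrite ler_pM2l//; lra.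
  by rewrite mulrN kd in e1; rewrite kd in e2; rewrite e1 e2.
have tb : t b0 = sg b0 by rewrite /t subrr.
have t'b : t' b0 = sg' b0 by rewrite /t' subrr t01 scalerA mulfV ?gt_eqF// scale1r.
have b0i : b0 - 2 * d < b0 < b0 + 2 * d by apply/andP; split; lra.
have t''b : t'' b0 = sg'' b0.
  by have [_ ->] := geodesic_interior gt' b0i; rewrite tb t'b E.
exists (glue b0 sg t), (glue b0 sg' t'), (glue b0 sg'' t''); split.
- split.
  + exact: is_derive_glue (geo_d1 g) (geo_d1 gt') (esym tb) (esym t'b).
  + exact: is_derive_glue (geo_d2 g) (geo_d2 gt') (esym t'b) (esym t''b).
  + move=> j; have -> : (fun s => glue b0 sg'' t'' s 0 j) = glue b0 (fun s => sg'' s 0 j) (fun s => t'' s 0 j).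
      by apply/funext => s; rewrite /glue; case: ifP.
    apply: glue_continuous; [exact: geo_cont g j|exact: geo_cont gt' j|by rewrite t''b].
  + move=> s /andP[sa sb]; rewrite /glue; case: leP => sb0'.
      by apply: (geo_in g); rewrite sa/= /b0 in sb0' *; lra.
    by apply: (geo_in gt'); rewrite /b0 in sb0' *; apply/andP; split; lra.
  + move=> s /andP[sa sb]; rewrite /glue; case: leP => sb0'.
      by apply: (geo_normal g); rewrite sa/= /b0 in sb0' *; lra.
    by apply: (geo_normal gt'); rewrite /b0 in sb0' *; apply/andP; split; lra.
- by move=> s s32; rewrite /glue ifT// /b0; lra.
- by rewrite /glue ifT// /b0; lra.
Qed.

Lemma extend_right_far a b M sg sg' sg'' : a < 0 -> 2 <= b ->
  geodesic_on N a b sg sg' sg'' ->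
  exists tg tg' tg'', [/\ geodesic_on N a M tg tg' tg'',
    (forall s, s <= 3 / 2 -> tg s = sg s) & tg' 0 = sg' 0].
Proof.
move=> a0 b2 g; have [d d0 Hd] := extend_right (dot (sg' 0) (sg' 0)).
have H n : exists tg tg' tg'', [/\ geodesic_on N a (b + n%:R * d) tg tg' tg'',
    (forall s, s <= 3 / 2 -> tg s = sg s) & tg' 0 = sg' 0].
  elim: n => [|n [tg [tg' [tg'' [gn En En']]]]].
    by exists sg, sg', sg''; rewrite mul0r addr0.
  have bn : 2 <= b + n%:R * d by have : 0 <= n%:R * d; [rewrite mulr_ge0// ltW|lra].
  have [|hg [hg' [hg'' [gh Eh Eh']]]] := Hd _ _ _ _ _ a0 bn gn; first by rewrite En'.
  exists hg, hg', hg''; split.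
  - by have -> : b + n.+1%:R * d = b + n%:R * d + d by rewrite -natr1; ring.
  - by move=> s s32; rewrite Eh// En.
  - by rewrite Eh'.
have [tg [tg' [tg'' [gn En En']]]] := H (Num.truncn (`|M| / d)).+1.
exists tg, tg', tg''; split=> //; apply: geodesic_sub gn _ _ => //.
have : `|M| / d <= (Num.truncn (`|M| / d)).+1%:R by apply: ltW; exact: truncnS_gt.
rewrite ler_pdivrMr// => h; have := ler_norm M; lra.
Qed.

(** The distance d is chosen before M. This order of quantifiers matters because M will bound a heat
    profile, whose size depends on the time available. *)
Lemma long_geodesic e : 0 < e -> exists2 d, 0 < d & forall p q M, N p -> N q -> `|q - p| <= d ->
  exists sg sg' sg'', [/\ geodesic_on N (- M) M sg sg' sg'', sg 0 = p, sg 1 = q &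
    forall s, 0 <= s <= 1 -> `|p - sg s| <= e].
Proof.
move=> /uniform_bvp[d d0 Hd]; exists d => // p q M Np Nq pq.
have [sg [sg' [sg'' [g s0 s1 sb]]]] := Hd p q Np Nq pq.
have n2 : - 2 < 0 :> R by lra.
pose M' := Num.max M 2; have M'0 : 2 <= M' by rewrite le_max lexx orbT.
have [tg [tg' [tg'' [gt Et _]]]] := extend_right_far M' n2 (lexx 2) g.
have gr : geodesic_on N (- M') 2 (fun s => tg (- 1 * s + 0)) (fun s => - 1 *: tg' (- 1 * s + 0))
    (fun s => - 1 *: (- 1 *: tg'' (- 1 * s + 0))).
  by apply: geodesic_affine gt _ => s /andP[? ?]; apply/andP; split; lra.
have M'n : - M' < 0 by lra.
(* The left end is extended by reflecting s to - s and extending to the right again; both extensions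
   leave [-3/2, 3/2], and so the points at 0 and 1, unchanged. *)
have [hg [hg' [hg'' [gh Eh _]]]] := extend_right_far M' M'n (lexx 2) gr.
have EE s : - (3 / 2) <= s <= 3 / 2 -> hg (- 1 * s + 0) = sg s.
  move=> /andP[? ?]; rewrite Eh; last lra.
  by rewrite Et ?mulN1r ?addr0 ?mulN1r ?opprK//; lra.
have MM : M <= M' by rewrite le_max lexx.
exists (fun s => hg (- 1 * s + 0)), (fun s => - 1 *: hg' (- 1 * s + 0)),
  (fun s => - 1 *: (- 1 *: hg'' (- 1 * s + 0))); split.
- by apply: geodesic_affine gh _ => s /andP[? ?]; apply/andP; split; lra.
- by rewrite EE//; apply/andP; split; lra.
- by rewrite EE//; apply/andP; split; lra.
- move=> s /andP[s0' s1']; rewrite EE; last by apply/andP; split; lra.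
  by apply: sb; rewrite ger0_norm//; lra.
Qed.

End LongGeodesics.

(** * Global retraction *)

Section Retraction.
Context {R : realType} (m : nat) (N : set 'rV[R]_m).
Hypotheses (sN : is_submanifold N) (cN : compact N).

Lemma smooth_upto_step_comp (V : normedModType R) (U : set V) (d : nat -> R -> R) (f : V -> R) k j :
  open U -> (forall k (t : R), is_derive t 1 (d k) (d k.+1 t)) ->
  smooth_upto k U f -> smooth_upto k U (fun x => d j (f x)).
Proof.
move=> oU dd; elim: k j => [|k IH] j sf; have [df sf'] := sf.
  split=> // x Ux; apply: (@differentiable_comp _ _ _ _ f (d j)); first exact: df.
  by apply/derivable1_diffP; case: (dd j (f x)).
split.
  move=> x Ux; apply: (@differentiable_comp _ _ _ _ f (d j)); first exact: df.
  by apply/derivable1_diffP; case: (dd j (f x)).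
move=> v; apply: (@smooth_upto_eq _ _ _ oU _ _ ('D_v f * (fun x => d j.+1 (f x)))).
  move=> x /[1!inE] Ux.
  have ddj : differentiable (d j) (f x) by apply/derivable1_diffP; case: (dd j (f x)).
  rewrite [RHS](derive_comp_diff _ (df x Ux) ddj).
  have -> : 'D_('D_v f x) (d j) (f x) = 'D_('D_v f x *: 1) (d j) (f x) by rewrite [_ *: 1]mulr1.
  by rewrite deriveZ_dir//; have [_ ->] := dd j (f x).
apply: smooth_upto_mul => //; first exact: sf'.
exact: IH (smooth_upto_pred sf).
Qed.

(** F interpolates between the local retraction near p and the identity far away. Both fix N, so F
    does; its values are known to lie in N only near p. *)
Lemma cutoff_retraction p : N p -> exists (F : 'rV[R]_m -> 'rV[R]_m) (A : set 'rV[R]_m),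
  [/\ smooth_on setT F, forall q, N q -> F q = q, open A, A p & forall q, A q -> N (F q)].
Proof.
move=> Np; have [r [P [Pi H]]] := submanifold_adapted_retraction sN Np.
have r0 := ret_gt0 H.
have [d [dd d0 d1 _ _]] := gevrey_step (ltr01 : 0 < 1 :> R).
(* The cut-off depends on the squared Euclidean distance, which is smooth: it is 1 up to a and 0
   from 2 a = (r/2)^2 on. *)
pose a := r ^+ 2 / 8; have a0 : 0 < a by rewrite divr_gt0// exprn_gt0.
pose rho q := (dot (q - p) (q - p) - a) / a.
pose chi q := 1 - d 0%N (rho q).
have srho : smooth_on setT rho.
  have sc i : smooth_on setT (fun q : 'rV[R]_m => q 0 i - p 0 i).
    apply: (@smooth_on_add _ _ _ openT _ (fun q : 'rV[R]_m => q 0 i) (cst (- p 0 i))).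
      apply: smooth_on_linear; [exact: openT|by move=> b x y; rewrite !mxE|exact: coord_continuous].
    by apply: smooth_on_cst; exact: openT.
  have -> : rho = (fun q => \sum_i ((fun q : 'rV[R]_m => q 0 i - p 0 i) * (fun q : 'rV[R]_m => q 0 i - p 0 i)) q)
       * cst a^-1 + cst (- 1).
    apply/funext => q; rewrite /rho !fctE mulrBl divff ?gt_eqF//; congr (_ / _ - _).
    by apply: eq_bigr => i _; rewrite !mxE.
  apply: smooth_on_add; [exact: openT| |by apply: smooth_on_cst; exact: openT].
  apply: smooth_on_mul; [exact: openT| |by apply: smooth_on_cst; exact: openT].
  apply: smooth_on_sum; first exact: openT.
  by move=> i _; apply: smooth_on_mul; [exact: openT|exact: sc|exact: sc].
have schi : smooth_on setT chi.
  have -> : chi = cst 1 + cst (- 1) * (fun q => d 0%N (rho q)).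
    by apply/funext => q; rewrite !fctE mulN1r.
  apply: smooth_on_add; [exact: openT|by apply: smooth_on_cst; exact: openT|].
  apply: smooth_on_mul; [exact: openT|by apply: smooth_on_cst; exact: openT|].
  apply/smooth_onP => k; apply: smooth_upto_step_comp => //; first exact: openT.
  by have /smooth_onP := srho; exact.
have chi1 q : dot (q - p) (q - p) <= a -> chi q = 1.
  by move=> h; rewrite /chi d0 ?subr0// /rho pmulr_lle0 ?invr_gt0// subr_le0.
have chi0 q : r / 2 < `|p - q| -> chi q = 0.
  move=> h; rewrite /chi; have [|-> _] := d1 (rho q); last by rewrite subrr.
  rewrite /rho ler_pdivlMr// mul1r lerBrDr.
  apply: le_trans (norm_le_dot _); rewrite distrC.
  have -> : a + a = (r / 2) ^+ 2 by rewrite /a; field.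
  by rewrite ler_pXn2r ?nnegrE //; [exact: ltW|lra].
pose F q := q + chi q *: (Pi q - q).
have oB : open (ball p r) by exact: ball_open.
have sF1 : smooth_on (ball p r) F.
  apply/(smooth_on_components oB) => i.
  have -> : (fun q => F q 0 i) = (fun q : 'rV[R]_m => q 0 i) + chi * ((fun q => Pi q 0 i) + cst (- 1) * (fun q : 'rV[R]_m => q 0 i)).
    by apply/funext => q; rewrite /F !mxE !fctE mulN1r.
  have sco : smooth_on (ball p r) (fun q : 'rV[R]_m => q 0 i).
    by apply: smooth_on_linear => //; [move=> b x y; rewrite !mxE|exact: coord_continuous].
  apply: smooth_on_add => //; apply: smooth_on_mul => //; first exact: smooth_on_sub schi.
  apply: smooth_on_add => //; first by have /(smooth_on_components oB) := ret_smooth H; exact.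
  by apply: smooth_on_mul => //; exact: smooth_on_cst.
pose B : set 'rV[R]_m := [set q | r / 2 < `|p - q|].
have cnorm : continuous (fun q : 'rV[R]_m => `|p - q|).
  move=> q A /nbhs_ballP[e e0 He]; apply/nbhs_ballP; exists e => // q'.
  rewrite -ball_normE/= => qq'; apply: He; rewrite -ball_normE/=.
  apply: le_lt_trans (ler_dist_dist _ _) _.
  by rewrite opprB addrC addrA subrK distrC.
have oBc : open B.
  have -> : B = (fun q => `|p - q|) @^-1` [set x | r / 2 < x] by [].
  by apply: open_comp; [move=> q _; exact: cnorm|exact: open_gt].
have sF2 : smooth_on B F.
  apply: (@smooth_on_eq _ _ _ oBc _ id).
    by move=> q; rewrite inE => Bq; rewrite /F chi0// scale0r addr0.
  apply: smooth_on_linear => //; first by move=> b x y.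
have FN q : N q -> F q = q.
  move=> Nq; have [bq|] := pselect (ball p r q).
    by rewrite /F (ret_id H bq Nq) subrr scaler0 addr0.
  rewrite -ball_normE/= => /negP; rewrite -leNgt => rq.
  by rewrite /F chi0 ?scale0r ?addr0//; lra.
have cdot : continuous (fun q : 'rV[R]_m => rho q).
  by move=> q; apply: (smooth_on_continuous srho).
exists F, (rho @^-1` [set x | x < 0]); split=> //.
- apply: smooth_on_local => q _; have [bq|] := pselect (ball p r q); first by exists (ball p r).
  rewrite -ball_normE/= => /negP; rewrite -leNgt => rq.
  by exists B => //; rewrite /B/=; lra.
- by apply: open_comp; [move=> q _; exact: cdot|exact: open_lt].
- rewrite /preimage/= /rho subrr (_ : dot 0 0 = 0); last by rewrite /dot big1// => i _; rewrite mxE mul0r.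
  by rewrite sub0r mulNr divff ?gt_eqF// ltrN10.
- move=> q; rewrite /preimage/= /rho pmulr_llt0 ?invr_gt0// subr_lt0 => qa.
  rewrite /F chi1 ?ltW// scale1r addrC subrK; apply: (ret_in H).
  rewrite -ball_normE/= -(@ltr_pXn2r _ 2) ?nnegrE ?(ltW r0)//.
  apply: le_lt_trans (_ : _ <= dot (q - p) (q - p)) _; first by rewrite distrC norm_le_dot.
  by apply: lt_trans qa _; rewrite /a; have := exprn_gt0 2 r0; lra.
Qed.

(** A composition of finitely many cut-off retractions. Near a point of N one factor maps into N:
    the inner factors move points only slightly because they fix N, and the outer ones leave N
    pointwise fixed. *)
Lemma global_retraction : exists F : 'rV[R]_m -> 'rV[R]_m,
  [/\ smooth_on setT F, forall q, N q -> F q = q &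
      exists2 e, 0 < e & forall p q, N p -> `|p - q| < e -> N (F q)].
Proof.
have /choice[FA HFA] : forall p, exists FA : ('rV[R]_m -> 'rV[R]_m) * set 'rV[R]_m, N p ->
    [/\ smooth_on setT FA.1, forall q, N q -> FA.1 q = q, open FA.2, FA.2 p & forall q, FA.2 q -> N (FA.1 q)].
  move=> p; have [Np|nNp] := pselect (N p).
    by have [F [A HF]] := cutoff_retraction Np; exists (F, A) => _.
  by exists (id, set0) => /nNp.
have := cN; rewrite compact_cover => /(_ _ N (fun p => (FA p).2)).
case=> [p /HFA[] //|p Np|D DN cov]; first by exists p => //; case: (HFA p Np).
have H (l : seq 'rV[R]_m) : (forall p, p \in l -> N p) ->
  exists F : 'rV[R]_m -> 'rV[R]_m, [/\ smooth_on setT F, forall q, N q -> F q = q &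
    forall p, N p -> (exists2 i, i \in l & (FA i).2 p) -> \forall q \near p, N (F q)].
  elim: l => [_|i l IH lN].
    exists id; split=> // [|p _ [? ]//].
    by apply: smooth_on_linear; [exact: openT|by move=> b x y|by move=> q A; apply].
  have [|F [sF FN HF]] := IH; first by move=> p pl; apply: lN; rewrite inE pl orbT.
  have Ni : N i by apply: lN; rewrite inE eqxx.
  have [sG GN oA Ai AG] := HFA i Ni.
  exists ((FA i).1 \o F); split.
  - by apply: (smooth_on_comp openT openT) sG.
  - by move=> q Nq; rewrite /= FN// GN.
  - move=> p Np [j]; rewrite inE => /orP[/eqP ->|jl] Ajp.
      have cF : {for p, continuous F} by exact: (smooth_on_continuous sF).
      have AFp : (FA i).2 (F p) by rewrite FN.
      have nA : \forall q \near p, (FA i).2 (F q) by exact: cF (open_nbhs_nbhs (conj oA AFp)).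
      by apply: filterS nA => q /= Aq; exact: AG.
    have := HF p Np; case; first by exists j.
    move=> e e0 He; exists e => // q qe; rewrite /= GN; exact: He.
have [|F [sF FN HF]] := H (finmap.enum_fset D).
  by move=> p pD; have := DN p pD; rewrite inE.
exists F; split=> //.
have [||e e0 He] := @compact_uniform_radius R m N cN (fun e p => forall q, `|p - q| < e -> N (F q)).
- by move=> r r' p _ r'r Hr q qr; apply: Hr; exact: lt_le_trans r'r.
- move=> p0 Np0; have [i iD Ai] := cov p0 Np0.
  have [|e e0 He] := (nbhs_ballP _ _).1 (HF p0 Np0 _); first by exists i.
  exists (e / 2) => [|p Np pp q pq]; first by rewrite divr_gt0.
  by apply: He; rewrite -ball_normE/=; apply: le_lt_trans (ler_distD p _ _) _; lra.
by exists e => // p q Np; exact: He.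
Qed.

End Retraction.

(** * Classical solutions are strong solutions *)

Section Measurability.
Context {R : realType}.
Local Notation mu := (@lebesgue_measure R).

Lemma open_measurable_prod (O : set (R * R)) : open O -> measurable O.
Proof.
move=> oO.
pose box (q : rat * rat * (rat * rat)) : set (R * R) :=
  `]ratr q.1.1, ratr q.1.2[ `*` `]ratr q.2.1, ratr q.2.2[.
have -> : O = \bigcup_q (if `[< box q `<=` O >] then box q else set0).
  apply/seteqP; split=> [[x y] Oxy|z [q _]]; last first.
    by case: asboolP => // bO; exact: bO.
  have [[A B] [/= nA nB] ABO] : nbhs (x, y) O by exact: open_nbhs_nbhs.
  have [e1 /= e10 He1] := (nbhs_ballP _ _).1 nA.
  have [e2 /= e20 He2] := (nbhs_ballP _ _).1 nB.
  have dense (u v : R) : u < v -> exists q : rat, u < ratr q < v.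
    by move=> uv; have [q] := rat_in_itvoo uv; rewrite in_itv/=; exists q.
  have [|a1 /andP[a1l a1r]] := dense (x - e1) x; first by rewrite ltrBlDr ltrDl.
  have [|a2 /andP[a2l a2r]] := dense x (x + e1); first by rewrite ltrDl.
  have [|b1 /andP[b1l b1r]] := dense (y - e2) y; first by rewrite ltrBlDr ltrDl.
  have [|b2 /andP[b2l b2r]] := dense y (y + e2); first by rewrite ltrDl.
  exists ((a1, a2), (b1, b2)) => //; case: asboolP => [_|]; first by split; rewrite /= in_itv/= ?a1r ?b1r.
  case=> -[x' y'] [] /=; rewrite !in_itv/= => /andP[? ?] /andP[? ?].
  apply: ABO; split=> /=.
    by apply: He1; rewrite -ball_normE/= ltr_norml; apply/andP; split; lra.
  by apply: He2; rewrite -ball_normE/= ltr_norml; apply/andP; split; lra.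
apply: countable_bigcupT_measurable => [|q]; first exact: countableP.
case: ifP => _ //; exact: measurableX.
Qed.

Lemma continuous_measurable_prod (D : set (R * R)) (g : R * R -> R) :
  measurable D -> continuous g -> measurable_fun D g.
Proof.
move=> mD cg; apply: (measurability _ (RGenOInfty.measurableE R)).
move=> /= _ [_ [a ->]] <-; apply: measurableI => //; apply: open_measurable_prod.
by apply: open_comp => [z _|]; [exact: cg|exact: interval_open].
Qed.

Lemma ftc_continuous (f f' : R -> R) (a b : R) :
  (forall s : R, is_derive s 1 f (f' s)) -> continuous f' -> a <= b ->
  f b - f a = \int[mu]_(z in `[a, b]) f' z.
Proof.
move=> df cf'; rewrite le_eqVlt => /predU1P[->|ab].
  by rewrite subrr set_itv1 Rintegral_set1.
rewrite /Rintegral (@continuous_FTC2 _ f' f)//.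
- exact: continuous_subspaceT.
- have cf x : {for x, continuous f} by exact: is_derive_scalar_continuous (df x).
  split; [by move=> x _; case: (df x)|exact/cvg_at_right_filter/cf|exact/cvg_at_left_filter/cf].
- by move=> x _; rewrite derive1E; case: (df x).
Qed.

Lemma ftc_continuous_oo (f f' : R -> R) (a b : R) :
  (forall s : R, is_derive s 1 f (f' s)) -> continuous f' -> a <= b ->
  f b - f a = \int[mu]_(z in `]a, b[) f' z.
Proof.
move=> df cf' ab; rewrite (ftc_continuous df cf' ab) /Rintegral integral_itv_bndoo//.
apply/measurable_EFinP; apply: measurable_funS (continuous_measurable_fun cf') => //.
Qed.

Lemma continuous_prod_left (V : topologicalType) (g : R * R -> V) (t : R) :
  continuous g -> continuous (fun x => g (t, x)).
Proof.
move=> cg x; apply: (@continuous_comp _ _ _ (fun y : R => (t, y)) g); last exact: cg.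
exact: pair_left_continuous.
Qed.

Lemma continuous_prod_right (V : topologicalType) (g : R * R -> V) (x : R) :
  continuous g -> continuous (fun t => g (t, x)).
Proof.
move=> cg t; apply: (@continuous_comp _ _ _ (fun y : R => (y, x)) g); last exact: cg.
exact: pair_right_continuous.
Qed.

Lemma bounded_on_rectangle (V : normedModType R) (g : R * R -> V) (a b c d : R) : continuous g ->
  exists2 M, 0 <= M & forall t x, a <= t <= b -> c <= x <= d -> `|g (t, x)| <= M.
Proof.
move=> cg; pose K : set (R * R) := `[a, b] `*` `[c, d].
have cK : compact K by apply: compact_setX; exact: segment_compact.
have [K0|/set0P[z0 Kz0]] := eqVneq K set0.
  exists 0 => // t x tab xcd; have : K (t, x) by split; rewrite /= in_itv.
  by rewrite K0.
have cn : {within K, continuous (fun z => `|g z|)}.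
  by apply: continuous_subspaceT => z; apply: cvg_norm; exact: cg.
have K1 : K !=set0 by exists z0.
have [z _ Hz] := compact_EVT_max K1 cK cn.
exists `|g z| => // t x tab xcd; apply: Hz; rewrite inE.
by split; rewrite /= in_itv.
Qed.

Lemma uniformly_near (V : normedModType R) (g : R * R -> V) (t0 c d e : R) : continuous g -> 0 < e ->
  \forall t \near t0, forall x, c <= x <= d -> `|g (t, x) - g (t0, x)| <= e.
Proof.
move=> cg e0.
have /compact_near_coveringP/(_ R (nbhs t0) (fun t x => `|g (t, x) - g (t0, x)| <= e) _) :=
  @segment_compact R c d.
move=> H; have {H} : \forall t \near t0, `[c, d]%classic `<=` (fun x => `|g (t, x) - g (t0, x)| <= e).
  apply: H => x0 _.
  have e2 : 0 < e / 2 by rewrite divr_gt0.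
  have /cvgrPdist_lt/(_ _ e2) [[A B] [/= nA nB] AB] := cg (t0, x0).
  exists (B, A) => //= -[x t] /= [Bx At].
  have h1 := AB (t, x) (conj At Bx).
  have h2 := AB (t0, x) (conj (nbhs_singleton nA) Bx).
  rewrite /= in h1 h2.
  have -> : g (t, x) - g (t0, x) = (g (t0, x0) - g (t0, x)) - (g (t0, x0) - g (t, x)).
    by rewrite opprB [RHS]addrC addrA subrK.
  by apply: le_trans (ler_normB _ _) _; lra.
by apply: filterS => t H x xcd; apply: H; rewrite /= in_itv.
Qed.

End Measurability.

Section L2Bounds.
Context {R : realType} (m : nat).
Local Notation mu := (@lebesgue_measure R).

(** Directly from the supremum over simple functions: those below f are below g. *)
Lemma le_integral_nonneg (D : set R) (f g : R -> \bar R) :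
  (forall x, D x -> (0 <= f x)%E) -> (forall x, D x -> (f x <= g x)%E) ->
  (\int[mu]_(x in D) f x <= \int[mu]_(x in D) g x)%E.
Proof.
move=> f0 fg; have g0 x : D x -> (0 <= g x)%E by move=> Dx; exact: le_trans (f0 x Dx) (fg x Dx).
rewrite !ge0_integralE//; apply: ge_ereal_sup => _ [h hf <-].
apply: ereal_sup_ubound; exists h => // x; apply: le_trans (hf x) _.
by rewrite /patch; case: ifPn => // xD; apply: fg; rewrite inE in xD.
Qed.

Lemma dot_le_norm (v : 'rV[R]_m) : dot v v <= m%:R * `|v| ^+ 2.
Proof.
apply: le_trans (_ : _ <= \sum_(i < m) `|v| ^+ 2) _.
  apply: ler_sum => i _; rewrite -expr2 -real_normK ?num_real//.
  by rewrite ler_pXn2r ?nnegrE//; exact: coord_le_norm.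
by rewrite sumr_const card_ord mulr_natl.
Qed.

Lemma period_gt0 : 0 < pi *+ 2 :> R.
Proof. by rewrite pmulrn_rgt0// pi_gt0. Qed.

Lemma sqnorm_L2_ge0 (g : R -> 'rV[R]_m) : (0 <= sqnorm_L2 g)%E.
Proof. by apply: integral_ge0 => x _; rewrite lee_fin dot_ge0. Qed.

Lemma sqnorm_L2_le (g : R -> 'rV[R]_m) M : 0 <= M ->
  (forall x, 0 <= x <= pi *+ 2 -> `|g x| <= M) ->
  (sqnorm_L2 g <= (m%:R * M ^+ 2 * (pi *+ 2))%:E)%E.
Proof.
move=> M0 gM; rewrite /sqnorm_L2.
apply: (@le_trans _ _ (\int[mu]_(x in `[0%R, (pi *+ 2)%R]) (cst (m%:R * M ^+ 2)%:E x))%E).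
  apply: le_integral_nonneg => x; first by rewrite lee_fin dot_ge0.
  rewrite /= in_itv/= => xI; rewrite lee_fin; apply: le_trans (dot_le_norm _) _.
  by rewrite ler_wpM2l// ler_pXn2r ?nnegrE//; exact: gM.
rewrite integral_cst//= lebesgue_measure_itv/= lte_fin period_gt0 -EFinB subr0 -EFinM//.
Qed.

End L2Bounds.

Section StrongSolution.
Context {R : realType} (m : nat).
Local Notation mu := (@lebesgue_measure R).
Implicit Types u : R -> R -> 'rV[R]_m.

Lemma circle_fun_derive (V : normedModType R) (g g' : R -> V) :
  (forall x : R, is_derive x 1 g (g' x)) -> circle_fun g -> circle_fun g'.
Proof.
move=> dg cg x; have d1 := @is_derive_affine_comp R V g (g' (x + pi *+ 2)) 1 (pi *+ 2) x.
have : is_derive x 1 (fun s => g (1 * s + pi *+ 2)) (1 *: g' (x + pi *+ 2)).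
  by apply: d1; rewrite mul1r; exact: dg.
have -> : (fun s => g (1 * s + pi *+ 2)) = g by apply/funext => s; rewrite mul1r cg.
by rewrite scale1r => d2; exact: is_derive_unique d2 (dg x).
Qed.

Lemma in_L2_continuous (g : R -> 'rV[R]_m) : circle_fun g -> coord_continuous_fun g -> in_L2 g.
Proof.
move=> cg cont; split=> //; first by move=> i; apply: continuous_measurable_fun; exact: cont.
have cg2 : continuous (fun z : R * R => g z.2).
  move=> z; apply: (@continuous_comp _ _ _ snd g); first exact: cvg_snd.
  by have /coord_continuousP := cont; exact.
have [M M0 HM] := bounded_on_rectangle 0 0 0 (pi *+ 2) cg2.
apply: (@le_lt_trans _ _ (m%:R * M ^+ 2 * (pi *+ 2))%:E%E); last exact: ltry.
by apply: sqnorm_L2_le => // x xI; apply: (HM 0 x) => //; rewrite lexx.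
Qed.

Lemma H1_deriv_C1 (g g' : R -> 'rV[R]_m) : (forall x : R, is_derive x 1 g (g' x)) -> circle_fun g ->
  coord_continuous_fun g' -> H1_deriv g g'.
Proof.
move=> dg cg cg'; split=> //.
  exact: in_L2_continuous (circle_fun_derive dg cg) cg'.
move=> x y i xy.
exact: (@ftc_continuous R (fun x => g x 0 i) (fun x => g' x 0 i) x y
  (fun s => is_derive_component i (dg s)) (cg' i) xy).
Qed.

Variable T : R.
Hypothesis T0 : 0 < T.

Let coord_cont (g : R -> R -> 'rV[R]_m) t : continuous (fun z : R * R => g z.1 z.2) ->
  coord_continuous_fun (g t).
Proof.
move=> cg; apply/coord_continuousP.
exact: (@continuous_prod_left R _ (fun z : R * R => g z.1 z.2) t cg).
Qed.

Lemma time_circle_measurable_continuous (g : R -> R -> 'rV[R]_m) :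
  continuous (fun z : R * R => g z.1 z.2) -> (forall t, circle_fun (g t)) ->
  time_circle_measurable T g.
Proof.
move=> cg pg; split=> [t _|i]; first exact: pg.
apply: continuous_measurable_prod; first by apply: measurableX => //; exact: measurable_itv.
move=> z; apply: (@continuous_comp _ _ _ (fun z : R * R => g z.1 z.2) (fun v : 'rV[R]_m => v 0 i)).
  exact: cg.
exact: coord_continuous.
Qed.

Lemma sqnorm_bounded (g : R -> R -> 'rV[R]_m) :
  continuous (fun z : R * R => g z.1 z.2) ->
  exists M : R, forall t, 0 < t < T -> (sqnorm_L2 (g t) <= M%:E)%E.
Proof.
move=> cg; have [M M0 HM] := bounded_on_rectangle 0 T 0 (pi *+ 2) cg.
exists (m%:R * M ^+ 2 * (pi *+ 2)) => t /andP[t0 tT]; apply: sqnorm_L2_le => // x xI.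
by apply: (HM t x) => //; rewrite !ltW.
Qed.

Lemma in_LooL2_continuous (g : R -> R -> 'rV[R]_m) :
  continuous (fun z : R * R => g z.1 z.2) -> (forall t, circle_fun (g t)) -> in_LooL2 T g.
Proof.
move=> cg pg; split; first exact: time_circle_measurable_continuous.
by have [M HM] := sqnorm_bounded cg; exists M; exact: aeW.
Qed.

Lemma in_L2L2_continuous (g : R -> R -> 'rV[R]_m) :
  continuous (fun z : R * R => g z.1 z.2) -> (forall t, circle_fun (g t)) -> in_L2L2 T g.
Proof.
move=> cg pg; split; first exact: time_circle_measurable_continuous.
have [M HM] := sqnorm_bounded cg.
apply: (@le_lt_trans _ _ (\int[mu]_(x in `]0%R, T[) (cst M%:E x))%E).
  apply: le_integral_nonneg => t; first by rewrite sqnorm_L2_ge0.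
  by rewrite /= in_itv/=; exact: HM.
by rewrite integral_cst//= lebesgue_measure_itv/= lte_fin T0 -EFinB subr0 -EFinM ltry.
Qed.

Lemma sqnorm_L2_near (g : R -> R -> 'rV[R]_m) t0 e :
  continuous (fun z : R * R => g z.1 z.2) -> 0 < e ->
  \forall t \near t0, (sqnorm_L2 (fun x => g t x - g t0 x)%R <= e%:E)%E.
Proof.
move=> cg e0; pose B : R := m%:R * (pi *+ 2).
have B0 : 0 <= B by rewrite mulr_ge0// ltW// period_gt0.
pose eta := Num.min 1 (e / (B + 1)).
have eta0 : 0 < eta by rewrite lt_min ltr01 divr_gt0// ltr_wpDl.
have := uniformly_near t0 0 (pi *+ 2) cg eta0; apply: filterS => t H.
apply: le_trans (sqnorm_L2_le (ltW eta0) H) _; rewrite lee_fin mulrAC -/B.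
have h1 : eta ^+ 2 <= eta by rewrite expr2 ger_pMr// ge_min lexx.
have h2 : eta * (B + 1) <= e by rewrite -ler_pdivlMr ?ltr_wpDl// ge_min lexx orbT.
have h3 : 0 <= B * (eta - eta ^+ 2) by rewrite mulr_ge0// subr_ge0.
by have := ltW eta0; lra.
Qed.

(** By the Gauss formula beta(u_x, u_x) is the tangential part of u_xx minus u_xx, and u_t is
    tangent. The equation thus says that the tangential part of u_t - u_xx equals that of the
    control on omega and zero off omega. *)
Lemma strong_solution_C12 (N : set 'rV[R]_m) (omega : set R)
    (u ut ux uxx : R -> R -> 'rV[R]_m) :
  is_submanifold N -> circle_fun omega ->
  C12 u ut ux uxx -> (forall t, circle_fun (u t)) -> (forall t x, N (u t x)) ->
  (forall t x, 0 < t < T -> ~ omega x ->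
     forall z, tangent_space N (u t x) z -> dot (ut t x - uxx t x) z = 0) ->
  in_LooL2 T (fun t x => ut t x - uxx t x) /\
  strong_solution N omega T (fun t x => ut t x - uxx t x) u ut ux uxx.
Proof.
move=> sN po [ct cx cxx c0 c1 c2 c3] pu Nu off.
have pux t : circle_fun (ux t) by apply: circle_fun_derive (pu t) => x; exact: cx.
have puxx t : circle_fun (uxx t) by apply: circle_fun_derive (pux t) => x; exact: cxx.
have put t : circle_fun (ut t).
  move=> x; apply: is_derive_unique (ct t (x + pi *+ 2)) _.
  have -> : (fun s => u s (x + pi *+ 2)) = (fun s => u s x) by apply/funext => s; exact: pu.
  exact: ct.
split.
  apply: in_LooL2_continuous.
    by move=> z; apply: cvgB; [exact: c1|exact: c3].
  by move=> t x; rewrite put puxx.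
split.
- by move=> t x _; exact: Nu.
- by move=> t _; apply: H1_deriv_C1 => //; exact: coord_cont.
- exact: time_circle_measurable_continuous.
- move=> t0 _; apply: cvg_within_filter; apply/fine_cvgP.
  have H e : 0 < e -> \forall t \near t0, (0 <= sqnorm_L2 (fun x => u t x - u t0 x)%R +
      sqnorm_L2 (fun x => ux t x - ux t0 x)%R <= e%:E)%E.
    move=> e0; have e2 : 0 < e / 2 by rewrite divr_gt0.
    apply: filterS2 (sqnorm_L2_near t0 c0 e2) (sqnorm_L2_near t0 c2 e2) => t h1 h2.
    rewrite adde_ge0 ?sqnorm_L2_ge0//=.
    by apply: le_trans (leeD h1 h2) _; rewrite -EFinD lee_fin; lra.
  split.
    apply: filterS (H 1 ltr01) => t /andP[h1 h2].
    by rewrite ge0_fin_numE//; apply: le_lt_trans h2 _; exact: ltry.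
  apply/cvgrPdist_le => e e0; apply: filterS (H e e0) => t /andP[h1 h2].
  rewrite sub0r normrN /= ger0_norm; last exact: fine_ge0.
  by rewrite -lee_fin fineK// ge0_fin_numE//; apply: le_lt_trans h2 _; exact: ltry.
- by apply: aeW => t _; apply: H1_deriv_C1 => //; exact: coord_cont.
- exact: in_L2L2_continuous.
- move=> s t _ st _; apply: aeW => x i.
  apply: (@ftc_continuous_oo R (fun r => u r x 0 i) (fun r => ut r x 0 i)) => //.
    by move=> r; exact: is_derive_component (ct r x).
  move=> r; apply: (@continuous_comp _ _ _ (fun r => ut r x) (fun v : 'rV[R]_m => v 0 i)).
    exact: (@continuous_prod_right R _ (fun z : R * R => ut z.1 z.2) x c1).
  exact: coord_continuous.
- exact: in_L2L2_continuous.
- apply: aeW => -[t x] /= tT.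
  have [r [P [Pi H]]] := submanifold_adapted_retraction sN (Nu t x).
  have nN : \forall y \near x, N (u t y) by exact: (@filterE _ (nbhs x) _ _ (Nu t)).
  have nd : \forall y \near x, is_derive (y : R) 1 (u t) (ux t y).
    exact: (@filterE _ (nbhs x) _ _ (cx t)).
  have [_ _ E] := curve_second_fund_form (Nu t x) H nN nd (cxx t x) erefl.
  have bc : ball (u t x) r (u t x) by apply: ballxx; exact: ret_gt0 H.
  have nNt : \forall s \near t, N (u s x) by exact: (@filterE _ (nbhs t) _ _ (fun s => Nu s x)).
  have utP : ut t x *m P = ut t x.
    by rewrite -(ret_derive_center H); exact: (curve_velocity H (ct t x) nNt bc).
  have sffE : second_fund_form N (u t x) (ux t x) (ux t x) = uxx t x *m P - uxx t x.
    by rewrite -E addrAC subrr add0r.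
  rewrite sffE (tangent_projE (Nu t x) H) mulmxBl utP.
  have [xo|xno] := pselect (omega x).
    rewrite indicE mem_set// scale1r.
    by move: (uxx t x *m P) (ut t x) (uxx t x) => a b c; rewrite [RHS]addrC addrA subrK.
  have /(normal_iff (Nu t x) H) : forall z, tangent_space N (u t x) z -> dot (ut t x - uxx t x) z = 0.
    exact: off.
  rewrite mulmxBl utP => /eqP; rewrite subr_eq0 => /eqP utE.
  by rewrite indicE memNset// scale0r addr0 -utE.
Qed.

End StrongSolution.

(** * Calculus of functions of time and space *)

Section SpaceTime.
Context {R : realType}.

Definition dt (V : normedModType R) (u : R -> R -> V) (t x : R) : V := 'D_1 (fun s => u s x) t.
Definition dx (V : normedModType R) (u : R -> R -> V) (t x : R) : V := 'D_1 (u t) x.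
(** Using the canonical derivatives makes this a predicate on u alone, stable under the operations
    below without displaying the derivatives. *)
Definition class12 (V : normedModType R) (u : R -> R -> V) : Prop := C12 u (dt u) (dx u) (dx (dx u)).

Lemma C12_derivs (V : normedModType R) (u ut ux uxx : R -> R -> V) : C12 u ut ux uxx ->
  [/\ class12 u, dt u = ut, dx u = ux & dx (dx u) = uxx].
Proof.
move=> H; have [ct cx cxx c0 c1 c2 c3] := H.
have et : dt u = ut by apply/funext => t; apply/funext => x; case: (ct t x).
have ex : dx u = ux by apply/funext => t; apply/funext => x; case: (cx t x).
have exx : dx (dx u) = uxx by rewrite ex; apply/funext => t; apply/funext => x; case: (cxx t x).
by split=> //; rewrite /class12 exx et ex.
Qed.

Lemma C12_class12 (V : normedModType R) (u ut ux uxx : R -> R -> V) : C12 u ut ux uxx -> class12 u.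
Proof. by move=> /C12_derivs[]. Qed.

Definition agree (V : normedModType R) (u v : R -> R -> V) : set (R * R) :=
  [set z | u z.1 z.2 = v z.1 z.2].

Lemma agree_right (V : normedModType R) (u v : R -> R -> V) (t x : R) : nbhs (t, x) (agree u v) ->
  \forall s \near t, u s x = v s x.
Proof. exact: (@pair_right_continuous R x t (agree u v)). Qed.

Lemma agree_left (V : normedModType R) (u v : R -> R -> V) (t x : R) : nbhs (t, x) (agree u v) ->
  \forall y \near x, u t y = v t y.
Proof. exact: (@pair_left_continuous R t x (agree u v)). Qed.

Lemma agree_dt (V : normedModType R) (u v : R -> R -> V) (z : R * R) :
  nbhs z (agree u v) -> nbhs z (agree (dt u) (dt v)).
Proof.
move/nbhs_interior; apply: filterS => -[t x] /agree_right H.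
exact: near_eq_derive.
Qed.

Lemma agree_dx (V : normedModType R) (u v : R -> R -> V) (z : R * R) :
  nbhs z (agree u v) -> nbhs z (agree (dx u) (dx v)).
Proof.
move/nbhs_interior; apply: filterS => -[t x] /agree_left H.
exact: near_eq_derive.
Qed.

Lemma continuous_near_eq (T : topologicalType) (V : normedModType R) (f g : T -> V) (x : T) :
  (\forall y \near x, f y = g y) -> {for x, continuous g} -> {for x, continuous f}.
Proof.
move=> fg cg; apply/cvgrPdist_le => e e0; rewrite (nbhs_singleton fg).
by move/cvgrPdist_le: cg => /(_ e e0); apply: filterS2 fg => y ->.
Qed.

(** Regularity and derivatives depend only on the germ at each point. Trajectories defined by cases,
    across the cut of the circle or at a switching time, are handled by exhibiting near each point a
    regular function that agrees with them. *)
Lemma class12_local (V : normedModType R) (u : R -> R -> V) :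
  (forall z : R * R, exists2 v, class12 v & nbhs z (agree u v)) -> class12 u.
Proof.
move=> H; split.
- move=> t x; have [v [ct _ _ _ _ _ _] uv] := H (t, x).
  rewrite (nbhs_singleton (agree_dt uv) : dt u t x = _); apply: near_eq_is_derive (ct t x).
  by move/agree_right: uv; apply: filterS => s ->.
- move=> t x; have [v [_ cx _ _ _ _ _] uv] := H (t, x).
  rewrite (nbhs_singleton (agree_dx uv) : dx u t x = _); apply: near_eq_is_derive (cx t x).
  by move/agree_left: uv; apply: filterS => s ->.
- move=> t x; have [v [_ _ cx _ _ _ _] /agree_dx uv] := H (t, x).
  rewrite (nbhs_singleton (agree_dx uv) : dx (dx u) t x = _); apply: near_eq_is_derive (cx t x).
  by move/agree_left: uv; apply: filterS => s ->.
- move=> z; have [v [_ _ _ c _ _ _] uv] := H z.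
  by apply: continuous_near_eq (c z).
- move=> z; have [v [_ _ _ _ c _ _] /agree_dt uv] := H z.
  by apply: continuous_near_eq (c z).
- move=> z; have [v [_ _ _ _ _ c _] /agree_dx uv] := H z.
  by apply: continuous_near_eq (c z).
- move=> z; have [v [_ _ _ _ _ _ c] /agree_dx/agree_dx uv] := H z.
  by apply: continuous_near_eq (c z).
Qed.

Lemma class12_add (V : normedModType R) (u v : R -> R -> V) :
  class12 u -> class12 v -> class12 (fun t x => u t x + v t x).
Proof.
move=> [ct cx cxx c0 c1 c2 c3] [ct' cx' cxx' c0' c1' c2' c3'].
apply: (@C12_class12 V (fun t x => u t x + v t x) (fun t x => dt u t x + dt v t x)
  (fun t x => dx u t x + dx v t x) (fun t x => dx (dx u) t x + dx (dx v) t x)).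
split.
- by move=> t x; exact: (is_deriveD (ct t x) (ct' t x)).
- by move=> t x; exact: (is_deriveD (cx t x) (cx' t x)).
- by move=> t x; exact: (is_deriveD (cxx t x) (cxx' t x)).
- by move=> z; apply: cvgD; [exact: c0|exact: c0'].
- by move=> z; apply: cvgD; [exact: c1|exact: c1'].
- by move=> z; apply: cvgD; [exact: c2|exact: c2'].
- by move=> z; apply: cvgD; [exact: c3|exact: c3'].
Qed.

Lemma C12_shift (V : normedModType R) (u : R -> R -> V) (a b : R) : class12 u ->
  C12 (fun t x => u (t + a) (x + b)) (fun t x => dt u (t + a) (x + b))
    (fun t x => dx u (t + a) (x + b)) (fun t x => dx (dx u) (t + a) (x + b)).
Proof.
move=> [ct cx cxx c0 c1 c2 c3].
have sh (f : R -> V) (f' : V) (c s : R) : is_derive (s + c) 1 f f' -> is_derive s 1 (fun r => f (r + c)) f'.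
  move=> df; have := @is_derive_affine_comp R V f f' 1 c s.
  rewrite mul1r scale1r => /(_ df).
  by have -> : (fun r => f (1 * r + c)) = (fun r => f (r + c)) by apply/funext => r; rewrite mul1r.
have cs (f : R * R -> V) : continuous f -> continuous (fun z : R * R => f (z.1 + a, z.2 + b)).
  move=> cf z; apply: (@continuous_comp _ _ _ (fun z : R * R => (z.1 + a, z.2 + b)) f); last exact: cf.
  apply: (@cvg_pair _ _ _ _ (nbhs (z.1 + a)) (nbhs (z.2 + b))).
    by apply: cvgD; [exact: cvg_fst|exact: cvg_cst].
  by apply: cvgD; [exact: cvg_snd|exact: cvg_cst].
split.
- by move=> t x; exact: (sh (fun s => u s (x + b)) _ a t (ct (t + a) (x + b))).
- by move=> t x; exact: (sh (u (t + a)) _ b x (cx (t + a) (x + b))).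
- by move=> t x; exact: (sh (dx u (t + a)) _ b x (cxx (t + a) (x + b))).
- exact: cs c0.
- exact: cs c1.
- exact: cs c2.
- exact: cs c3.
Qed.

Lemma class12_shift (V : normedModType R) (u : R -> R -> V) (a b : R) :
  class12 u -> class12 (fun t x => u (t + a) (x + b)).
Proof. by move=> /(C12_shift a b)/C12_class12. Qed.

Lemma continuous_static (V : normedModType R) (g : R -> V) :
  continuous g -> continuous (fun z : R * R => g z.2).
Proof.
by move=> cg z; apply: (@continuous_comp _ _ _ snd g); [exact: cvg_snd|exact: cg].
Qed.

Lemma class12_static (V : normedModType R) (g g' g'' : R -> V) :
  (forall x : R, is_derive x 1 g (g' x)) -> (forall x : R, is_derive x 1 g' (g'' x)) ->
  continuous g'' -> class12 (fun _ x => g x).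
Proof.
move=> d1 d2 c; apply: (@C12_class12 V (fun t x => g x) (fun t x => 0)
  (fun t x => g' x) (fun t x => g'' x)).
split.
- by move=> t x; exact: is_derive_cst.
- by move=> t x; exact: d1.
- by move=> t x; exact: d2.
- exact: (@continuous_static V g (fun x => is_derive_continuous (d1 x))).
- by move=> z; exact: cvg_cst.
- exact: (@continuous_static V g' (fun x => is_derive_continuous (d2 x))).
- exact: (@continuous_static V g'' c).
Qed.

Lemma class12_freeze (V : normedModType R) (u : R -> R -> V) (t0 : R) :
  class12 u -> class12 (fun _ x => u t0 x).
Proof.
move=> [ct cx cxx c0 c1 c2 c3].
apply: (@class12_static V (u t0) _ _ (cx t0) (cxx t0)).
exact: (@continuous_prod_left R V (fun z : R * R => dx (dx u) z.1 z.2) t0 c3).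
Qed.

Lemma class12_cst (V : normedModType R) (c : V) : class12 (fun _ _ => c).
Proof.
by apply: (@class12_static V (cst c) (cst 0) (cst 0)) => x; exact: cvg_cst.
Qed.

Lemma class12_time (th th' : R -> R) : (forall t : R, is_derive t 1 th (th' t)) -> continuous th' ->
  class12 (fun t _ => th t).
Proof.
move=> d1 c1; apply: (@C12_class12 R (fun t x => th t) (fun t x => th' t)
  (fun t x => 0) (fun t x => 0)).
have ct (f : R -> R) : continuous f -> continuous (fun z : R * R => f z.1).
  by move=> cf z; apply: (@continuous_comp _ _ _ fst f); [exact: cvg_fst|exact: cf].
split.
- by move=> t x; exact: d1.
- by move=> t x; exact: is_derive_cst.
- by move=> t x; exact: is_derive_cst.
- exact: (ct th (fun t => is_derive_continuous (d1 t))).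
- exact: (ct th' c1).
- by move=> z; exact: cvg_cst.
- by move=> z; exact: cvg_cst.
Qed.

Lemma is_derive_mul (f g : R -> R) (f' g' s : R) : is_derive s 1 f f' -> is_derive s 1 g g' ->
  is_derive s 1 (fun t => f t * g t) (f' * g s + f s * g').
Proof.
move=> df dg; have := is_deriveM df dg.
by rewrite /GRing.scale /= addrC [g s * f']mulrC.
Qed.

Lemma class12_mul (u v : R -> R -> R) :
  class12 u -> class12 v -> class12 (fun t x => u t x * v t x).
Proof.
move=> [ct cx cxx c0 c1 c2 c3] [ct' cx' cxx' c0' c1' c2' c3'].
apply: (@C12_class12 R (fun t x => u t x * v t x)
  (fun t x => dt u t x * v t x + u t x * dt v t x)
  (fun t x => dx u t x * v t x + u t x * dx v t x)
  (fun t x => (dx (dx u) t x * v t x + dx u t x * dx v t x) +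
              (dx u t x * dx v t x + u t x * dx (dx v) t x))).
have cm (f g : R * R -> R) : continuous f -> continuous g -> continuous (fun z => f z * g z).
  by move=> cf cg z; apply: cvgM; [exact: cf|exact: cg].
have ca (f g : R * R -> R) : continuous f -> continuous g -> continuous (fun z => f z + g z).
  by move=> cf cg z; apply: cvgD; [exact: cf|exact: cg].
split.
- by move=> t x; exact: is_derive_mul (ct t x) (ct' t x).
- by move=> t x; exact: is_derive_mul (cx t x) (cx' t x).
- move=> t x; apply: is_deriveD; first exact: is_derive_mul (cxx t x) (cx' t x).
  exact: is_derive_mul (cx t x) (cxx' t x).
- exact: cm c0 c0'.
- by apply: ca; [exact: cm c1 c0'|exact: cm c0 c1'].
- by apply: ca; [exact: cm c2 c0'|exact: cm c0 c2'].
- exact: (ca _ _ (ca _ _ (cm _ _ c3 c0') (cm _ _ c2 c2')) (ca _ _ (cm _ _ c2 c2') (cm _ _ c0 c3'))).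
Qed.

Lemma is_derive_curve_comp (V : normedModType R) (y : R -> R) (sg : R -> V) (y' s : R) (sg' : V) :
  is_derive s 1 y y' -> is_derive (y s) 1 sg sg' -> is_derive s 1 (fun t => sg (y t)) (y' *: sg').
Proof.
move=> dy dsg; have dsg' : differentiable sg (y s) by apply/derivable1_diffP; case: dsg.
have := is_derive_comp_diff dy dsg'.
have -> : 'D_y' sg (y s) = y' *: sg'; last by [].
have -> : 'D_y' sg (y s) = 'D_(y' *: (1 : R)) sg (y s) by rewrite /GRing.scale /= mulr1.
rewrite deriveZ_dir//.
by congr (_ *: _); case: dsg.
Qed.

Lemma coord_continuous_into (T : topologicalType) m (f : T -> 'rV[R]_m) :
  (forall i, continuous (fun z => f z 0 i)) -> continuous f.
Proof.
move=> H z; apply/cvgrPdist_le => e e0.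
have : \forall y \near z, forall i, `|f z 0 i - f y 0 i| <= e.
  by apply: near_forall => i; move/cvgrPdist_le: (H i z); exact.
by apply: filterS => y Hy; apply: row_norm_le => [|i]; [exact: ltW|rewrite !mxE; exact: Hy].
Qed.

Lemma continuous_bigsum (T : topologicalType) (V : normedModType R) (I : Type) (r : seq I)
    (F : I -> T -> V) (z : T) :
  (forall i, {for z, continuous (F i)}) -> {for z, continuous (fun y => \sum_(i <- r) F i y)}.
Proof.
move=> cF; elim: r => [|i r IH].
  have -> : (fun y => \sum_(i <- [::]) F i y) = cst 0 by apply/funext => y; rewrite big_nil.
  exact: cvg_cst.
have -> : (fun y => \sum_(j <- i :: r) F j y) = (fun y => F i y + \sum_(j <- r) F j y).
  by apply/funext => y; rewrite big_cons.
by apply: cvgD; [exact: cF|exact: IH].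
Qed.

Variable m : nat.

Lemma continuous_scale (f : R * R -> R) (g : R * R -> 'rV[R]_m) :
  continuous f -> continuous g -> continuous (fun z => f z *: g z).
Proof. by move=> cf cg z; apply: cvgZ; [exact: cf|exact: cg]. Qed.

Section Curve.
Variables (y : R -> R -> R) (sg sg' sg'' : R -> 'rV[R]_m).
Hypotheses (cy : class12 y) (d1 : forall s : R, is_derive s 1 sg (sg' s))
  (d2 : forall s : R, is_derive s 1 sg' (sg'' s)) (c2 : continuous sg'').

Lemma C12_curve : C12 (fun t x => sg (y t x)) (fun t x => dt y t x *: sg' (y t x))
  (fun t x => dx y t x *: sg' (y t x))
  (fun t x => dx (dx y) t x *: sg' (y t x) + dx y t x *: (dx y t x *: sg'' (y t x))).
Proof.
have [yt yx yxx y0 y1 y2 y3] := cy.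
have cc (f : R -> 'rV[R]_m) : continuous f -> continuous (fun z : R * R => f (y z.1 z.2)).
  move=> cf z; apply: (@continuous_comp _ _ _ (fun z : R * R => y z.1 z.2) f); first exact: y0.
  exact: cf.
have c0 : continuous sg by move=> s; exact: is_derive_continuous (d1 s).
have c1 : continuous sg' by move=> s; exact: is_derive_continuous (d2 s).
split.
- by move=> t x; exact: is_derive_curve_comp (yt t x) (d1 _).
- by move=> t x; exact: is_derive_curve_comp (yx t x) (d1 _).
- move=> t x; exact: (@is_derive_scale R m (dx y t) (fun x => sg' (y t x)) _ _ x (yxx t x)
    (is_derive_curve_comp (yx t x) (d2 _))).
- exact: cc c0.
- exact: continuous_scale y1 (cc _ c1).
- exact: continuous_scale y2 (cc _ c1).
- move=> z; apply: cvgD; first exact: (continuous_scale y3 (cc _ c1)).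
  exact: (continuous_scale y2 (continuous_scale y2 (cc _ c2))).
Qed.

Lemma class12_curve : class12 (fun t x => sg (y t x)).
Proof. by have [] := C12_derivs C12_curve. Qed.

End Curve.

Lemma continuous_dir (G : 'rV[R]_m -> 'rV[R]_m) (c v : R * R -> 'rV[R]_m) : smooth_on setT G ->
  continuous c -> continuous v -> continuous (fun z => 'D_(v z) G (c z)).
Proof.
move=> sG cc cv.
have -> : (fun z => 'D_(v z) G (c z)) = (fun z => \sum_i v z 0 i *: 'D_(delta_mx 0 i) G (c z)).
  by apply/funext => z; rewrite derive_rV_dir//; exact: smooth_on_diff sG I.
move=> z0; apply: continuous_bigsum => i; move: z0; apply: continuous_scale => z.
  apply: (@continuous_comp _ _ _ v (fun w : 'rV[R]_m => w 0 i)); first exact: cv.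
  exact: coord_continuous.
apply: (@continuous_comp _ _ _ c ('D_(delta_mx 0 i) G)); first exact: cc.
exact: (smooth_on_continuous (smooth_on_derive _ sG) I).
Qed.

Lemma class12_smooth (G : 'rV[R]_m -> 'rV[R]_m) (a : R -> R -> 'rV[R]_m) :
  smooth_on setT G -> class12 a -> class12 (fun t x => G (a t x)).
Proof.
move=> sG [ct cx cxx c0 c1 c2 c3].
have dG q : differentiable G q by exact: smooth_on_diff sG I.
apply: (@C12_class12 _ (fun t x => G (a t x)) (fun t x => 'D_(dt a t x) G (a t x))
  (fun t x => 'D_(dx a t x) G (a t x))
  (fun t x => 'D_(dx (dx a) t x) G (a t x) + 'D_(dx a t x) ('D_(dx a t x) G) (a t x))).
split.
- by move=> t x; exact: is_derive_comp_diff (ct t x) (dG _).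
- by move=> t x; exact: is_derive_comp_diff (cx t x) (dG _).
- by move=> t x; exact: (is_derive_dir_along openT sG I (cx t x) (cxx t x)).
- move=> z; apply: (@continuous_comp _ _ _ (fun z : R * R => a z.1 z.2) G); first exact: c0.
  exact: (smooth_on_continuous sG I).
- exact: continuous_dir sG c0 c1.
- exact: continuous_dir sG c0 c2.
- suff c4 : continuous (fun z : R * R => 'D_(dx a z.1 z.2) ('D_(dx a z.1 z.2) G) (a z.1 z.2)).
    by move=> z; apply: cvgD; [exact: (continuous_dir sG c0 c3)|exact: c4].
  have -> : (fun z : R * R => 'D_(dx a z.1 z.2) ('D_(dx a z.1 z.2) G) (a z.1 z.2)) =
    (fun z => \sum_i dx a z.1 z.2 0 i *: 'D_(dx a z.1 z.2) ('D_(delta_mx 0 i) G) (a z.1 z.2)).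
    by apply/funext => y; exact: (derive_sum_coord _ _ openT sG I).
  move=> z0; apply: continuous_bigsum => i; move: z0; apply: continuous_scale => z.
    apply: (@continuous_comp _ _ _ (fun z : R * R => dx a z.1 z.2) (fun w : 'rV[R]_m => w 0 i)); first exact: c2.
    exact: coord_continuous.
  exact: continuous_dir (smooth_on_derive _ sG) c0 c2 z.
Qed.

Lemma class12_scale (f : R -> R -> R) (a : R -> R -> 'rV[R]_m) :
  class12 f -> class12 a -> class12 (fun t x => f t x *: a t x).
Proof.
move=> [ct cx cxx c0 c1 c2 c3] [ct' cx' cxx' c0' c1' c2' c3'].
apply: (@C12_class12 _ (fun t x => f t x *: a t x)
  (fun t x => dt f t x *: a t x + f t x *: dt a t x)
  (fun t x => dx f t x *: a t x + f t x *: dx a t x)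
  (fun t x => (dx (dx f) t x *: a t x + dx f t x *: dx a t x) +
              (dx f t x *: dx a t x + f t x *: dx (dx a) t x))).
have ca (f1 f2 : R * R -> 'rV[R]_m) : continuous f1 -> continuous f2 -> continuous (fun z => f1 z + f2 z).
  by move=> cf cg z; apply: cvgD; [exact: cf|exact: cg].
split.
- by move=> t x; exact: is_derive_scale (ct t x) (ct' t x).
- by move=> t x; exact: is_derive_scale (cx t x) (cx' t x).
- move=> t x; exact: (is_deriveD (@is_derive_scale R m (dx f t) (a t) _ _ x (cxx t x) (cx' t x))
    (@is_derive_scale R m (f t) (dx a t) _ _ x (cx t x) (cxx' t x))).
- exact: continuous_scale c0 c0'.
- exact: (ca _ _ (continuous_scale c1 c0') (continuous_scale c0 c1')).
- exact: (ca _ _ (continuous_scale c2 c0') (continuous_scale c0 c2')).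
- exact: (ca _ _ (ca _ _ (continuous_scale c3 c0') (continuous_scale c2 c2'))
    (ca _ _ (continuous_scale c2 c2') (continuous_scale c0 c3'))).
Qed.

End SpaceTime.

(** * Reachability *)

Section Wrap.
Context {R : realType} (xs : R).

(* [centered x] is the representative of [x - xs] modulo 2 pi in [-pi, pi). *)
Definition turn (x : R) : int := Num.floor ((x - xs + pi) / (pi *+ 2)).
Definition centered (x : R) : R := x - xs - (turn x)%:~R * (pi *+ 2).

Lemma turn_eq (x : R) (k : int) :
  - pi <= x - xs - k%:~R * (pi *+ 2) < pi -> turn x = k.
Proof.
move=> /andP[h1 h2]; apply: floor_def; have p0 := @period_gt0 R.
apply/andP; split; first by rewrite ler_pdivlMr//; lra.
by rewrite ltr_pdivrMr// intrD mulrDl mul1r; move: h2; rewrite mulr2n; lra.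
Qed.

Lemma wrap_bound (x : R) : - pi <= centered x < pi.
Proof.
have p0 := @period_gt0 R.
have := floor_itv ((x - xs + pi) / (pi *+ 2)).
rewrite -/(turn x) => /andP[]; rewrite ler_pdivlMr// ltr_pdivrMr// intrD mulrDl mul1r.
by rewrite /centered mulr2n => h1 h2; apply/andP; split; lra.
Qed.

Lemma wrap_eq (x : R) (k : int) :
  - pi <= x - xs - k%:~R * (pi *+ 2) < pi -> centered x = x - xs - k%:~R * (pi *+ 2).
Proof. by rewrite /centered => /turn_eq ->. Qed.

Lemma wrap_period : circle_fun centered.
Proof.
move=> x; rewrite (@wrap_eq _ (turn x + 1)); last first.
  have := wrap_bound x; rewrite /centered intrD mulrDl mul1r.
  by move=> /andP[h1 h2]; apply/andP; split; lra.
by rewrite intrD mulrDl mul1r /centered; ring.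
Qed.

Lemma circle_fun_int (V : Type) (g : R -> V) (x : R) (k : int) :
  circle_fun g -> g (x + k%:~R * (pi *+ 2)) = g x.
Proof.
move=> pg; have nat_case (n : nat) y : g (y + n%:R * (pi *+ 2)) = g y.
  elim: n => [|n IH]; first by rewrite mul0r addr0.
  by rewrite -natr1 mulrDl mul1r addrA pg.
have [n|n] := ltP 0 k; last first.
  have -> : k = - (`|k|%N : int) by rewrite -[LHS]opprK -(ler0_norm n) abszE.
  by rewrite -(nat_case `|k|%N (x + _)) mulrNz mulNr subrK.
have -> : k = (`|k|%N : int) by rewrite abszE gtr0_norm.
exact: nat_case.
Qed.

Lemma circle_wrap (V : Type) (g : R -> V) (x : R) : circle_fun g -> g (xs + centered x) = g x.
Proof.
move=> pg; rewrite -(circle_fun_int (xs + centered x) (turn x) pg) /centered.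
by congr (g _); ring.
Qed.

Lemma wrap_near (x : R) : `|centered x| < pi ->
  \forall y \near x, centered y = y + (- xs - (turn x)%:~R * (pi *+ 2)).
Proof.
rewrite ltr_norml => /andP[h1 h2].
have c : {for x, continuous (fun y => y - xs - (turn x)%:~R * (pi *+ 2))}.
  by apply: cvgB; [apply: cvgB; [exact: cvg_id|exact: cvg_cst]|exact: cvg_cst].
have n1 : \forall y \near x, - pi < y - xs - (turn x)%:~R * (pi *+ 2) by exact: (cvgr_gt _ c).
have n2 : \forall y \near x, y - xs - (turn x)%:~R * (pi *+ 2) < pi by exact: (cvgr_lt _ c).
apply: filterS2 n1 n2 => y a b; rewrite addrA; apply: wrap_eq.
by rewrite b ltW.
Qed.

(** [centered] jumps between pi and - pi at the cut, but its absolute value stays close to pi. *)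
Lemma wrap_near_cut (x e : R) : 0 < e -> pi <= `|centered x| ->
  \forall y \near x, pi - e <= `|centered y|.
Proof.
move=> e0 wx; have := wrap_bound x => /andP[h1 h2].
have {wx} wx : centered x = - pi.
  by move: wx; rewrite ler_normr => /orP[|]; lra.
have : \forall y \near x, `|x - y| < e by exact: nbhsx_ballx.
apply: filterS => y; rewrite ltr_norml => /andP[d1 d2].
rewrite leNgt ltr_norml; apply/negP => /andP[w1 w2].
pose n : int := turn x - turn y.
have E : centered y - centered x = (y - x) + n%:~R * (pi *+ 2).
  by rewrite /centered /n intrB mulrBl; ring.
rewrite wx in E.
have p0 := @period_gt0 R.
have a1 : 0 < n%:~R * (pi *+ 2) :> R by lra.
have a2 : n%:~R * (pi *+ 2) < 1 * (pi *+ 2) :> R by rewrite mul1r; lra.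
move: a1 a2; rewrite pmulr_lgt0// ltr_pM2r// ltr0z ltrz1.
by lia.
Qed.

End Wrap.

Section Residual.
Context {R : realType} (m : nat) (N : set 'rV[R]_m).
Implicit Types u v : R -> R -> 'rV[R]_m.

(** For u with values in N, u_t is tangent, so this is the uncontrolled harmonic map heat flow at
    (t, x). *)
Definition normal_at u (t x : R) : Prop :=
  forall z, tangent_space N (u t x) z -> dot (dt u t x - dx (dx u) t x) z = 0.

Lemma normal_at_agree u v (t x : R) :
  nbhs (t, x) (agree u v) -> normal_at v t x -> normal_at u t x.
Proof.
move=> uv H z; have e0 : u t x = v t x := nbhs_singleton uv.
have e1 : dt u t x = dt v t x := nbhs_singleton (agree_dt uv).
have e2 : dx (dx u) t x = dx (dx v) t x := nbhs_singleton (agree_dx (agree_dx uv)).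
by rewrite e0 e1 e2; exact: H.
Qed.

Lemma normal_at_shift u (a b t x : R) : class12 u -> normal_at u (t + a) (x + b) ->
  normal_at (fun t x => u (t + a) (x + b)) t x.
Proof.
move=> cu H; have [_ e1 _ e2] := C12_derivs (C12_shift a b cu).
by rewrite /normal_at e1 e2.
Qed.

Lemma normal_at_curve (y : R -> R -> R) (sg sg' sg'' : R -> 'rV[R]_m) (t x : R) : class12 y ->
  (forall s : R, is_derive s 1 sg (sg' s)) -> (forall s : R, is_derive s 1 sg' (sg'' s)) ->
  continuous sg'' -> dt y t x = dx (dx y) t x ->
  (forall z, tangent_space N (sg (y t x)) z -> dot (sg'' (y t x)) z = 0) ->
  normal_at (fun t x => sg (y t x)) t x.
Proof.
move=> cy d1 d2 c2 hy H; have [_ e1 _ e2] := C12_derivs (C12_curve cy d1 d2 c2).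
move=> z Tz; rewrite e1 e2 hy opprD addrA subrr add0r scalerA -scaleNr.
rewrite /dot; under eq_bigr do rewrite mxE -mulrA.
by rewrite -mulr_sumr -/(dot _ _) H// mulr0.
Qed.

Lemma normal_at_cst (c : 'rV[R]_m) (t x : R) : normal_at (fun _ _ => c) t x.
Proof.
move=> z _; rewrite /dt /dx !derive_cst.
have -> : ('D_1 (fun=> c) : R -> 'rV[R]_m) = cst 0 by apply/funext => y; rewrite derive_cst.
by rewrite derive_cst subrr /dot big1// => i _; rewrite mxE mul0r.
Qed.

End Residual.

Section Periodize.
Context {R : realType} (m : nat) (N : set 'rV[R]_m) (xs : R).
Implicit Types v w : R -> R -> 'rV[R]_m.

Let near_snd (P : R -> Prop) (z : R * R) : (\forall y \near z.2, P y) -> nbhs z (fun y : R * R => P y.2).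
Proof. by move=> H; exact: (cvg_snd H). Qed.

Lemma periodized_agree v (t x : R) : `|centered xs x| < pi -> exists b, centered xs x = x + b /\
  nbhs (t, x) (agree (fun t x => v t (centered xs x)) (fun t x => v (t + 0) (x + b))).
Proof.
move=> wx; exists (- xs - (turn xs x)%:~R * (pi *+ 2)); split.
  by rewrite /centered addrA.
have := @near_snd _ (t, x) (wrap_near wx); apply: filterS => -[s y] /= E.
by rewrite /agree /= addr0 E.
Qed.

(** v is a function on the line; its agreement with a periodic w in a collar of |y| = pi is what
    removes the discontinuity of [centered]. *)
Lemma class12_periodized v w (e : R) : 0 < e -> class12 v -> class12 w ->
  (forall t, circle_fun (w t)) -> (forall t y, pi - e <= `|y| -> v t y = w t y) ->
  class12 (fun t x => v t (centered xs x)).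
Proof.
move=> e0 cv cw pw vw; apply: class12_local => -[t x].
have [wx|wx] := ltP `|centered xs x| pi.
  have [b [_ H]] := @periodized_agree v t x wx.
  by exists (fun t x => v (t + 0) (x + b)); [exact: class12_shift 0 b cv|exact: H].
exists (fun t x => w (t + 0) (x + - xs)); first exact: class12_shift 0 (- xs) cw.
have := @near_snd _ (t, x) (wrap_near_cut e0 wx); apply: filterS => -[s y] /= E.
have pws : circle_fun (fun y => w s (y - xs)) by move=> r; rewrite addrAC pw.
by rewrite /agree /= addr0 (vw _ _ E) -[RHS](circle_wrap xs y pws) addrAC subrr add0r.
Qed.

Lemma normal_at_periodized v (t x : R) : class12 v -> `|centered xs x| < pi ->
  normal_at N v t (centered xs x) -> normal_at N (fun t x => v t (centered xs x)) t x.
Proof.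
move=> cv wx H; have [b [E A]] := @periodized_agree v t x wx.
apply: normal_at_agree A _; apply: (@normal_at_shift R m N v 0 b t x cv).
by rewrite addr0 -E.
Qed.

End Periodize.

(** * Admissible trajectories and their concatenation *)

Section Reach.
Context {R : realType} (m : nat) (N : set 'rV[R]_m) (omega : set R).
Implicit Types (u : R -> R -> 'rV[R]_m) (g h k : R -> 'rV[R]_m).

Record admissible u : Prop := {
  adm_class12 : class12 u;
  adm_circle : forall t, circle_fun (u t);
  adm_target : forall t x, N (u t x);
  adm_normal : forall t x, ~ omega x -> normal_at N u t x }.

(** Trajectories exist for all real times and rest outside [0, T], so switching from one to the next
    preserves the class C^(1,2). *)
Definition reach_at (T : R) g h : Prop := exists2 u, admissible u &
  (forall t x, t <= 0 -> u t x = g x) /\ (forall t x, T <= t -> u t x = h x).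

Definition reach g h : Prop := forall T : R, 0 < T -> reach_at T g h.

Lemma reach_at_trans (T : R) g h k : 0 < T ->
  reach_at (T / 3) g h -> reach_at (T / 3) h k -> reach_at T g k.
Proof.
move=> T0 [u [cu pu Nu nu] [ug uh]] [v [cv pv Nv nv] [vh vk]].
(* The middle third is a rest at h: there both trajectories coincide, so near every time the
   concatenation agrees with one of them. *)
pose v' t x := v (t + - (2 * (T / 3))) (x + 0).
have cv' : class12 v' by exact: class12_shift.
pose w t x := if t <= T / 2 then u t x else v (t - 2 * (T / 3)) x.
have wu t x : t < 2 * (T / 3) -> w t x = u t x.
  by move=> tT; rewrite /w; case: leP => // t2; rewrite uh ?vh//; lra.
have wv t x : T / 3 < t -> w t x = v' t x.
  by move=> tT; rewrite /w /v' addr0; case: leP => // t2; rewrite uh ?vh//; lra.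
have nfst (P : R -> Prop) (z : R * R) : (\forall s \near z.1, P s) -> nbhs z (fun y : R * R => P y.1).
  by move=> H; exact: (cvg_fst H).
have local (t x : R) : (t < 2 * (T / 3) /\ nbhs (t, x) (agree w u)) \/ nbhs (t, x) (agree w v').
  have [tT|tT] := ltP t (2 * (T / 3)); [left; split=> //|right].
    have := @nfst _ (t, x) (lt_nbhsl tT); apply: filterS => -[s y] /= sT; exact: wu.
  have tT' : T / 3 < t by lra.
  have := @nfst _ (t, x) (lt_nbhsr tT'); apply: filterS => -[s y] /= sT; exact: wv.
exists w; last by split=> t x tT; [rewrite wu ?ug//; lra|rewrite wv /v' ?addr0 ?vk//; lra].
split.
- apply: class12_local => -[t x].
  by have [[_ H]|H] := local t x; [exists u|exists v'].
- by move=> t x; rewrite /w; case: ifP => _; [exact: pu|exact: pv].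
- by move=> t x; rewrite /w; case: ifP => _; [exact: Nu|exact: Nv].
- move=> t x ox; have [[_ H]|H] := local t x; first exact: normal_at_agree H (nu t x ox).
  apply: normal_at_agree H _; apply: normal_at_shift cv _; apply: nv.
  by rewrite addr0.
Qed.

Lemma reach_trans g h k : reach g h -> reach h k -> reach g k.
Proof.
move=> gh hk T T0; have a0 : 0 < T / 3 by rewrite divr_gt0.
exact: reach_at_trans T0 (gh _ a0) (hk _ a0).
Qed.

End Reach.

Section Profiles.
Context {R : realType}.

Lemma step_exists : exists (d d1 d2 : R -> R), [/\ forall t : R, is_derive t 1 d (d1 t),
  forall t : R, is_derive t 1 d1 (d2 t), continuous d2,
  (forall t, t <= 0 -> d t = 0) /\ (forall t, 1 <= t -> d t = 1) &
  forall t, 0 <= d t <= 1].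
Proof.
have [d [dd d0 d1 d01 _]] := gevrey_step (ltr01 : 0 < 1 :> R).
exists (d 0%N), (d 1%N), (d 2%N); split=> //.
- by move=> t; exact: is_derive_scalar_continuous (dd 2%N t).
- by split=> t t0; [exact: d0|have [] := d1 t t0].
Qed.

Lemma cutoff_exists (a b : R) : a < b -> exists2 chi : R -> R, class12 (fun _ y => chi y) &
  [/\ forall y, `|y| <= a -> chi y = 1, forall y, b <= `|y| -> chi y = 0 &
      forall y, 0 <= chi y <= 1].
Proof.
move=> ab; have [d [d1 [d2 [D1 D2 c2 [d0 d1' ] d01]]]] := step_exists.
have e0 : 0 < b - a by rewrite subr_gt0.
have aff (k : R) : class12 (fun _ y => d (k * y + b / (b - a))).
  apply: (@class12_static R R (fun y => d (k * y + b / (b - a)))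
    (fun y => k *: d1 (k * y + b / (b - a))) (fun y => k *: (k *: d2 (k * y + b / (b - a))))).
  - by move=> y; exact: is_derive_affine_comp (D1 _).
  - move=> y; apply: (@is_deriveZ R R R (fun y => d1 (k * y + b / (b - a))) k y 1 (k *: d2 (k * y + b / (b - a)))).
    exact: is_derive_affine_comp (D2 _).
  - move=> y; apply: cvgZr; apply: cvgZr.
    apply: (@continuous_comp _ _ _ (fun y => k * y + b / (b - a)) d2); last exact: c2.
    by apply: cvgD; [apply: cvgM; [exact: cvg_cst|exact: cvg_id]|exact: cvg_cst].
have E k y : k * ((b - a)^-1) * y + b / (b - a) = (k * y + b) / (b - a) by field; lra.
exists (fun y => d (1 * ((b - a)^-1) * y + b / (b - a)) * d ((-1) * ((b - a)^-1) * y + b / (b - a))).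
  exact: (class12_mul (aff _) (aff _)).
split=> y; rewrite ?E; last first.
- by rewrite mulr_ge0 ?mulr_ile1//; have /andP[] := d01 ((1 * y + b) / (b - a));
    have /andP[] := d01 ((-1 * y + b) / (b - a)).
- rewrite ler_normr => /orP[h|h].
    by rewrite [X in _ * X]d0 ?mulr0// ler_pdivrMr//; lra.
  by rewrite d0 ?mul0r// ler_pdivrMr//; lra.
- by rewrite ler_norml => /andP[h1 h2]; rewrite !d1' ?mulr1// ler_pdivlMr//; lra.
Qed.

Lemma time_step (T : R) : 0 < T -> exists2 th : R -> R, class12 (fun t _ => th t) &
  [/\ forall t, t <= 0 -> th t = 0, forall t, T <= t -> th t = 1 & forall t, 0 <= th t <= 1].
Proof.
move=> /gevrey_step[d [dd d0 d1 d01 _]]; exists (d 0%N); last first.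
  by split=> // [t|t tT]; [exact: d0|have [] := d1 t tT].
apply: (@class12_time R (d 0%N) (d 1%N) (dd 0%N)).
by move=> t; exact: is_derive_scalar_continuous (dd 1%N t).
Qed.

Definition heat (u : R -> R -> R) : Prop := class12 u /\ forall t x, dt u t x = dx (dx u) t x.

Lemma heat_step_up (T : R) : 0 < T -> exists2 phi, heat phi &
  (forall t x, t <= 0 -> phi t x = 0) /\ (forall t x, T <= t -> phi t x = 1).
Proof.
move=> /heat_control_const[phi [phit [phix [/C12_derivs[c e1 _ e2] h0 h1]]]].
by exists phi; split=> // t x; rewrite e1 e2.
Qed.

Lemma heat_id_up (T : R) : 0 < T -> exists2 phi, heat phi &
  (forall t x, t <= 0 -> phi t x = 0) /\ (forall t x, T <= t -> phi t x = x).
Proof.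
move=> /heat_control_id[phi [phit [phix [/C12_derivs[c e1 _ e2] h0 h1]]]].
by exists phi; split=> // t x; rewrite e1 e2.
Qed.

Lemma heat_id_down (T : R) : 0 < T -> exists2 phi, heat phi &
  (forall t x, t <= 0 -> phi t x = x) /\ (forall t x, T <= t -> phi t x = 0).
Proof.
move=> /heat_control_id[phi [phit [phix [[ct cx cxx c0 c1 c2 c3] h0 h1]]]].
exists (fun t x => x - phi t x); last first.
  by split=> t x tT; [rewrite h0// subr0|rewrite h1// subrr].
have : C12 (fun t x => x - phi t x) (fun t x => 0 - phit t x) (fun t x => 1 - phix t x)
    (fun t x => 0 - phit t x).
  split.
  - by move=> t x; exact: (is_deriveB (is_derive_cst (x : R) (t : R) 1) (ct t x)).
  - by move=> t x; exact: (is_deriveB (is_derive_id (x : R) 1) (cx t x)).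
  - by move=> t x; exact: (is_deriveB (is_derive_cst (1 : R) (x : R) 1) (cxx t x)).
  - by move=> z; apply: cvgB; [exact: cvg_snd|exact: c0].
  - by move=> z; apply: cvgB; [exact: cvg_cst|exact: c1].
  - by move=> z; apply: cvgB; [exact: cvg_cst|exact: c2].
  - by move=> z; apply: cvgB; [exact: cvg_cst|exact: c3].
by move=> /C12_derivs[c e1 _ e2]; split=> // t x; rewrite e1 e2.
Qed.

End Profiles.

Definition C2_curve (R : realType) m (g : R -> 'rV[R]_m) : Prop := exists g' g'' : R -> 'rV[R]_m,
  [/\ forall x : R, is_derive x 1 g (g' x), forall x : R, is_derive x 1 g' (g'' x) & continuous g''].

Definition C2_loop (R : realType) m (N : set 'rV[R]_m) (g : R -> 'rV[R]_m) : Prop :=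
  [/\ circle_fun g, forall x, N (g x) & C2_curve g].

(** * Steering between pinched loops *)

Section Steering.
Context {R : realType} (m : nat) (N : set 'rV[R]_m).
Hypotheses (sN : is_submanifold N) (cN : compact N).
Variables (omega : set R) (xs dl : R).
Hypotheses (dl0 : 0 < dl) (dlpi : 3 * dl < pi).
Hypothesis off : forall x, ~ omega x -> `|centered xs x| < pi - 3 * dl.
(** In terms of |centered x|, omega contains everything from pi - 3 dl on. [psi] falls from 1 to 0
    in the first collar of width dl, [chi] in the second, and the third keeps both at 0 near the
    cut. Hence the transition of [psi] takes place where pinched loops are still constant. *)
Variables (chi psi : R -> R).
Hypotheses (c_chi : class12 (fun _ y => chi y)) (c_psi : class12 (fun _ y => psi y)).
Hypotheses (chi1 : forall y, `|y| <= pi - 2 * dl -> chi y = 1)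
  (chi0 : forall y, pi - dl <= `|y| -> chi y = 0)
  (psi1 : forall y, `|y| <= pi - 3 * dl -> psi y = 1)
  (psi0 : forall y, pi - 2 * dl <= `|y| -> psi y = 0)
  (psi01 : forall y, 0 <= psi y <= 1).

Local Notation cen := (centered xs).

Lemma class12_id : class12 (fun _ y : R => y).
Proof.
apply: (@class12_static R R id (cst 1) (cst 0)) => y; exact: cvg_cst.
Qed.

Lemma class12_opp (u : R -> R -> R) : class12 u -> class12 (fun t x => - u t x).
Proof.
move=> cu; have -> : (fun t x => - u t x) = (fun t x => -1 * u t x).
  by apply/funext => t; apply/funext => x; rewrite mulN1r.
exact: (class12_mul (class12_cst _) cu).
Qed.

Lemma C2_translate (g : R -> 'rV[R]_m) (c : R) : C2_curve g -> C2_curve (fun s => g (c + s)).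
Proof.
move=> [g' [g'' [d1 d2 c2]]].
have sh (f : R -> 'rV[R]_m) (f' : 'rV[R]_m) (s : R) : is_derive (c + s) 1 f f' -> is_derive s 1 (fun r => f (c + r)) f'.
  move=> df; have := @is_derive_affine_comp R _ f f' 1 c s.
  rewrite mul1r scale1r addrC => /(_ df).
  by have -> : (fun r => f (1 * r + c)) = (fun r => f (c + r)) by apply/funext => r; rewrite mul1r addrC.
exists (fun s => g' (c + s)), (fun s => g'' (c + s)); split.
- by move=> x; exact: sh (d1 _).
- by move=> x; exact: sh (d2 _).
- move=> x; apply: (@continuous_comp _ _ _ (fun s => c + s) g''); last exact: c2.
  by apply: cvgD; [exact: cvg_cst|exact: cvg_id].
Qed.

Lemma class12_along (y : R -> R -> R) (g : R -> 'rV[R]_m) : class12 y -> C2_curve g ->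
  class12 (fun t x => g (y t x)).
Proof. by move=> cy [g' [g'' [d1 d2 c2]]]; exact: class12_curve cy d1 d2 c2. Qed.

(* Where [chi = 1], which includes the complement of omega, this is
   [b (xs + phi t y)] with [y = centered xs x]; where [chi = 0] it is [b x]. *)
Definition deform (phi : R -> R -> R) (b : R -> 'rV[R]_m) (t x : R) : 'rV[R]_m :=
  b (xs + (cen x + chi (cen x) * (phi t (cen x) - cen x))).

Definition pinch (b : R -> 'rV[R]_m) : R -> 'rV[R]_m := deform (fun _ _ => 0) b 0.

Lemma class12_deform phi b : class12 phi -> C2_loop N b -> class12 (deform phi b).
Proof.
move=> cphi [pb _ cb].
pose v t y := b (xs + (y + chi y * (phi t y - y))).
have cb' := C2_translate xs cb.
apply: (@class12_periodized R m xs v (fun _ y => b (xs + y)) dl dl0).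
- apply: class12_along cb'; apply: class12_add class12_id _; apply: class12_mul c_chi _.
  exact: class12_add cphi (class12_opp class12_id).
- exact: class12_along class12_id cb'.
- by move=> _ y; rewrite addrA pb.
- by move=> t y /chi0 E; rewrite /v E mul0r addr0.
Qed.

Lemma deform_circle phi b t : circle_fun (deform phi b t).
Proof. by move=> x; rewrite /deform wrap_period. Qed.

Lemma deform_id phi b t : circle_fun b -> (forall y, phi t y = y) -> forall x, deform phi b t x = b x.
Proof. by move=> pb E x; rewrite /deform E subrr mulr0 addr0; exact: circle_wrap. Qed.

Lemma deform_zero phi b t : (forall y, phi t y = 0) -> forall x, deform phi b t x = pinch b x.
Proof. by move=> E x; rewrite /pinch /deform E. Qed.

Lemma near_cen_lt (x r : R) : r <= pi -> `|cen x| < r -> \forall y \near x, `|cen y| < r.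
Proof.
move=> rpi xr; have n1 := wrap_near (lt_le_trans xr rpi).
pose b := - xs - (turn xs x)%:~R * (pi *+ 2).
have E : cen x = x + b := nbhs_singleton n1.
have c : {for x, continuous (fun y : R => `|y + b|)}.
  by apply: cvg_norm; apply: cvgD; [exact: cvg_id|exact: cvg_cst].
have n2 : \forall y \near x, `|y + b| < r by apply: (cvgr_lt _ c); rewrite -E.
by apply: filterS2 n1 n2 => y ->.
Qed.

Lemma near_lt (x r : R) : `|x| < r -> \forall y \near x, `|y| < r.
Proof.
have c : {for x, continuous (fun y : R => `|y|)} by apply: cvg_norm; exact: cvg_id.
exact: (cvgr_lt _ c).
Qed.

Let near_snd (P : R -> Prop) (t x : R) : (\forall y \near x, P y) -> nbhs (t, x) (fun y : R * R => P y.2).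
Proof. by move=> H; exact: (@cvg_snd _ _ (nbhs t) (nbhs x) _ P H). Qed.

Definition harmonic_loop (g : R -> 'rV[R]_m) : Prop := exists g' g'' : R -> 'rV[R]_m,
  [/\ circle_fun g, forall x, N (g x),
      [/\ forall x : R, is_derive x 1 g (g' x), forall x : R, is_derive x 1 g' (g'' x) & continuous g''] &
      forall x z, tangent_space N (g x) z -> dot (g'' x) z = 0].

Lemma harmonic_C2_loop g : harmonic_loop g -> C2_loop N g.
Proof. by move=> [g' [g'' [pg Ng c _]]]; split=> //; exists g', g''. Qed.

Lemma lt_window_pi : pi - 3 * dl < pi :> R. Proof. by have := dl0; lra. Qed.

(** Off omega the strict inequality in [off] leaves a neighbourhood on which [chi] is 1; there the
    map is g (xs + phi), and [normal_at_curve] applies. *)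
Lemma admissible_deform phi g : heat phi -> harmonic_loop g -> admissible N omega (deform phi g).
Proof.
move=> [cphi hphi] hg; have lg := harmonic_C2_loop hg.
have [g' [g'' [pg Ng [d1 d2 c2] nor]]] := hg.
split.
- exact: class12_deform.
- exact: deform_circle.
- by move=> t x; exact: Ng.
- move=> t x /off xo; have xpi := lt_trans xo lt_window_pi.
  pose v t y := g (xs + (y + chi y * (phi t y - y))).
  have cy : class12 (fun t y => xs + phi t y) by exact: class12_add (class12_cst _) cphi.
  have cv : class12 v.
    apply: class12_along; last by exists g', g''.
    apply: class12_add (class12_cst _) _; apply: class12_add class12_id _.
    by apply: class12_mul c_chi _; exact: class12_add cphi (class12_opp class12_id).
  apply: (@normal_at_periodized R m N xs v t x cv xpi).
  apply: (@normal_at_agree R m N v (fun t y => g (xs + phi t y))).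
    have := near_snd t (near_lt xo); apply: filterS => -[s y] /= yo.
    rewrite /agree /= /v chi1; last by have := dl0; move/ltW: yo; lra.
    by congr (g _); ring.
  apply: (@normal_at_curve R m N _ g g' g'' t (cen x) cy d1 d2 c2); last exact: nor.
  have [ct cx cxx _ _ _ _] := cphi.
  have C : C12 (fun t y => xs + phi t y) (dt phi) (dx phi) (dx (dx phi)).
    have [_ _ _ c0 c1' c2' c3'] := cphi; split.
    - move=> s y; rewrite -[dt phi s y]add0r.
      exact: (is_deriveD (is_derive_cst (xs : R) (s : R) 1) (ct s y)).
    - move=> s y; rewrite -[dx phi s y]add0r.
      exact: (is_deriveD (is_derive_cst (xs : R) (y : R) 1) (cx s y)).
    - exact: cxx.
    - by move=> z; apply: cvgD; [exact: cvg_cst|exact: c0].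
    - exact: c1'.
    - exact: c2'.
    - exact: c3'.
  by have [_ -> _ ->] := C12_derivs C.
Qed.

Lemma reach_pinch g : harmonic_loop g -> reach N omega g (pinch g).
Proof.
move=> hg T /heat_id_down[phi hphi [p0 p1]].
have [pg _ _] := harmonic_C2_loop hg.
exists (deform phi g); first exact: admissible_deform.
split=> t x tT; first by apply: deform_id => // y; exact: p0.
by apply: deform_zero => y; exact: p1.
Qed.

Lemma reach_unpinch g : harmonic_loop g -> reach N omega (pinch g) g.
Proof.
move=> hg T /heat_id_up[phi hphi [p0 p1]].
have [pg _ _] := harmonic_C2_loop hg.
exists (deform phi g); first exact: admissible_deform.
split=> t x tT; last by apply: deform_id => // y; exact: p1.
by apply: deform_zero => y; exact: p0.
Qed.


Lemma pinch_const b x : `|cen x| <= pi - 2 * dl -> pinch b x = b xs.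
Proof. by move=> /chi1 E; rewrite /pinch /deform E; congr (b _); ring. Qed.

Lemma class12_pinch b : C2_loop N b -> class12 (fun _ x => pinch b x).
Proof.
move=> lb; apply: (@class12_freeze R _ (deform (fun _ _ => 0) b) 0).
exact: class12_deform (class12_cst _) lb.
Qed.

(** Not a genuine superposition: at each x either the pinched loop is at b xs, or [psi] is 0 and,
    for a geodesic starting at b xs, the two copies of b xs cancel. The values therefore stay in
    N. *)
Definition bend (sg b : R -> 'rV[R]_m) (x : R) : 'rV[R]_m :=
  sg (psi (cen x)) + (pinch b x - b xs).

Lemma class12_sub (u v : R -> R -> 'rV[R]_m) :
  class12 u -> class12 v -> class12 (fun t x => u t x - v t x).
Proof.
move=> cu cv; have -> : (fun t x => u t x - v t x) = (fun t x => u t x + (-1 : R) *: v t x).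
  by apply/funext => t; apply/funext => x; rewrite scaleN1r.
exact: class12_add cu (class12_scale (class12_cst _) cv).
Qed.

(** [psi] confines y to a period and phi is constant outside [0, T], so compactness applies. The
    bound decides how long a geodesic is needed. *)
Lemma heat_step_bound (T : R) (phi : R -> R -> R) : heat phi ->
  (forall t x, t <= 0 -> phi t x = 0) -> (forall t x, T <= t -> phi t x = 1) ->
  exists M, forall t y, `|psi y * phi t y| <= M.
Proof.
move=> [[_ _ _ c0 _ _ _] _] p0 p1.
have [M M0 HM] := bounded_on_rectangle 0 T (- pi) pi c0.
exists (M + 1) => t y; have [y01 y02] := andP (psi01 y).
have [ypi|ypi] := lerP `|y| pi; last first.
  rewrite psi0 ?mul0r ?normr0; first by move: M0; lra.
  by have := dl0; move/ltW: ypi; lra.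
rewrite normrM [X in X * _]ger0_norm//.
apply: (@le_trans _ _ `|phi t y|); first by rewrite ler_piMl.
have [t0|t0] := ltP t 0; first by rewrite p0 ?(ltW t0)// normr0; move: M0; lra.
have [tT|tT] := ltP T t; first by rewrite p1 ?(ltW tT)// normr1; move: M0; lra.
have := HM t y; rewrite t0 tT -ler_norml ypi => /(_ erefl erefl) /=; lra.
Qed.

Lemma reach_bend (T M : R) phi b (sg sg' sg'' : R -> 'rV[R]_m) : heat phi ->
  (forall t x, t <= 0 -> phi t x = 0) -> (forall t x, T <= t -> phi t x = 1) ->
  (forall t y, `|psi y * phi t y| <= M) -> C2_loop N b ->
  geodesic_on N (- M) M sg sg' sg'' -> sg 0 = b xs ->
  reach_at N omega T (pinch b) (bend sg b).
Proof.
move=> [cphi hphi] p0 p1 pM lb [d1 d2 c2 geo_N nor] sg0.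
have [pb Nb cb] := lb; have {}c2 : continuous sg'' by apply/coord_continuousP.
have csg : C2_curve sg by exists sg', sg''.
pose v t y := sg (psi y * phi t y).
pose u t x := v t (cen x) + (pinch b x - b xs).
have cv : class12 v by exact: class12_along (class12_mul c_psi cphi) csg.
have cvc : class12 (fun t x => v t (cen x)).
  apply: (@class12_periodized R m xs v (fun _ _ => sg 0) dl dl0 cv (class12_cst _)); first by [].
  by move=> t y yo; rewrite /v psi0 ?mul0r//; have := dl0; move: yo; lra.
exists u; last first.
  split=> t x tT; rewrite /u /v.
    by rewrite p0// mulr0 sg0 addrC subrK.
  by rewrite p1// mulr1.
split.
- exact: class12_add cvc (class12_sub (class12_pinch lb) (class12_cst _)).
- by move=> t x; rewrite /u /pinch deform_circle wrap_period.
- move=> t x; rewrite /u; have [xo|xo] := lerP `|cen x| (pi - 2 * dl).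
    by rewrite pinch_const// subrr addr0; apply: geo_N; rewrite -ler_norml.
  by rewrite /v psi0 ?mul0r ?sg0 ?(ltW xo)// addrC subrK; exact: Nb.
- move=> t x /off xo; have xpi := lt_trans xo lt_window_pi.
  apply: (@normal_at_agree R m N u (fun t x => v t (cen x))).
    have := near_snd t (near_cen_lt (ltW lt_window_pi) xo); apply: filterS => -[s y] /= yo.
    rewrite /agree /= /u pinch_const ?subrr ?addr0//.
    by have := dl0; move/ltW: yo; lra.
  apply: (@normal_at_periodized R m N xs v t x cv xpi).
  apply: (@normal_at_agree R m N v (fun t y => sg (phi t y))).
    have := near_snd t (near_lt xo); apply: filterS => -[s y] /= yo.
    by rewrite /agree /= /v psi1 ?mul1r ?(ltW yo).
  apply: (@normal_at_curve R m N _ sg sg' sg'' t (cen x) cphi d1 d2 c2 (hphi _ _)).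
  apply: nor; rewrite -ler_norml.
  by have := pM t (cen x); rewrite psi1 ?mul1r ?(ltW xo).
Qed.

Lemma reach_at_end (T : R) (g h : R -> 'rV[R]_m) : reach_at N omega T g h ->
  [/\ class12 (fun _ x => h x), circle_fun h & forall x, N (h x)].
Proof.
move=> [u [cu pu Nu _] [_ uh]].
have E : u T = h by apply/funext => x; exact: uh.
rewrite -E; split; [exact: class12_freeze|exact: pu|exact: Nu].
Qed.

Lemma reach_blend (F : 'rV[R]_m -> 'rV[R]_m) e (g h : R -> 'rV[R]_m) : smooth_on setT F ->
  (forall q, N q -> F q = q) -> (forall p q, N p -> `|p - q| < e -> N (F q)) ->
  class12 (fun _ x => g x) -> class12 (fun _ x => h x) -> circle_fun g -> circle_fun h ->
  (forall x, N (g x)) -> (forall x, N (h x)) -> (forall x, `|g x - h x| < e) ->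
  (forall x, ~ omega x -> exists q, \forall y \near x, g y = q /\ h y = q) ->
  reach N omega g h.
Proof.
move=> sF F1 FN cg ch pg ph Ng Nh gh const T T0.
have [th cth [th0 th1 th01]] := time_step T0.
pose a t x := g x + th t *: (h x - g x).
have ca : class12 a by exact: class12_add cg (class12_scale cth (class12_sub ch cg)).
exists (fun t x => F (a t x)); last first.
  split=> t x tT; first by rewrite /a th0// scale0r addr0 F1.
  by rewrite /a th1// scale1r addrC subrK F1.
split.
- exact: class12_smooth sF ca.
- by move=> t x; rewrite /a pg ph.
- move=> t x; apply: (FN (g x)) => //; rewrite /a opprD addNKr normrN normrZ.
  have /andP[h0 h1] := th01 t; rewrite ger0_norm//.
  by apply: le_lt_trans (gh x); rewrite distrC ler_piMl.
- move=> t x xo; have [q Hq] := const x xo.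
  apply: (@normal_at_agree R m N _ (fun _ _ => F q)); last exact: normal_at_cst.
  have := near_snd t Hq; apply: filterS => -[s y] /= [gq hq].
  by rewrite /agree /= /a gq hq subrr scaler0 addr0.
Qed.

Lemma reach_pinch_near : exists2 eta, 0 < eta & forall b b', C2_loop N b -> C2_loop N b' ->
  (forall x, `|b x - b' x| <= eta) -> reach N omega (pinch b) (pinch b').
Proof.
have [F [sF F1 [e e0 FN]]] := global_retraction sN cN.
have e4 : 0 < e / 4 by rewrite divr_gt0.
have [d d0 Hd] := long_geodesic sN cN e4.
exists (Num.min d (e / 2)) => [|b b' lb lb' bb' T T0]; first by rewrite lt_min d0 divr_gt0.
have bd x : `|b' x - b x| <= d by rewrite distrC; apply: le_trans (bb' x) _; rewrite ge_min lexx.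
have be x : `|b x - b' x| <= e / 2 by apply: le_trans (bb' x) _; rewrite ge_min lexx orbT.
have [pb Nb cb] := lb; have [pb' Nb' cb'] := lb'.
have T3 : 0 < T / 3 by rewrite divr_gt0.
have [phi hphi [p0 p1]] := heat_step_up T3.
have [M HM] := heat_step_bound hphi p0 p1.
have [sg [sg' [sg'' [geo sg0 sg1 sge]]]] := Hd _ _ M (Nb xs) (Nb' xs) (bd xs).
have r1 := reach_bend hphi p0 p1 HM lb geo sg0.
apply: (reach_at_trans T0 r1); apply: (reach_blend sF F1 FN) => //.
- by have [] := reach_at_end r1.
- exact: class12_pinch.
- by have [] := reach_at_end r1.
- exact: deform_circle.
- by have [] := reach_at_end r1.
- by move=> x; exact: Nb'.
(* Only the state after the first move enters, with geodesic parameter [psi] in [0, 1]. The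
   overshoot of phi is irrelevant here, and the distance is at most e/4 + e/2. *)
- move=> x; rewrite /bend.
  have -> : sg (psi (cen x)) + (pinch b x - b xs) - pinch b' x =
    - (b xs - sg (psi (cen x))) + (pinch b x - pinch b' x).
    by apply/rowP => i; rewrite !mxE; ring.
  apply: le_lt_trans (ler_normD _ _) _; rewrite normrN.
  have := sge _ (psi01 (cen x)).
  have : `|pinch b x - pinch b' x| <= e / 2 by exact: be.
  by move: e0; lra.
- move=> x /off xo; exists (b' xs).
  have := near_cen_lt (ltW lt_window_pi) xo; apply: filterS => y yo.
  have y2 : `|cen y| <= pi - 2 * dl by have := dl0; move/ltW: yo; lra.
  by rewrite /bend !pinch_const// psi1 ?(ltW yo)// sg1 subrr addr0.
Qed.

End Steering.

(** * Regularity of harmonic maps and smoothing of loops *)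

Section HarmonicRegularity.
Context {R : realType} (m : nat) (N : set 'rV[R]_m).
Hypothesis sN : is_submanifold N.

(** Nothing bounds v a priori. Since K is small near x0, |v - A| <= e |v| there; e = 1/2 gives a
    local bound on v, after which arbitrary e gives the limit. *)
Lemma continuous_perturbed_fixpoint (v A : R -> 'rV[R]_m) (K : R -> 'M[R]_m) (x0 : R) :
  {for x0, continuous A} -> (forall i j, {for x0, continuous (fun x => K x i j)}) -> K x0 = 0 ->
  (\forall x \near x0, v x = v x *m K x + A x) -> {for x0, continuous v}.
Proof.
move=> cA cK K0 H; have v0 : v x0 = A x0.
  by have := nbhs_singleton H; rewrite K0 mulmx0 add0r.
have small e : 0 < e -> \forall x \near x0, `|v x - A x| <= e * `|v x|.
  move=> e0; pose e' := e / (m%:R + 1).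
  have m1 : 0 < m%:R + 1 :> R by rewrite ltr_wpDl.
  have e'0 : 0 < e' by rewrite divr_gt0.
  have HK : \forall x \near x0, forall i j, `|K x i j| <= e'.
    apply: near_forall => i; apply: near_forall => j.
    have := cK i j => /cvgrPdist_le/(_ _ e'0); apply: filterS => x.
    by rewrite K0 mxE sub0r normrN.
  apply: filterS2 H HK => x E HKx; rewrite {1}E addrK.
  apply: row_norm_le => [|j]; first by rewrite mulr_ge0// ltW.
  rewrite mxE; apply: le_trans (ler_norm_sum _ _ _) _.
  apply: le_trans (_ : _ <= \sum_(i < m) `|v x| * e') _.
    by apply: ler_sum => i _; rewrite normrM ler_pM//; exact: coord_le_norm.
  rewrite sumr_const card_ord -mulr_natr -mulrA mulrC ler_wpM2r//.
  by rewrite /e' mulrAC ler_pdivrMr// ler_wpM2l ?(ltW e0)// lerDl.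
have bound : \forall x \near x0, `|v x| <= 2 * (`|A x0| + 1).
  have h2 : 0 < 2^-1 :> R by rewrite invr_gt0.
  move/cvgrPdist_le: (cA) => /(_ _ ltr01) n1; apply: filterS2 n1 (small _ h2) => x a b.
  have t1 := ler_normD (v x - A x) (A x); rewrite subrK in t1.
  have t2 := ler_normD (A x - A x0) (A x0); rewrite subrK distrC in t2.
  by move: a b t1 t2; lra.
apply/cvgrPdist_le => e e0; pose B := 2 * (`|A x0| + 1).
have B0 : 0 < B by rewrite mulr_gt0// ltr_wpDl.
have e2 : 0 < e / 2 by rewrite divr_gt0.
have eB : 0 < e / 2 / B by rewrite divr_gt0.
move/cvgrPdist_le: (cA) => /(_ _ e2) n1.
near=> x.
have b1 : `|v x| <= B by near: x; exact: bound.
have b2 : `|v x - A x| <= e / 2 / B * `|v x| by near: x; exact: small.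
have b3 : `|A x0 - A x| <= e / 2 by near: x; exact: n1.
have b4 : e / 2 / B * `|v x| <= e / 2.
  by rewrite -[leRHS](divfK (lt0r_neq0 B0)) ler_wpM2l// ltW.
have -> : v x0 - v x = (A x0 - A x) - (v x - A x) by rewrite v0 opprB addrA subrK.
by apply: le_trans (ler_normB _ _) _; move: b2 b3 b4; lra.
Unshelve. all: by end_near.
Qed.


(** The definition provides a second derivative, and its continuity must be recovered. With E the
    Jacobian of the local retraction at g x, normality gives g'' = g'' (E - E^T) + D^2 Pi (g', g'),
    and E - E^T vanishes at x0. *)
Lemma harmonic_map_loop (g : R -> 'rV[R]_m) : harmonic_map N g -> harmonic_loop N g.
Proof.
move=> [pg Ng dg dg' eqg]; set g' := derive1 g in dg' eqg *; pose g'' := derive1 g'.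
have D1 (x : R) : is_derive x 1 g (g' x) by rewrite /g' derive1E; apply: DeriveDef.
have D2 (x : R) : is_derive x 1 g' (g'' x) by rewrite /g'' derive1E; apply: DeriveDef.
have nN (x : R) : \forall y \near x, N (g y) by exact: (@filterE _ (nbhs x) _ _ Ng).
have nd (x : R) : \forall y \near x, is_derive (y : R) 1 g (g' y).
  exact: (@filterE _ (nbhs x) _ _ D1).
have nor x z : tangent_space N (g x) z -> dot (g'' x) z = 0.
  have [r [P [Pi H]]] := submanifold_adapted_retraction sN (Ng x).
  have [_ _ E] := curve_second_fund_form (Ng x) H (nN x) (nd x) (D2 x) erefl.
  apply: (normal_iff (Ng x) H (g'' x)).2; rewrite -E -eqg.
  by rewrite /derive1n /= addrN.
exists g', g''; split; [exact: pg|exact: Ng| |exact: nor].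
split; [exact: D1|exact: D2|move=> x0].
have [r [P [Pi H]]] := submanifold_adapted_retraction sN (Ng x0).
have oB : open (ball (g x0) r) by exact: ball_open.
have sPi := ret_smooth H.
have bx0 : ball (g x0) r (g x0) by apply: ballxx; exact: ret_gt0 H.
have nB : \forall x \near x0, ball (g x0) r (g x) by exact: is_derive_near (D1 x0) oB bx0.
have cdir (G : 'rV[R]_m -> 'rV[R]_m) : smooth_on (ball (g x0) r) G ->
    {for x0, continuous (fun x => G (g x))}.
  move=> sG; apply: (@continuous_comp _ _ _ g G); first exact: is_derive_continuous (D1 x0).
  exact: smooth_on_continuous sG bx0.
pose A x := \sum_(i < m) \sum_(k < m) (g' x 0 i * g' x 0 k) *: 'D_(delta_mx 0 i) ('D_(delta_mx 0 k) Pi) (g x).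
pose K x := \matrix_(i < m, j < m) ('D_(delta_mx 0 i) Pi (g x) 0 j - 'D_(delta_mx 0 j) Pi (g x) 0 i).
have cg' i : {for x0, continuous (fun x => g' x 0 i)}.
  by apply: is_derive_scalar_continuous; exact: is_derive_component (D2 x0).
apply: (@continuous_perturbed_fixpoint g'' A K x0).
- apply: continuous_bigsum => i; apply: continuous_bigsum => k.
  apply: cvgZ; first by apply: cvgM; [exact: cg'|exact: cg'].
  exact: (cdir _ (smooth_on_derive _ (smooth_on_derive _ sPi))).
- move=> i j.
  have -> : (fun x => K x i j) = (fun x => 'D_(delta_mx 0 i) Pi (g x) 0 j - 'D_(delta_mx 0 j) Pi (g x) 0 i).
    by apply/funext => x; rewrite mxE.
  have c (k l : 'I_m) : {for x0, continuous (fun x => 'D_(delta_mx 0 k) Pi (g x) 0 l)}.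
    apply: (@continuous_comp _ _ _ (fun x => 'D_(delta_mx 0 k) Pi (g x)) (fun w : 'rV[R]_m => w 0 l)).
      exact: cdir (smooth_on_derive _ sPi).
    exact: coord_continuous.
  by apply: cvgB; exact: c.
- have E a b : ((delta_mx 0 a : 'rV[R]_m) *m P) 0 b = P a b by rewrite -rowE mxE.
  apply/matrixP => i j; rewrite [LHS]mxE !(ret_derive_center H) !E mxE.
  have -> : P j i = P^T i j by rewrite mxE.
  by rewrite (ret_sym H) subrr.
- move: nB; apply: filterS => x bx.
  have acc := curve_acceleration H (nN x) (nd x) (D2 x) bx.
  have -> : A x = 'D_(g' x) ('D_(g' x) Pi) (g x).
    rewrite derive_rV_dir; last exact: smooth_on_diff (smooth_on_derive _ sPi) bx.
    apply: eq_bigr => i _; rewrite (derive_sum_coord _ _ oB sPi bx) scaler_sumr.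
    apply: eq_bigr => k _; rewrite scalerA; reflexivity.
  rewrite {1}acc; congr (_ + _); rewrite derive_rV_dir; last exact: ret_diff H _ bx.
  apply/rowP => j; rewrite summxE mxE.
  have n0 : \sum_i g'' x 0 i * 'D_(delta_mx 0 j) Pi (g x) 0 i = 0.
    exact: (nor x _ (tangent_derive H _ bx (Ng x))).
  transitivity (\sum_i (g'' x 0 i * 'D_(delta_mx 0 i) Pi (g x) 0 j)
      - \sum_i g'' x 0 i * 'D_(delta_mx 0 j) Pi (g x) 0 i).
    by rewrite n0 subr0; apply: eq_bigr => i _; rewrite mxE.
  by rewrite -sumrB; apply: eq_bigr => i _; rewrite mxE mulrBr.
Qed.

End HarmonicRegularity.

(** * Approximation by loops of class C^2 *)

Section Smoothing.
Context {R : realType} (m : nat) (N : set 'rV[R]_m).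
Hypotheses (sN : is_submanifold N) (cN : compact N).

Lemma average_circle a (f : R -> R) : continuous f -> circle_fun f -> circle_fun (average a f).
Proof.
move=> cf pf x; rewrite /average; congr (_ / _); rewrite addrAC.
apply: (@derive_eq_diff R (fun s => prim f (s + pi *+ 2)) (prim f) f) => s _; last exact: is_derive_prim.
have := @is_derive_affine_comp R _ (prim f) (f s) 1 (pi *+ 2) s.
rewrite mul1r scale1r -{1}(pf s) => /(_ (is_derive_prim _ cf)).
by have -> : (fun r => prim f (1 * r + pi *+ 2)) = (fun r => prim f (r + pi *+ 2))
  by apply/funext => r; rewrite mul1r.
Qed.

Lemma C2_curveP (g : R -> 'rV[R]_m) : C2_curve g <-> class12 (fun _ x => g x).
Proof.
split=> [[g' [g'' [d1 d2 c2]]]|[_ cx cxx _ _ _ c3]]; first exact: class12_static d1 d2 c2.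
exists (dx (fun _ => g) 0), (dx (dx (fun _ => g)) 0); split; [exact: cx|exact: cxx|].
exact: (@continuous_prod_left R _ (fun z : R * R => dx (dx (fun _ x => g x)) z.1 z.2) 0 c3).
Qed.

Lemma C2_double_average a (g : R -> 'rV[R]_m) : (forall i, continuous (fun x => g x 0 i)) ->
  C2_curve (fun x => \row_i average a (average a (fun x => g x 0 i)) x).
Proof.
move=> cg; pose f i (x : R) : R := g x 0 i; have ca i := @average_continuous R a _ (cg i).
have shift (h : R -> R) : continuous h -> continuous (fun x => h (x - a)).
  move=> ch x; apply: (@continuous_comp _ _ _ (fun x => x - a) h); last exact: ch.
  by apply: cvgB; [exact: cvg_id|exact: cvg_cst].
pose q (h : R -> R) x := (h x - h (x - a)) / a.
have dq (h h' : R -> R) : (forall x : R, is_derive x 1 h (h' x)) -> forall x : R, is_derive x 1 (q h) (q h' x).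
  move=> dh x; have := is_derive_mul (is_deriveB (dh x) (is_derive_shift_comp (dh (x - a))))
    (is_derive_cst (a^-1 : R) (x : R) 1).
  by rewrite mulr0 addr0.
exists (fun x => \row_i q (average a (f i)) x), (fun x => \row_i q (q (f i)) x); split.
- move=> x; apply: is_derive_components => i; rewrite mxE.
  have -> : (fun t => (\row_i0 average a (average a (fun x0 => g x0 0 i0)) t) 0 i) = average a (average a (f i)).
    by apply/funext => t; rewrite mxE.
  exact: is_derive_average (ca i).
- move=> x; apply: is_derive_components => i; rewrite mxE.
  have -> : (fun t => (\row_i0 q (average a (f i0)) t) 0 i) = q (average a (f i)).
    by apply/funext => t; rewrite mxE.
  by apply: dq => y; exact: is_derive_average (cg i).
- apply: coord_continuous_into => i.
  have -> : (fun z => (\row_i0 q (q (f i0)) z) 0 i) = q (q (f i)) by apply/funext => t; rewrite mxE.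
  have cq (h : R -> R) : continuous h -> continuous (q h).
    move=> ch x; apply: cvgM; last exact: cvg_cst.
    by apply: cvgB; [exact: ch|exact: shift ch x].
  exact: cq (cq _ (cg i)).
Qed.

Lemma double_average_near (g : R -> 'rV[R]_m) e : continuous g -> circle_fun g -> 0 < e ->
  exists2 a, 0 < a & forall x, `|(\row_i average a (average a (fun x => g x 0 i)) x) - g x| <= e.
Proof.
move=> cg pg e0; have c : continuous (fun z : R * R => g (z.2 - z.1)).
  move=> z; apply: (@continuous_comp _ _ _ (fun z : R * R => z.2 - z.1) g); last exact: cg.
  by apply: cvgB; [exact: cvg_snd|exact: cvg_fst].
have [d /= d0 Hd] := uniformly_near 0 (- pi) pi c e0.
have {}Hd s x : 0 <= s < d -> `|g (x - s) - g x| <= e.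
  move=> /andP[s0 sd]; have bs : ball (0 : R) d s by rewrite -ball_normE /= sub0r normrN ger0_norm.
  have /andP[h1 h2] := wrap_bound 0 x.
  have := Hd s bs (centered 0 x); rewrite /= subr0 h1 (ltW h2) => /(_ erefl).
  have ps : circle_fun (fun y => g (y - s)) by move=> r; rewrite addrAC pg.
  by have := circle_wrap 0 x pg; have := circle_wrap 0 x ps; rewrite add0r => -> ->.
(* Each coordinate of the double average is a value of g at some point of [x - 2a, x], and 2a = d/2
   < d. *)
exists (d / 4); first by rewrite divr_gt0.
move=> x; apply: row_norm_le => [|i]; first exact: ltW.
have cgi : continuous (fun x => g x 0 i) by have /coord_continuousP := cg; exact.
have a0 : 0 < d / 4 by rewrite divr_gt0.
have [y hy ey] := average_point x a0 (@average_continuous R (d / 4) _ cgi).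
have [z hz ez] := average_point y a0 cgi.
rewrite !mxE ey ez; have := coord_le_norm (g z - g x) i; rewrite !mxE => /le_trans; apply.
have -> : z = x - (x - z) by ring.
by apply: Hd; move: hy hz d0 => /andP[? ?] /andP[? ?] ?; apply/andP; split; lra.
Qed.

Lemma retraction_uniform (F : 'rV[R]_m -> 'rV[R]_m) e : continuous F -> (forall q, N q -> F q = q) ->
  0 < e -> exists2 d, 0 < d & forall p q, N p -> `|p - q| < d -> `|F q - p| <= e.
Proof.
move=> cF F1 e0.
have [||d d0 Hd] := @compact_uniform_radius R m N cN (fun d p => forall q, `|p - q| < d -> `|F q - p| <= e).
- by move=> r r' p _ r'r H q pq; apply: H; exact: lt_le_trans r'r.
- move=> p0 Np0; have e2 : 0 < e / 2 by rewrite divr_gt0.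
  have /cvgrPdist_le/(_ _ e2) := cF p0; rewrite F1// => /nbhs_ballP[r /= r0 Hr].
  exists (Num.min (r / 2) (e / 2)) => [|p Np]; first by rewrite lt_min !divr_gt0.
  rewrite lt_min => /andP[p1 p2] q; rewrite lt_min => /andP[q1 q2].
  have b : ball p0 r q.
    rewrite -ball_normE /= -(subrKA p); apply: le_lt_trans (ler_normD _ _) _.
    by move: p1 q1; lra.
  have := Hr q b; rewrite -(subrKA p0 (F q) (- p)) distrC => h.
  by apply: le_trans (ler_normD _ _) _; move: p2; lra.
- by exists d => // p q Np; exact: Hd.
Qed.

Lemma smooth_approximation (g : R -> 'rV[R]_m) eta : continuous g -> circle_fun g ->
  (forall x, N (g x)) -> 0 < eta -> exists2 b, C2_loop N b & forall x, `|b x - g x| <= eta.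
Proof.
move=> cg pg Ng eta0; have [F [sF F1 [e e0 FN]]] := global_retraction sN cN.
have cF : continuous F by move=> q; exact: smooth_on_continuous sF I.
have [d d0 Hd] := retraction_uniform cF F1 eta0.
have e'0 : 0 < Num.min e d / 2 by rewrite divr_gt0// lt_min e0.
have [a a0 Ha] := double_average_near cg pg e'0.
have cgi i : continuous (fun x => g x 0 i) by have /coord_continuousP := cg; exact.
pose b0 x := \row_i average a (average a (fun x => g x 0 i)) x.
have near0 x : `|g x - b0 x| < Num.min e d.
  by have := Ha x; rewrite distrC => h; apply: le_lt_trans h _; move: e'0; lra.
exists (fun x => F (b0 x)); last by move=> x; apply: Hd => //; apply: lt_le_trans (near0 x) _; rewrite ge_min lexx orbT.
split.
- move=> x; congr (F _); apply/rowP => i; rewrite !mxE; apply: average_circle.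
    exact: average_continuous.
  by apply: average_circle => // y; rewrite pg.
- by move=> x; apply: (FN (g x)) => //; apply: lt_le_trans (near0 x) _; rewrite ge_min lexx.
- by apply/C2_curveP; apply: class12_smooth sF _; apply/C2_curveP; exact: C2_double_average.
Qed.

End Smoothing.

(** * Conclusion *)

Section UniformChain.
Context {R : realType} (m : nat).

Lemma uniform_ball_nbhs (g : {uniform R -> 'rV[R]_m}) e : 0 < e ->
  nbhs g [set h : {uniform R -> 'rV[R]_m} | forall x : R, `|(g : R -> 'rV[R]_m) x - (h : R -> 'rV[R]_m) x| <= e].
Proof.
move=> e0; apply/uniform_nbhs; exists [set xy : 'rV[R]_m * 'rV[R]_m | ball xy.1 e xy.2].
split; first by rewrite -(@entourage_ballE R); exists e.
move=> h H x; have := H x I; rewrite /= -ball_normE /=; exact: ltW.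
Qed.

(** Within B, no point of S is e-close to a point outside S, so B meets S and its complement in two
    relatively open sets. The interiors of their e-thickenings supply the open and the closed set
    that connectedness asks for. *)
Lemma connected_chain (B S : set {uniform R -> 'rV[R]_m}) e (g0 g1 : {uniform R -> 'rV[R]_m}) :
  0 < e -> connected B -> B g0 -> B g1 -> S g0 ->
  (forall g h, B g -> B h -> (forall x : R, `|(g : R -> 'rV[R]_m) x - (h : R -> 'rV[R]_m) x| <= e) ->
     S g -> S h) -> S g1.
Proof.
move=> e0 cB B0 B1 S0 close.
pose thick (A : set {uniform R -> 'rV[R]_m}) : set {uniform R -> 'rV[R]_m} :=
  [set h | exists2 g : {uniform R -> 'rV[R]_m}, A g &
    forall x : R, `|(g : R -> 'rV[R]_m) x - (h : R -> 'rV[R]_m) x| <= e].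
have thick_int A : A `<=` (thick A)^°.
  by move=> g Ag; have := uniform_ball_nbhs g e0; apply: filterS => h Hh; exists g.
have sym (g h : {uniform R -> 'rV[R]_m}) :
    (forall x : R, `|(g : R -> 'rV[R]_m) x - (h : R -> 'rV[R]_m) x| <= e) ->
    forall x : R, `|(h : R -> 'rV[R]_m) x - (g : R -> 'rV[R]_m) x| <= e.
  by move=> H x; rewrite distrC.
suff E : B `&` S = B by have : (B `&` S) g1; [rewrite E|case].
apply: cB; first by exists g0.
  exists (thick (B `&` S))^°; first exact: open_interior.
  apply/seteqP; split=> g [Bg Sg]; split=> //; first by apply: thick_int.
  have [h [Bh Sh] H] := interior_subset Sg; exact: close Bh Bg H Sh.
exists (~` (thick (B `&` ~` S))^°); first by apply: open_closedC; exact: open_interior.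
apply/seteqP; split=> g [Bg Sg]; split=> //.
  move=> /interior_subset[h [Bh nSh] H]; apply: nSh; exact: close Bg Bh (sym _ _ H) Sg.
by apply: contrapT => nSg; apply: Sg; apply: thick_int.
Qed.

End UniformChain.

Section Window.
Context {R : realType}.

(** Centering at the antipode w + pi places the cut at w, in the middle of the arc contained in
    omega. *)
Lemma centered_window (omega : set R) (w d : R) : circle_fun omega ->
  (forall x, `|w - x| < d -> omega x) ->
  forall x, ~ omega x -> `|centered (w + pi) x| <= pi - d.
Proof.
move=> po Ho x nx; rewrite leNgt; apply/negP => H; apply: nx.
have /andP[b1 b2] := wrap_bound (w + pi) x.
have p0 := @pi_gt0 R.
have E : x = w + pi + centered (w + pi) x + (turn (w + pi) x)%:~R * (pi *+ 2).
  by rewrite /centered; ring.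
move: H; rewrite ltr_normr => /orP[H|H].
  have {}E : x = w - (pi - centered (w + pi) x) + (turn (w + pi) x + 1)%:~R * (pi *+ 2).
    by rewrite {1}E intrD; ring.
  rewrite E (circle_fun_int _ _ po); apply: Ho.
  by rewrite opprB addrC subrK ltr_norml; apply/andP; split; lra.
rewrite E (circle_fun_int _ _ po); apply: Ho.
by rewrite ltr_norml; apply/andP; split; lra.
Qed.

End Window.

Section Conclusion.
Context {R : realType} (m : nat) (N : set 'rV[R]_m).
Hypotheses (sN : is_submanifold N) (cN : compact N).

Lemma reach_harmonic (omega : set R) (g0 g1 : R -> 'rV[R]_m) :
  circle_fun omega -> open omega -> omega !=set0 -> harmonic_map N g0 -> harmonic_map N g1 ->
  connected_component (C0_circle N) g0 g1 -> reach N omega g0 g1.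
Proof.
move=> po oo [w ow] /(harmonic_map_loop sN) h0 /(harmonic_map_loop sN) h1 [B [B0 BC cB] B1].
have [d /= d0 Hd] := (nbhs_ballP w omega).1 (open_nbhs_nbhs (conj oo ow)).
have p0 := @pi_gt0 R.
(* Off omega this gives |centered| <= pi - d <= pi - 4 dl < pi - 3 dl; the bound by pi keeps the
   collars within a half-period. *)
pose dl := Num.min d pi / 4.
have dl0 : 0 < dl by rewrite divr_gt0// lt_min d0.
have dld : 4 * dl <= d by rewrite mulrC divfK// ge_min lexx.
have dlpi : 4 * dl <= pi by rewrite mulrC divfK// ge_min lexx orbT.
have off x : ~ omega x -> `|centered (w + pi) x| < pi - 3 * dl.
  move=> /(@centered_window R omega w d po _ x) H; have {H}H : `|centered (w + pi) x| <= pi - d.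
    by apply: H => y yw; apply: Hd; rewrite -ball_normE.
  by move: H; lra.
have [chi cchi [chi1 chi0 _]] : exists2 chi : R -> R, class12 (fun _ y => chi y) &
  [/\ forall y, `|y| <= pi - 2 * dl -> chi y = 1, forall y, pi - dl <= `|y| -> chi y = 0 &
      forall y, 0 <= chi y <= 1] by apply: cutoff_exists; lra.
have [psi cpsi [psi1 psi0 psi01]] : exists2 psi : R -> R, class12 (fun _ y => psi y) &
  [/\ forall y, `|y| <= pi - 3 * dl -> psi y = 1, forall y, pi - 2 * dl <= `|y| -> psi y = 0 &
      forall y, 0 <= psi y <= 1] by apply: cutoff_exists; lra.
have [eta eta0 near] := reach_pinch_near sN cN dl0 off cchi cpsi chi1 chi0 psi1 psi0 psi01.
have start := reach_pinch dl0 off cchi chi1 chi0 h0.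
have finish := reach_unpinch dl0 off cchi chi1 chi0 h1.
have l0 := harmonic_C2_loop h0; have l1 := harmonic_C2_loop h1.
pose P (b : R -> 'rV[R]_m) := pinch (w + pi) chi b.
have eta4 : 0 < eta / 4 by rewrite divr_gt0.
(* g itself need not be C^2. For eta/4-close g and h, the chain b, g, h, b' has three gaps of eta/4,
   within the tolerance eta of [near]. *)
pose S (g : {uniform R -> 'rV[R]_m}) := exists b, [/\ C2_loop N b,
  forall x : R, `|b x - (g : R -> 'rV[R]_m) x| <= eta / 4 & reach N omega g0 (P b)].
have [b [lb bg1 r]] : S g1.
  apply: (connected_chain eta4 cB B0 B1).
    by exists g0; split=> // x; rewrite subrr normr0 ltW.
  move=> g h Bg Bh gh [b [lb bg r]]; have [ph ch Nh] := BC _ Bh.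
  have [b' lb' bh] := smooth_approximation sN cN ch ph Nh eta4.
  exists b'; split=> //; apply: reach_trans r _; apply: near => // x.
  have -> : b x - b' x = (b x - (g : R -> 'rV[R]_m) x) +
      (((g : R -> 'rV[R]_m) x - (h : R -> 'rV[R]_m) x) - (b' x - (h : R -> 'rV[R]_m) x)).
    by apply/rowP => i; rewrite !mxE; ring.
  apply: le_trans (ler_normD _ _) _; have := ler_normB ((g : R -> 'rV[R]_m) x - (h : R -> 'rV[R]_m) x) (b' x - (h : R -> 'rV[R]_m) x).
  by have := bg x; have := gh x; have := bh x; move: eta0; lra.
apply: reach_trans r _; apply: reach_trans finish; apply: near => // x.
by apply: le_trans (bg1 x) _; move: eta0; lra.
Qed.

End Conclusion.

Theorem theorem1p13 (R : realType) (m : nat) (N : set 'rV[R]_m)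
  (N_submanifold : is_submanifold N) (N_compact : compact N)
  (omega : set R) (omega_circle : circle_fun omega)
  (omega_open : open omega) (omega_nonempty : omega !=set0)
  (T : R) (T_gt0 : 0 < T)
  (gamma0 gamma1 : R -> 'rV[R]_m)
  (gamma0_harmonic : harmonic_map N gamma0) (gamma1_harmonic : harmonic_map N gamma1)
  (same_component : connected_component (C0_circle N) gamma0 gamma1) :
  exists2 f : R -> R -> 'rV[R]_m, in_LooL2 T f &
    exists u : R -> R -> 'rV[R]_m,
      [/\ is_solution N omega T f u,
          (forall x, u 0 x = gamma0 x) &
          (forall x, u T x = gamma1 x)].
Proof.
have [u [cu pu Nu nu] [u0 u1]] := reach_harmonic N_submanifold N_compact omega_circle
  omega_open omega_nonempty gamma0_harmonic gamma1_harmonic same_component T_gt0.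
have [fL2 sol] := strong_solution_C12 T_gt0 N_submanifold omega_circle cu pu Nu
  (fun t x _ ox => nu t x ox).
exists (fun t x => dt u t x - dx (dx u) t x) => //; exists u; split.
- by exists (dt u), (dx u), (dx (dx u)).
- by move=> x; exact: u0.
- by move=> x; exact: u1.
Qed.
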